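(* For every environment $\Gamma=(c,\mu)$, $$\mathbf{\Pi}^*_{fb}(\Gamma)=\{(\pi_b,\pi_s):\pi_b\ge0,\ \pi_s\ge\underline{\pi}_s(\Gamma),\ \pi_b+\pi_s\le S(\Gamma),\ \pi_s\ge\underline{\pi}_s^{fb}(\Gamma)\}.$$
   Context: Environment: $V\subset\mathbb{R}$ compact with $\underline v=\min V<\max V=\overline v$; $\mu$ a probability measure with support $V$; $c:V\to\mathbb{R}$ continuous with $v-c(v)\ge0$ on $V$ and $\mathbb{E}_\mu[v-c(v)]>0$. $S(\Gamma)=\mathbb{E}[v-c(v)]$, $\underline{\pi}_s(\Gamma)=\max\{\underline v-\mathbb{E}[c(v)],0\}$, and $\underline{\pi}_s^{fb}(\Gamma)=\sup_{p\in\mathbb{R}}\int_{\{v\ge p\}}(p-c(v))\mu(dv)$. An information structure $\tau$: complete separable metric spaces $T_s,T_b$ and a probability $P$ on $T_s\times T_b\times V$ with $V$-marginal $\mu$. Game: $(t_s,t_b,v)\sim P$; Seller observes $t_s$ and posts $p\in\mathbb{R}$; Buyer observes $t_b$ and $p$, accepts (payoffs $v-p$ to Buyer, $p-c(v)$ to Seller) or rejects (both $0$). Seller uses a distributional strategy $\sigma$; Buyer uses $\alpha:\mathbb{R}\times T_b\to[0,1]$; Buyer's beliefs $\nu(\cdot|p,t_b)\in\Delta(V)$. A wPBE requires: $\alpha(p,t_b)=1$ if $\mathbb{E}_{\nu(\cdot|p,t_b)}[v]>p$ and $=0$ if $<p$, for every $(p,t_b)$; Seller's strategy maximizes her ex ante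 expected payoff given $\alpha$; beliefs satisfy Bayes rule on path. A wPBE has price-independent beliefs if for every $p$ and every measurable $D\subset T_b\times V$, $\int_D\nu(dv|p,t_b)P(T_s,dt_b,V)=\int_D P(T_s,dt_b,dv)$. $\tau$ has fully-informed Buyer if $T_b=V$ and $P(v=t_b\mid t_b)=1$. $\mathbf{\Pi}^*_{fb}(\Gamma)$ is the set of ex ante payoff pairs $(\pi_b,\pi_s)$ of wPBE with price-independent beliefs under some fully-informed-Buyer information structure. *)

(* Defs.v *)
From HB Require Import structures.
From mathcomp Require Import all_boot all_order all_algebra.
From mathcomp Require Import all_classical all_reals all_analysis.
Set Implicit Arguments. Unset Strict Implicit. Unset Printing Implicit Defensive.
Import Order.TTheory GRing.Theory Num.Theory.
Import numFieldNormedType.Exports.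
Local Open Scope classical_set_scope.
Local Open Scope ring_scope.
Local Open Scope ereal_scope.

Definition msupport (R : realType) (mu : set R -> \bar R) : set R :=
  [set x | forall U : set R, open U -> U x -> 0 < mu U].

Definition separable_space (T : topologicalType) : Prop :=
  exists D : set T, countable D /\ closure D = setT.

Notation borelT T := (g_sigma_algebraType (@open T)).

Section Game.
Variables (R : realType) (c : R -> R).
Variables (T : ptopologicalType).
(* outcome space: ((t_s, t_b), v) *)
Local Notation Om := ((borelT T * R) * R)%type.
Variable P : probability Om R.

Definition surplus (mu : probability R R) : \bar R := \int[mu]_v (v - c v)%:E.
Definition pis_low (vlo : R) (mu : probability R R) : \bar R :=
  maxe (vlo%:E - \int[mu]_v (c v)%:E) 0.
Definition pis_fb (mu : probability R R) : \bar R :=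
  ereal_sup (range (fun p : R =>
    \int[mu]_(v in [set v : R | (p <= v)%R]) (p - c v)%:E)).

Definition V_marginal (mu : probability R R) : Prop :=
  forall B : set R, measurable B -> P [set w : Om | B w.2] = mu B.
Definition fully_informed : Prop := P [set w : Om | w.1.2 = w.2] = 1.

(** Expectation of f(t_s,t_b,v,p) under the joint law of P and the
    (behavioural) seller strategy sigma : T_s -> Delta(R). *)
Definition jointE (sigma : R.-pker borelT T ~> R)
  (f : Om -> R -> \bar R) : \bar R :=
  \int[P]_w \int[sigma w.1.1]_p f w p.

Definition buyer_payoff (sigma : R.-pker borelT T ~> R) (alpha : R * R -> R) :=
  jointE sigma (fun w p => (alpha (p, w.1.2) * (w.2 - p))%:E).
Definition seller_payoff (sigma : R.-pker borelT T ~> R) (alpha : R * R -> R) :=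
  jointE sigma (fun w p => (alpha (p, w.1.2) * (p - c w.2))%:E).

Definition belief_mean (nu : R.-pker (R * R)%type ~> R) (p tb : R) : \bar R :=
  \int[nu (p, tb)]_v v%:E.

(** weak perfect Bayesian equilibrium; alpha and nu are indexed by (p, t_b). *)
Definition wPBE (V : set R) (sigma : R.-pker borelT T ~> R) (alpha : R * R -> R)
  (nu : R.-pker (R * R)%type ~> R) : Prop :=
  [/\ measurable_fun setT alpha,
      (forall x, 0 <= alpha x <= 1)%R,
      (forall p tb, nu (p, tb) V = 1) &
      (forall p tb, p%:E < belief_mean nu p tb -> alpha (p, tb) = 1%R)] /\
  [/\ (forall p tb, belief_mean nu p tb < p%:E -> alpha (p, tb) = 0%R),
      (forall sigma' : R.-pker borelT T ~> R,
         seller_payoff sigma' alpha <= seller_payoff sigma alpha) &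
      (forall (A : set (R * R)) (B : set R), measurable A -> measurable B ->
         jointE sigma (fun w p => (\1_A (p, w.1.2))%:E * nu (p, w.1.2) B) =
         jointE sigma (fun w p => (\1_A (p, w.1.2) * \1_B w.2)%:E))].

Definition price_independent (nu : R.-pker (R * R)%type ~> R) : Prop :=
  forall (p : R) (D : set (R * R)), measurable D ->
    \int[P]_w nu (p, w.1.2) [set v | D (w.1.2, v)] =
    P [set w : Om | D (w.1.2, w.2)].

End Game.

(** Pi^*_fb(Gamma): payoff pairs of wPBE with price-independent beliefs under
    some fully-informed-Buyer information structure (T_s a complete separable
    metric space with its Borel sigma-algebra). *)
Definition Pi_fb (R : realType) (V : set R) (c : R -> R) (mu : probability R R)
  (pib pis : R) : Prop :=
  exists (T : completePseudoMetricType R),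
    hausdorff_space T /\ separable_space T /\
    exists (P : probability ((borelT T * R) * R)%type R),
      V_marginal P mu /\ fully_informed P /\
      exists (sigma : R.-pker borelT T ~> R) (alpha : R * R -> R)
             (nu : R.-pker (R * R)%type ~> R),
        wPBE c P V sigma alpha nu /\ price_independent P nu /\
        buyer_payoff P sigma alpha = pib%:E /\
        seller_payoff c P sigma alpha = pis%:E.

(* Main.v *)
Require Import Defs.
From HB Require Import structures.
From mathcomp Require Import all_boot all_order all_algebra.
From mathcomp Require Import all_classical all_reals all_analysis.
From mathcomp Require Import measurable_realfun archimedean zify ring lra.

(** Necessity. Price-independent beliefs make the informed buyer accept, at
every price and hence also off path, almost surely whenever her value exceeds
the price; so posting [p - eps] guarantees the seller the fixed-price profit at
[p] up to [eps]. Bayes' rule on path gives the buyer a nonnegative payoff, and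
trade creates at most the surplus.

Sufficiency. Let the seller's signal be a recommended price, and let the buyer
buy iff the posted price is at most her value. In a finite market, the
segmentation of Bergemann, Brooks and Morris into extremal markets, whose
supported prices are all optimal, gives the seller only the fixed-price profit,
with all or none of the remaining surplus going to the buyer according to
whether the lowest or the highest supported price is recommended. Mixing these
with full price discrimination reaches every payoff pair of the triangle. For a
general environment one discretizes the values, takes the limit of the laws of
(recommended price, value) along an ultrafilter, and realizes the limit as the
law of [(T (v, u), v)] with [u] an independent uniform variable. Obedience
passes to the limit for Lipschitz weights of the recommendation, hence for
indicators of Borel sets, hence for arbitrary randomized deviations. *)

Set Implicit Arguments. Unset Strict Implicit. Unset Printing Implicit Defensive.
Import Order.TTheory GRing.Theory Num.Theory.
Import numFieldNormedType.Exports.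
Local Open Scope classical_set_scope.
Local Open Scope ring_scope.

(** * Segmentations of a finite market *)

(** The limit is delicate because trade takes place on [t <= v], whose indicator jumps in the signal
    [t]: along a convergent sequence of laws, buyers may pass from rejecting to accepting. Trade is
    therefore tested only through functions Lipschitz in [t], with a slack [eta], and the limit
    profit is bounded above by obedience itself, against a deviation that undercuts the
    recommendation. Dependence on the value stays merely measurable, since every approximating law
    has the same value marginal [mu]; this also provides the conditional laws of the signal, as
    densities with respect to [mu]. An ultrafilter limit is only finitely additive, so its agreement
    with a genuine law is proved on such Lipschitz functions. Gains from trade may vanish while the
    greedy segmentation divides by them; the discretization therefore rounds values up by more than
    one and at most two mesh steps. Finally, [c] is arbitrary outside [V] and posted prices are
    unbounded, so payoffs are integrals of functions that may be neither measurable nor bounded. *)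

Section FiniteMarket.
Variables (R : realFieldType) (v c : nat -> R).
Hypothesis v_dec : forall i, v i.+1 < v i.
Hypothesis gain_gt0 : forall i, c i < v i.

(* Types are listed in decreasing order of value, so that exactly the types
   [0, ..., i] of the market [x] buy at the price [v i]. *)
Definition profit (x : nat -> R) (i : nat) : R :=
  \sum_(k < i.+1) x k * (v i - c k).

Lemma profitS (x : nat -> R) i :
  \sum_(k < i.+1) x k * (v i.+1 - c k) =
  profit x i - (v i - v i.+1) * \sum_(k < i.+1) x k.
Proof.
rewrite /profit mulr_sumr -sumrB; apply: eq_bigr => k _; ring.
Qed.

(** Masses are fixed from the highest value down. The types already placed yield strictly less than
    1 at the next lower price, so a positive mass of the next type tops the profit up to exactly 1;
    a type absent from [m] gets no mass and leaves the profit below 1. *)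
Lemma extremal_market n (m : nat -> R) : (forall i, 0 <= m i) ->
  exists x : nat -> R, forall i, (i < n)%N ->
    [/\ 0 <= x i, (0 < m i -> 0 < x i), (m i = 0 -> x i = 0),
        profit x i <= 1 & (0 < m i -> profit x i = 1)].
Proof.
move=> m0; elim: n => [|n [x IH]]; first by exists (fun=> 0).
pose a := \sum_(k < n) x k * (v n - c k).
have x0 (k : 'I_n) : 0 <= x k by have [] := IH k (ltn_ord k).
(* Lowering the price one step to serve the same types loses the price difference on every unit
   sold; if nothing is sold, [a] is 0. *)
have a1 : a < 1.
  rewrite /a; case: n IH {a} x0 => [|n] IH x0; first by rewrite big_ord0.
  have [s0|/eqP s0] := eqVneq (\sum_(k < n.+1) x k) 0.
    rewrite big1 // => k _.
    by have /eqP := s0; rewrite psumr_eq0// => /allP/(_ k (mem_index_enum _))/eqP ->;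
      rewrite mul0r.
  have s1 : 0 < \sum_(k < n.+1) x k by rewrite lt_neqAle sumr_ge0// andbT eq_sym; apply/eqP.
  rewrite profitS; have [_ _ _ + _] := IH n (ltnSn n).
  by have := v_dec n; move: s1; set s := \sum_(k < _) _ => s1 vn p1; nra.
pose xn := if 0 < m n then (1 - a) / (v n - c n) else 0.
exists (fun k => if k == n then xn else x k) => i.
have px j : (j < n)%N -> profit (fun k => if k == n then xn else x k) j = profit x j.
  move=> jn; apply: eq_bigr => k _; case: eqP => // kn.
  by have := ltn_ord k; rewrite kn ltnNge jn.
rewrite ltnS leq_eqVlt => /orP[/eqP ->|lin]; last first.
  by rewrite px// (ltn_eqF lin); apply: IH.
have g0 : 0 < v n - c n by rewrite subr_gt0.
have pn : profit (fun k => if k == n then xn else x k) n = a + xn * (v n - c n).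
  rewrite /profit big_ord_recr/= eqxx; congr (_ + _); apply: eq_bigr => k _.
  by case: eqP => // kn; have := ltn_ord k; rewrite kn ltnn.
rewrite eqxx pn /xn; case: ifPn => mn.
  rewrite divfK ?gt_eqF// subrKC; split => //.
  - by rewrite divr_ge0 ?ltW// subr_gt0.
  - by move=> _; rewrite divr_gt0// subr_gt0.
  - by move=> mn0; rewrite mn0 ltxx in mn.
by rewrite mul0r addr0; split => //; rewrite ltW.
Qed.

(* [Y j i] is the mass of type [i] in the submarket where the price [v j] is
   recommended. *)
Definition obedient n (m : nat -> R) (pi : R) (Y : nat -> nat -> R) : Prop :=
  [/\ forall j i, 0 <= Y j i,
      forall i, (i < n)%N -> \sum_(j < n) Y j i = m i,
      forall j l, (j < n)%N -> (l < n)%N -> profit (Y j) l <= profit (Y j) j &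
      \sum_(j < n) profit (Y j) j = pi].

Lemma profitD (x y : nat -> R) i : profit (fun k => x k + y k) i = profit x i + profit y i.
Proof. by rewrite /profit -big_split/=; apply: eq_bigr => k _; rewrite mulrDl. Qed.

Lemma profitZ a (x : nat -> R) i : profit (fun k => a * x k) i = a * profit x i.
Proof. by rewrite /profit mulr_sumr; apply: eq_bigr => k _; rewrite mulrA. Qed.

Lemma eq_profit (x y : nat -> R) i : (forall k, (k <= i)%N -> x k = y k) -> profit x i = profit y i.
Proof. by move=> xy; apply: eq_bigr => k _; rewrite xy// -ltnS ltn_ord. Qed.

Lemma profit0 i : profit (fun=> 0) i = 0.
Proof. by rewrite /profit big1// => k _; rewrite mul0r. Qed.

(** An unsupported price serves the same types as the next higher price, which earns strictly more
    as soon as something is sold. Something is sold at an optimum, because the highest supported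
    value alone yields a positive profit. *)
Lemma optimal_price_supported n (m : nat -> R) s : (s < n)%N -> (forall i, 0 <= m i) ->
  (forall i, (i < n)%N -> profit m i <= profit m s) ->
  (exists2 i, (i < n)%N & 0 < m i) -> 0 < m s.
Proof.
move=> sn m0 ms [i lin mi]; rewrite lt_neqAle m0 andbT; apply/negP => /eqP ms0.
have [k [lkn mk kmin]] : exists k, [/\ (k < n)%N, 0 < m k &
    forall j, (j < k)%N -> m j = 0].
  pose p := fun k => (k < n)%N && (0 < m k).
  have ep : exists k, p k by exists i; rewrite /p lin mi.
  case: (ex_minnP ep) => k /andP[kn mk] kmin; exists k; split => // j jk.
  apply/eqP; rewrite eq_le m0 andbT leNgt; apply/negP => mj.
  by have := kmin j; rewrite /p mj (ltn_trans jk kn) => /(_ isT); rewrite leqNgt jk.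
have pk : 0 < profit m k.
  rewrite /profit big_ord_recr/= big1 ?add0r; last first.
    by move=> j _; rewrite kmin// mul0r.
  by rewrite mulr_gt0// subr_gt0.
have ps : 0 < profit m s by exact: lt_le_trans (ms _ lkn).
case: s sn ms ms0 ps => [|s] sn ms ms0 ps.
  by move: ps; rewrite /profit big_ord_recr big_ord0/= -ms0 mul0r addr0 ltxx.
move: (ms s (ltnW sn)) ps; rewrite {2 3}/profit big_ord_recr/= -ms0 mul0r addr0 profitS.
have [s0|s0] := eqVneq (\sum_(k0 < s.+1) m k0) 0.
  move=> _; rewrite s0 mulr0 subr0 /profit big1 ?ltxx// => j _.
  have /eqP := s0; rewrite psumr_eq0; last by move=> *; exact: m0.
  by move=> /allP/(_ j (mem_index_enum _))/eqP ->; rewrite mul0r.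
have s1 : 0 < \sum_(k < s.+1) m k.
  by rewrite lt_neqAle sumr_ge0 ?andbT 1?eq_sym// => *; exact: m0.
by have := v_dec s; move: s1; set t := \sum_(k < _) _ => *; nra.
Qed.

Lemma ex_extreme_index (p : pred nat) n (b : bool) :
  (exists2 i, (i < n)%N & p i) ->
  exists j, [/\ (j < n)%N, p j &
    forall i, (i < n)%N -> p i -> if b then (i <= j)%N else (j <= i)%N].
Proof.
move=> [i lin pi]; pose q := fun k => (k < n)%N && p k.
have eq : exists k, q k by exists i; rewrite /q lin pi.
case: b.
  have qb k : q k -> (k <= n)%N by case/andP => /ltnW.
  case: (ex_maxnP eq qb) => j /andP[jn pj] jmax; exists j; split => // k kn pk.
  by apply: jmax; rewrite /q kn pk.
case: (ex_minnP eq) => j /andP[jn pj] jmin; exists j; split => // k kn pk.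
by apply: jmin; rewrite /q kn pk.
Qed.

(* The greedy step of Bergemann, Brooks and Morris: remove the largest multiple
   of the market on the current support that makes the seller indifferent between
   all supported prices.  This exhausts a type, and the uniform optimum [s] stays
   optimal in the remaining market. *)
Lemma extremal_segmentation (b : bool) n (m : nat -> R) s : (s < n)%N -> (forall i, 0 <= m i) ->
  (forall i, (i < n)%N -> profit m i <= profit m s) ->
  exists2 Y, obedient n m (profit m s) Y &
    forall j i, (i < n)%N -> (if b then j < i else i < j)%N -> Y j i = 0.
Proof.
move=> sn; have [N] := ubnP #|[pred i : 'I_n | 0 < m i]|.
elim: N m => // N IH m mN m0 ms.
have [/existsP[i0 mi0]|/existsPn nm] := boolP [exists i : 'I_n, 0 < m i]; last first.
  have mz i : (i < n)%N -> m i = 0.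
    by move=> lin; apply/eqP; rewrite eq_le m0 andbT leNgt; exact: (nm (Ordinal lin)).
  exists (fun _ _ => 0) => //; split => //.
  - by move=> i lin; rewrite big1// mz.
  - by move=> j l _ _; rewrite !profit0.
  - by rewrite big1 => [|j _]; rewrite ?profit0// -(@eq_profit (fun=> 0)) ?profit0// => k ks;
      rewrite mz// (leq_ltn_trans ks sn).
have supp : exists2 i, (i < n)%N & 0 < m i by exists i0.
have [x0 Hx0] := extremal_market n m0.
(* Zero from [n] on, so that the remainder [m'] is nonnegative at every index, as the induction
   hypothesis demands. *)
pose x k := if (k < n)%N then x0 k else 0.
have Hx i : (i < n)%N ->
    [/\ 0 <= x i, (0 < m i -> 0 < x i), (m i = 0 -> x i = 0),
        profit x i <= 1 & (0 < m i -> profit x i = 1)].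
  move=> lin; have -> : profit x i = profit x0 i.
    by apply: eq_profit => k ki; rewrite /x (leq_ltn_trans ki lin).
  by rewrite /x lin; exact: Hx0.
have x_ge0 i : 0 <= x i.
  by have [lin|ni] := ltnP i n; [have [] := Hx i lin | rewrite /x ltnNge ni].
(* [e] is the type exhausted first: with [eps = m e / x e], the remainder [m - eps * x] stays
   nonnegative and vanishes at [e]. *)
case: (@arg_minP _ _ _ i0 (fun i : 'I_n => 0 < m i) (fun i : 'I_n => m i / x i) mi0) => e me emin.
pose eps := m e / x e.
have [_ xe _ _ _] := Hx e (ltn_ord e); have {}xe := xe me.
have eps_ge0 : 0 <= eps by rewrite divr_ge0// ltW.
pose m' k := m k - eps * x k.
have m'0 k : 0 <= m' k.
  rewrite /m'; have [lkn|nk] := ltnP k n; last first.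
    by rewrite /x ltnNge nk/= mulr0 subr0.
  rewrite subr_ge0; have [_ xk mk _ _] := Hx k lkn.
  have [mk0|mk0] := eqVneq (m k) 0; first by rewrite mk0 mk// mulr0.
  have mkp : 0 < m k by rewrite lt_neqAle eq_sym mk0 m0.
  by rewrite -ler_pdivlMr ?xk//; exact: (emin (Ordinal lkn)).
have m'e : m' e = 0 by rewrite /m' /eps divfK ?subrr// gt_eqF.
have m'z k : (k < n)%N -> m k = 0 -> m' k = 0.
  by move=> /Hx[_ _ xk _ _] mk; rewrite /m' mk xk// mulr0 subrr.
have pm' i : profit m' i = profit m i - eps * profit x i.
  rewrite -profitZ -mulN1r -profitZ -profitD; apply: eq_profit => k _.
  by rewrite mulN1r.
have mssupp : 0 < m s by exact: optimal_price_supported ms supp.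
have px k : (k < n)%N -> 0 < m k -> profit m' k = profit m k - eps.
  by move=> lkn mk; rewrite pm'; have [_ _ _ _ ->//] := Hx k lkn; rewrite mulr1.
(* Needed when the price of index 0 is unsupported and so earns 0. At the highest supported value
   [k] only type [k] itself buys, so the profit there is nonnegative. *)
have ps_ge0 : 0 <= profit m' s.
  have [k [kn mk kmin]] := ex_extreme_index (p := fun i => 0 < m i) false supp.
  apply: (@le_trans _ _ (profit m' k)); last first.
    by rewrite !px// lerB// ms.
  rewrite /profit sumr_ge0// => -[l /=]; rewrite ltnS leq_eqVlt => /orP[/eqP ->|lk] _.
    by rewrite mulr_ge0// subr_ge0 ltW.
  have ln := ltn_trans lk kn.
  suff -> : m' l = 0 by rewrite mul0r.
  apply: m'z => //; apply/eqP; rewrite eq_le m0 andbT leNgt; apply/negP => ml.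
  by have := kmin l ln ml; rewrite leqNgt lk.
(* All prices supported in [m] lose the same [eps], which keeps their ranking; an unsupported price
   adds no buyer to those of the next higher price, hence the induction. *)
have ms' i : (i < n)%N -> profit m' i <= profit m' s.
  elim: i => [|i IHi] lin.
    have [mi|mi] := ltP 0 (m 0); first by rewrite !px// lerB// ms.
    rewrite /profit big_ord_recr big_ord0/= add0r m'z ?mul0r//.
    by apply/eqP; rewrite eq_le m0 mi.
  have [mi|mi] := ltP 0 (m i.+1); first by rewrite !px// lerB// ms.
  apply: le_trans (IHi (ltnW lin)).
  rewrite /profit big_ord_recr/= (m'z i.+1)// ?mul0r ?addr0; last first.
    by apply/eqP; rewrite eq_le m0 mi.
  by apply: ler_sum => k _; rewrite ler_wpM2l// lerB// ltW.
have [|Y [Y0 Ym Yo Ys] Yb] := IH m' _ m'0 ms'.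
  rewrite -ltnS; apply: leq_trans mN; rewrite ltnS; apply: proper_card; apply/properP; split.
    apply/fintype.subsetP => i; rewrite !inE => m'i; rewrite lt_neqAle m0 andbT.
    by apply/negP => /eqP mi; rewrite m'z ?ltxx// in m'i.
  by exists e; rewrite !inE// m'e ltxx.
have [j [jn mj jb]] := ex_extreme_index (p := fun i => 0 < m i) b supp.
exists (fun j' i => Y j' i + (if j' == j then eps * x i else 0)).
  split.
  - by move=> j' i; rewrite addr_ge0//; case: ifP => // _; rewrite mulr_ge0.
  - move=> i lin; rewrite big_split/= Ym// (bigD1 (Ordinal jn))//= eqxx big1 ?addr0.
      by rewrite /m' subrK.
    by move=> k /negP kj; case: eqP => // kj'; case: kj; apply/eqP/val_inj.
  - move=> j' l j'n ln; rewrite !profitD lerD ?Yo//.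
    case: (eqVneq j' j) => [->|_]; last by rewrite !profit0.
    rewrite !profitZ ler_wpM2l//; have [_ _ _ xl _] := Hx l ln.
    by have [_ _ _ _ ->] := Hx j jn.
  - rewrite -(subrK eps (profit m s)) -px// -Ys.
    under eq_bigr do rewrite profitD.
    rewrite big_split/=; congr (_ + _); rewrite (bigD1 (Ordinal jn))//= eqxx big1 ?addr0.
      by rewrite profitZ; have [_ _ _ _ ->] := Hx j jn; rewrite ?mulr1.
    move=> k /negP kj; case: eqP => [kj'|_]; last exact: profit0.
    by case: kj; apply/eqP/val_inj.
move=> j' i lin ij; rewrite Yb// add0r; case: eqP => // j'j.
have [_ _ xi _ _] := Hx i lin; rewrite xi ?mulr0//.
apply/eqP; rewrite eq_le m0 andbT leNgt; apply/negP => mi.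
by have := jb i lin mi; rewrite -j'j; case: (b) ij => ij; rewrite leqNgt ij.
Qed.

(* With weight [ae] the lowest supported price of each extremal market is
   recommended (trade is efficient), with weight [ai] the highest one (buyers
   get no rent), and with weight [af] each type is charged its value. *)
Lemma finite_segmentation n (m : nat -> R) s (ae ai af : R) :
  0 <= ae -> 0 <= ai -> 0 <= af -> ae + ai + af = 1 ->
  (s < n)%N -> (forall i, 0 <= m i) ->
  (forall i, (i < n)%N -> profit m i <= profit m s) ->
  let S := \sum_(i < n) m i * (v i - c i) in
  exists2 Y, obedient n m ((ae + ai) * profit m s + af * S) Y &
    \sum_(j < n) \sum_(i < j.+1) Y j i * (v i - v j) = ae * (S - profit m s).
Proof.
move=> ae0 ai0 af0 a1 sn m0 ms S.
have [Ye [Ye0 Yem Yeo Yes] Yeb] := extremal_segmentation true sn m0 ms.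
have [Yi [Yi0 Yim Yio Yis] Yib] := extremal_segmentation false sn m0 ms.
pose Yd (j i : nat) := if i == j then m j else 0.
have Yd0 j i : 0 <= Yd j i by rewrite /Yd; case: ifP.
have pd j : profit (Yd j) j = m j * (v j - c j).
  rewrite /profit big_ord_recr/= big1 ?add0r /Yd ?eqxx// => k _.
  by rewrite ltn_eqF ?ltn_ord// mul0r.
have v_le i j : (i <= j)%N -> v j <= v i.
  elim: j => [|j IHj]; first by rewrite leqn0 => /eqP ->.
  by rewrite leq_eqVlt => /orP[/eqP ->//|/IHj]; apply: le_trans; exact: ltW.
have Ydo j l : profit (Yd j) l <= profit (Yd j) j.
  rewrite pd /profit; have [lj|jl] := ltnP l j.
    rewrite big1 => [|k _]; first by rewrite mulr_ge0// subr_ge0 ltW.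
    by rewrite /Yd ltn_eqF ?mul0r// (leq_ltn_trans _ lj)// -ltnS ltn_ord.
  rewrite (bigD1 (Ordinal (jl : (j < l.+1)%N)))//= big1 ?addr0 => [|k kj].
    by rewrite /Yd eqxx ler_wpM2l// lerB// v_le.
  by rewrite /Yd ifN ?mul0r.
exists (fun j i => ae * Ye j i + ai * Yi j i + af * Yd j i).
  split.
  - by move=> j i; rewrite !addr_ge0 ?mulr_ge0.
  - move=> i lin; rewrite !big_split/= -!mulr_sumr Yem// Yim//.
    rewrite (bigD1 (Ordinal lin))//= /Yd eqxx big1 ?addr0.
      by rewrite -!mulrDl a1 mul1r.
    by move=> k ki; rewrite ifN// eq_sym.
  - by move=> j l jn ln; rewrite !profitD !profitZ !lerD ?ler_wpM2l ?Yeo ?Yio.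
  - under eq_bigr do rewrite !profitD !profitZ pd.
    by rewrite !big_split/= -!mulr_sumr Yes Yis mulrDl.
under eq_bigr do under eq_bigr do rewrite !mulrDl -!mulrA.
under eq_bigr do rewrite !big_split/= -!mulr_sumr.
rewrite !big_split/= -!mulr_sumr.
have Z (Y : nat -> nat -> R) : (forall j i, (i < j)%N -> (j < n)%N -> Y j i = 0) ->
    \sum_(j < n) \sum_(i < j.+1) Y j i * (v i - v j) = 0.
  move=> Y0; rewrite big1// => j _; rewrite big_ord_recr/= subrr mulr0 addr0.
  by rewrite big1// => k _; rewrite Y0 ?mul0r.
rewrite [X in _ + ai * X]Z; last by move=> j i ij jn; rewrite Yib// (ltn_trans ij).
rewrite [X in _ + af * X]Z; last by move=> j i ij _; rewrite /Yd ltn_eqF.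
rewrite !mulr0 !addr0; congr (_ * _).
(* Under [Ye] no type is worth less than the price recommended to it, so everyone trades and the
   whole surplus splits over the submarkets; what the seller does not take is rent. *)
have -> : S = \sum_(j < n) \sum_(i < j.+1) Ye j i * (v i - c i).
  have -> : \sum_(j < n) \sum_(i < j.+1) Ye j i * (v i - c i) =
      \sum_(j < n) \sum_(i < n) Ye j i * (v i - c i).
    apply: eq_bigr => j _.
    rewrite (big_ord_widen n (fun i => Ye j i * (v i - c i)))//.
    rewrite big_mkcond/=; apply: eq_bigr => i _; case: ltnP => // ji.
    by rewrite Yeb// mul0r.
  by rewrite exchange_big/=; apply: eq_bigr => i _; rewrite -mulr_suml Yem.
rewrite -Yes -sumrB; apply: eq_bigr => j _.
by rewrite /profit -sumrB; apply: eq_bigr => i _; ring.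
Qed.

End FiniteMarket.

(** * Integration *)

Section ArbitraryIntegrand.
Context d (T : measurableType d) (R : realType).
Variable mu : {measure set T -> \bar R}.
Local Open Scope ereal_scope.
Import HBNNSimple.

(** The integral is a difference of suprema over simple functions below the positive and negative
    parts, hence monotone for every integrand. This serves payoffs, whose integrands involve [c]
    outside [V]. *)
Lemma le_integral_arbitrary (D : set T) (f g : T -> \bar R) :
  (forall x, D x -> f x <= g x) ->
  \int[mu]_(x in D) f x <= \int[mu]_(x in D) g x.
Proof.
move=> fg; have fgD x : (f \_ D) x <= (g \_ D) x.
  by rewrite !patchE; case: ifPn => // /[!inE]; exact: fg.
rewrite /integral; apply: leeB; apply: le_ereal_sup => _ [h hf <-]; exists h => // x.
  by apply: le_trans (hf x) _; rewrite !funeposE ge_max !le_max fgD lexx !orbT.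
by apply: le_trans (hf x) _; rewrite !funenegE ge_max !le_max leeN2 fgD lexx !orbT.
Qed.

(** The null set is removed from each simple function below [f], where measurability is
    available. *)
Lemma ge0_integral_restrict_arbitrary (A : set T) (f : T -> \bar R) :
  measurable A -> mu (~` A) = 0 -> (forall x, 0 <= f x) ->
  \int[mu]_x f x = \int[mu]_(x in A) f x.
Proof.
move=> mA A0 f0; apply/eqP; rewrite eq_le; apply/andP; split; last first.
  rewrite [leLHS]integral_mkcond; apply: le_integral_arbitrary => x _.
  by rewrite patchE; case: ifP.
rewrite ge0_integralTE//; apply: ge_ereal_sup => _ [h hf <-].
rewrite -(patch_setT (fun=> point) h) -integral_nnsfun//.
rewrite (ge0_negligible_integral (N := ~` A))//=; first last.
- by move=> x _; rewrite lee_fin.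
- exact/measurable_EFinP.
- exact: measurableC.
rewrite setTD setCK; apply: le_integral_arbitrary => x _; exact: hf.
Qed.

Lemma integral_restrict_arbitrary (A : set T) (f : T -> \bar R) :
  measurable A -> mu (~` A) = 0 -> \int[mu]_x f x = \int[mu]_(x in A) f x.
Proof.
move=> mA A0; rewrite [LHS]integralE [RHS]integralE; congr (_ - _).
  exact: ge0_integral_restrict_arbitrary.
exact: ge0_integral_restrict_arbitrary.
Qed.

Lemma le_integral_ae_arbitrary (f g : T -> \bar R) :
  {ae mu, forall x, f x <= g x} -> \int[mu]_x f x <= \int[mu]_x g x.
Proof.
move=> [N [mN N0 fgN]].
rewrite (@integral_restrict_arbitrary (~` N))//; last 2 first.
- exact: measurableC.
- by rewrite setCK.
rewrite [leRHS](@integral_restrict_arbitrary (~` N))//; last 2 first.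
- exact: measurableC.
- by rewrite setCK.
by apply: le_integral_arbitrary => x Nx; apply: contrapT => /fgN.
Qed.

Lemma eq_integral_ae_arbitrary (f g : T -> \bar R) :
  {ae mu, forall x, f x = g x} -> \int[mu]_x f x = \int[mu]_x g x.
Proof.
move=> fg; apply/eqP; rewrite eq_le; apply/andP; split;
  by apply: le_integral_ae_arbitrary; apply: filterS fg => x ->.
Qed.

End ArbitraryIntegrand.

(** * Calculus of bounded measurable functions under a probability *)

Section BoundedMeasurable.
Context d (T : measurableType d) (R : realType).
Implicit Types f g : T -> R.

Definition bounded_measurable f :=
  measurable_fun setT f /\ exists M : R, forall x, `|f x| <= M.

Lemma bm_cst (k : R) : bounded_measurable (fun=> k).
Proof. by split; [exact: measurable_cst | exists `|k|]. Qed.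

Lemma bmD f g : bounded_measurable f -> bounded_measurable g ->
  bounded_measurable (fun x => f x + g x).
Proof.
move=> [mf [M fM]] [mg [N gN]]; split; first exact: measurable_funD.
by exists (M + N) => x; rewrite (le_trans (ler_normD _ _))// lerD.
Qed.

Lemma bmM f g : bounded_measurable f -> bounded_measurable g ->
  bounded_measurable (fun x => f x * g x).
Proof.
move=> [mf [M fM]] [mg [N gN]]; split; first exact: measurable_funM.
by exists (M * N) => x; rewrite normrM ler_pM.
Qed.

Lemma bmN f : bounded_measurable f -> bounded_measurable (fun x => - f x).
Proof.
move=> bf; have := bmM (bm_cst (-1)) bf.
by congr bounded_measurable; apply/funext => x; rewrite mulN1r.
Qed.

Lemma bmB f g : bounded_measurable f -> bounded_measurable g ->
  bounded_measurable (fun x => f x - g x).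
Proof. by move=> bf bg; apply: bmD => //; exact: bmN. Qed.

Lemma bm_sum (I : Type) (s : seq I) (F : I -> T -> R) :
  (forall i, bounded_measurable (F i)) ->
  bounded_measurable (fun x => \sum_(i <- s) F i x).
Proof.
move=> bF; elim: s => [|i s IH].
  have := bm_cst 0; congr bounded_measurable.
  by apply/funext => x; rewrite big_nil.
have := bmD (bF i) IH; congr bounded_measurable.
by apply/funext => x; rewrite big_cons.
Qed.

Lemma bm_indic (A : set T) : measurable A -> bounded_measurable (\1_A : T -> R).
Proof.
move=> mA; split; first exact: measurable_indic.
by exists 1 => x; rewrite indicE; case: (_ \in _); rewrite ?normr1 ?normr0 ?ler01.
Qed.

Lemma bm_bound f : bounded_measurable f -> exists2 M, 0 < M & forall x, `|f x| <= M.
Proof.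
move=> [_ [M fM]]; exists (`|M| + 1) => [|x]; first by rewrite ltr_pwDr.
by rewrite (le_trans (fM x))// (le_trans (ler_norm _))// lerDl.
Qed.

Lemma bm_le (M : R) f : measurable_fun setT f -> (forall x, `|f x| <= M) ->
  bounded_measurable f.
Proof. by split => //; exists M. Qed.

Variable P : probability T R.
Local Notation E f := (\int[P]_x f x).

Lemma bm_integrable f : bounded_measurable f -> P.-integrable setT (EFin \o f).
Proof.
move=> [mf [M fM]]; apply: measurable_bounded_integrable => //.
  by rewrite (le_lt_trans (probability_le1 P measurableT))// ltry.
by exists M; split; [exact: num_real | move=> N /ltW MN x _; exact: le_trans MN].
Qed.

Lemma bm_integralE f : bounded_measurable f ->
  (\int[P]_x (f x)%:E)%E = (E f)%:E.
Proof.
by move=> bf; rewrite /Rintegral fineK//; apply: integrable_fin_num => //;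
  exact: bm_integrable.
Qed.

Lemma ED f g : bounded_measurable f -> bounded_measurable g ->
  E (fun x => f x + g x) = E f + E g.
Proof. by move=> bf bg; rewrite RintegralD//; exact: bm_integrable. Qed.

Lemma EZ (k : R) f : bounded_measurable f -> E (fun x => k * f x) = k * E f.
Proof. by move=> bf; rewrite RintegralZl//; exact: bm_integrable. Qed.

Lemma E_le f g : bounded_measurable f -> bounded_measurable g ->
  (forall x, f x <= g x) -> E f <= E g.
Proof. by move=> bf bg fg; apply: le_Rintegral => //; exact: bm_integrable. Qed.

Lemma E_cst (k : R) : E (fun=> k) = k.
Proof.
rewrite Rintegral_cst// -[RHS]mulr1; congr (_ * _).
by apply: (congr1 fine (y := 1%E)); exact: probability_setT.
Qed.

Lemma E_sum (I : Type) (s : seq I) (F : I -> T -> R) :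
  (forall i, bounded_measurable (F i)) ->
  E (fun x => \sum_(i <- s) F i x) = \sum_(i <- s) E (F i).
Proof.
move=> bF; elim: s => [|i s IH].
  rewrite big_nil -[RHS](E_cst 0).
  by apply: eq_Rintegral => x _; rewrite big_nil.
rewrite big_cons -IH -ED//; last exact: bm_sum.
by apply: eq_Rintegral => x _; rewrite big_cons.
Qed.

Lemma E_indic (A : set T) : measurable A -> E (\1_A) = fine (P A).
Proof. by move=> mA; rewrite /Rintegral integral_indic// setIT. Qed.

Lemma E_lim (f_ : nat -> T -> R) (f : T -> R) (M : R) :
  (forall n, measurable_fun setT (f_ n)) -> measurable_fun setT f ->
  (forall n x, `|f_ n x| <= M) -> (forall x, f_ n x @[n --> \oo] --> f x) ->
  E (f_ n) @[n --> \oo] --> E f.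
Proof.
move=> mf_ mf fM f_f.
have bf n : bounded_measurable (f_ n) by split => //; exists M.
have [iF _ H] : [/\ P.-integrable setT (EFin \o f),
    [sequence (\int[P]_x `|(f_ n x)%:E - (f x)%:E|)%E]_n @ \oo --> 0%E &
    [sequence (\int[P]_x (f_ n x)%:E)%E]_n @ \oo --> (\int[P]_x (f x)%:E)%E].
  apply: (@dominated_convergence _ _ _ P setT measurableT
    (fun n x => (f_ n x)%:E) (EFin \o f) (fun=> M%:E)).
  - by move=> n; exact/measurable_EFinP.
  - exact/measurable_EFinP.
  - by apply: aeW => x _; apply: cvg_EFin; [exact: nearW | exact: f_f].
  - by have := bm_integrable (bm_cst M).
  - by apply: aeW => x n _; rewrite /= lee_fin.
by apply: fine_cvg; rewrite fineK; [exact: H | exact: integrable_fin_num iF].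
Qed.

End BoundedMeasurable.

Section LeIndicator.
Context d (T : measurableType d) (R : realType).

Lemma bm_ler (f g : T -> R) : measurable_fun setT f -> measurable_fun setT g ->
  bounded_measurable (fun x => (f x <= g x)%R%:R : R).
Proof.
move=> mf mg; have mA : measurable [set x | f x <= g x].
  by rewrite -[X in measurable X]setTI; exact: measurable_fun_le.
have := @bm_indic _ T R _ mA; congr bounded_measurable; apply/funext => x.
have e : (x \in [set x | f x <= g x]) = (f x <= g x) by apply/idP/idP => /[!inE].
by rewrite indicE e.
Qed.

Lemma bm_ltr (f g : T -> R) : measurable_fun setT f -> measurable_fun setT g ->
  bounded_measurable (fun x => (f x < g x)%R%:R : R).
Proof.
move=> mf mg; have := bmB (bm_cst T (1 : R)) (bm_ler mg mf).
congr bounded_measurable; apply/funext => x.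
by case: ltP; rewrite ?subr0 ?subrr.
Qed.

End LeIndicator.

(** * Laws of (signal, value) pairs and their limits *)

Section Mean.
Context (R : realType) (lo hi : R).
Local Notation bm := (@bounded_measurable _ (R * R)%type R).
Local Notation bm1 := (@bounded_measurable _ R R).

(* A finitely additive law of a pair [(t, v)] with [t] in [lo, hi]. *)
Definition is_mean (I : (R * R -> R) -> R) :=
  [/\ forall f g, bm f -> bm g -> I (fun x => f x + g x) = I f + I g,
      forall k f, bm f -> I (fun x => k * f x) = k * I f,
      forall f g, bm f -> bm g ->
        (forall t v, lo <= t <= hi -> f (t, v) <= g (t, v)) -> I f <= I g &
      I (fun=> 1) = 1].

Section MeanTheory.
Variables (I : (R * R -> R) -> R) (mI : is_mean I).

Lemma meanD f g : bm f -> bm g -> I (fun x => f x + g x) = I f + I g.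
Proof. by case: mI => + _ _ _; exact. Qed.

Lemma meanZ k f : bm f -> I (fun x => k * f x) = k * I f.
Proof. by case: mI => _ + _ _; exact. Qed.

Lemma mean_le f g : bm f -> bm g ->
  (forall t v, lo <= t <= hi -> f (t, v) <= g (t, v)) -> I f <= I g.
Proof. by case: mI => _ _ + _; exact. Qed.

Lemma mean1 : I (fun=> 1) = 1. Proof. by case: mI. Qed.

Lemma mean_cst k : I (fun=> k) = k.
Proof.
have <- : (fun _ : R * R => k * 1) = (fun=> k) by apply/funext => x; rewrite mulr1.
by rewrite meanZ ?mean1 ?mulr1//; exact: bm_cst.
Qed.

Lemma meanB f g : bm f -> bm g -> I (fun x => f x - g x) = I f - I g.
Proof.
move=> bf bg; rewrite meanD//; last exact: bmN.
congr (_ + _); rewrite -mulN1r -meanZ//.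
by congr I; apply/funext => x; rewrite mulN1r.
Qed.

Lemma mean_sum n (F : nat -> R * R -> R) : (forall i, bm (F i)) ->
  I (fun x => \sum_(i < n) F i x) = \sum_(i < n) I (F i).
Proof.
move=> bF; elim: n => [|n IH].
  rewrite big_ord0 -[RHS](mean_cst 0).
  by congr I; apply/funext => x; rewrite big_ord0.
rewrite big_ord_recr/= -IH -meanD//; last exact: bm_sum.
by congr I; apply/funext => x; rewrite big_ord_recr.
Qed.

Lemma mean_bound f M : bm f -> (forall t v, lo <= t <= hi -> `|f (t, v)| <= M) ->
  `|I f| <= M.
Proof.
move=> bf fM; rewrite ler_norml; apply/andP; split.
  rewrite -(mean_cst (- M)); apply: mean_le => // [|t v /(fM _ v)]; first exact: bm_cst.
  by rewrite ler_norml => /andP[].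
rewrite -(mean_cst M); apply: mean_le => // [|t v /(fM _ v)]; first exact: bm_cst.
by rewrite ler_norml => /andP[].
Qed.

Lemma mean_dist f g e : bm f -> bm g ->
  (forall t v, lo <= t <= hi -> `|f (t, v) - g (t, v)| <= e) -> `|I f - I g| <= e.
Proof. by move=> bf bg fg; rewrite -meanB//; apply: mean_bound => //; exact: bmB. Qed.

Definition below (q : R) (x : R * R) : R := (x.1 <= q)%R%:R.

Lemma bm_below q : bm (below q).
Proof. by apply: bm_ler => //; exact: measurable_cst. Qed.

Lemma bm_snd (phi : R -> R) : bm1 phi -> bm (fun x => phi x.2).
Proof.
by move=> [mphi [M phiM]]; split; [exact: measurableT_comp | exists M].
Qed.

Lemma bm_belowM q (phi : R -> R) : bm1 phi -> bm (fun x => below q x * phi x.2).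
Proof. by move=> bphi; apply: bmM; [exact: bm_below | exact: bm_snd]. Qed.

(** A Riemann-Stieltjes sum: the difference of the two [below] factors is the indicator of the slab
    [q k < t <= q k.+1], and the slabs cover each signal in [[lo, hi]] exactly once. *)
Lemma mean_partition (q : nat -> R) (K : nat) (Psi : R * R -> R) (e : R) :
  bm Psi -> (forall k, bm1 (fun v => Psi (q k, v))) ->
  (forall k, q k <= q k.+1) -> q 0%N < lo -> hi <= q K ->
  (forall k t v, (k < K)%N -> q k < t <= q k.+1 -> lo <= t <= hi ->
     `|Psi (t, v) - Psi (q k, v)| <= e) ->
  `|I Psi - \sum_(k < K) (I (fun x => below (q k.+1) x * Psi (q k, x.2)) -
                          I (fun x => below (q k) x * Psi (q k, x.2)))| <= e.
Proof.
move=> bP bPq qS q0 qK Pe.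
pose F k x := below (q k.+1) x * Psi (q k, x.2) - below (q k) x * Psi (q k, x.2).
have bF k : bm (F k) by apply: bmB; exact: (bm_belowM _ (bPq k)).
have -> : \sum_(k < K) (I (fun x => below (q k.+1) x * Psi (q k, x.2)) -
                          I (fun x => below (q k) x * Psi (q k, x.2))) =
    \sum_(k < K) I (F k).
  by apply: eq_bigr => k _; rewrite meanB//; exact: (bm_belowM _ (bPq k)).
rewrite -mean_sum//; apply: mean_dist => //; first exact: bm_sum.
move=> t v lth; have [t0 t1] := andP lth.
have qle : {homo q : m n / (m <= n)%N >-> m <= n} by apply: homo_leq => // x y z; exact: le_trans.
have [k [kK tk tk1]] : exists k, [/\ (k < K)%N, q k < t & t <= q k.+1].
  have ex : exists k, t <= q k by exists K; exact: le_trans qK.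
  case: (ex_minnP ex) => -[|k] tk kmin; first by move: (lt_le_trans q0 t0); rewrite ltNge tk.
  exists k; split => //; first by apply: kmin; exact: le_trans qK.
  by rewrite ltNge; apply/negP => /kmin; rewrite ltnn.
have Fk : F k (t, v) = Psi (q k, v).
  by rewrite /F /below/= tk1 (lt_geF tk) mul1r mul0r subr0.
rewrite (bigD1 (Ordinal kK))//= Fk big1 ?addr0; first by apply: Pe => //; rewrite tk.
move=> i ik; rewrite /F /below/=; case: (ltngtP i k) => [lik|lki|eik]; last first.
- by move/eqP: ik; case; exact: val_inj.
- have tq : t <= q i by apply: le_trans tk1 _; exact: qle.
  by rewrite tq (le_trans tq (qS i)) subrr.
- have tq : q i.+1 < t by apply: le_lt_trans tk; exact: qle.
  by rewrite (lt_geF tq) (lt_geF (le_lt_trans (qS i) tq)) mul0r subrr.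
Qed.

End MeanTheory.

(** * Means with interlacing distribution functions *)

Section TwoMeans.
Variables (L E : (R * R -> R) -> R) (mL : is_mean L) (mE : is_mean E).
Variable D : set R.
Hypothesis D_dense : forall x y, x < y -> exists2 q, D q & x < q < y.
Hypothesis L_le_E : forall q phi, D q -> bm1 phi -> (forall v, 0 <= phi v) ->
  L (fun x => below q x * phi x.2) <= E (fun x => below q x * phi x.2).
Hypothesis E_le_L : forall q q', D q -> D q' -> q < q' -> E (below q) <= L (below q').

Let err q := E (below q) - L (below q).

(** By [E_le_L], [E (below q)] grows by at least the error at each later point of [D]. An error
    above [e] throughout an interval would push it beyond 1. *)
Let small_err x y e : x < y -> 0 < e -> exists2 q, D q /\ x < q < y & err q <= e.
Proof.
move=> xy e0; apply: contrapT => H.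
have {}H q : D q -> x < q < y -> e < err q.
  by move=> Dq xqy; rewrite ltNge; apply/negP => qe; apply: H; exists q.
have grow N : exists2 q, D q /\ x < q < y & N%:R * e <= E (below q).
  elim: N => [|N [q [Dq /andP[xq qy]] Nq]].
    have [q Dq xqy] := D_dense xy; exists q => //; rewrite mul0r -(mean_cst mE 0).
    by apply: (mean_le mE) => [||t v _]; [exact: bm_cst|exact: bm_below|exact: ler0n].
  have [q' Dq' /andP[qq' q'y]] := D_dense qy.
  have xq'y : x < q' < y by rewrite q'y (lt_trans xq qq').
  exists q' => //; rewrite -natr1 mulrDl mul1r.
  have := H _ Dq' xq'y; have := E_le_L Dq Dq' qq'; rewrite /err; lra.
have [q _] := grow (Num.bound (e^-1)).
have E1 : E (below q) <= 1.
  rewrite -(mean1 mE); apply: (mean_le mE) => [||t v _]; [exact: bm_below|exact: bm_cst|].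
  by rewrite /below lern1 leq_b1.
move=> /le_trans/(_ E1); rewrite leNgt -ltr_pdivrMr// div1r; apply/negP; rewrite negbK.
by apply: archi_boundP; rewrite invr_ge0 ltW.
Qed.

(** The one-sided hypothesis is applied to both nonnegative weights [phi + M] and [M - phi]; the
    constants contribute [M * err q]. *)
Let below_close q phi M : D q -> bm1 phi -> (forall v, `|phi v| <= M) ->
  `|L (fun x => below q x * phi x.2) - E (fun x => below q x * phi x.2)| <= M * err q.
Proof.
move=> Dq bphi phiM.
have bb := bm_belowM q bphi; have bq := bm_below q.
have up : L (fun x => below q x * (phi x.2 + M)) <= E (fun x => below q x * (phi x.2 + M)).
  apply: (L_le_E (phi := fun v => phi v + M)) => //; first by apply: bmD => //; exact: bm_cst.
  by move=> v; have := phiM v; rewrite ler_norml => /andP[]; lra.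
have dn : L (fun x => below q x * (M - phi x.2)) <= E (fun x => below q x * (M - phi x.2)).
  apply: (L_le_E (phi := fun v => M - phi v)) => //; first by apply: bmB => //; exact: bm_cst.
  by move=> v; have := phiM v; rewrite ler_norml => /andP[]; lra.
have e1 (I : (R * R -> R) -> R) : is_mean I ->
    I (fun x => below q x * (phi x.2 + M)) =
    I (fun x => below q x * phi x.2) + M * I (below q).
  move=> mI; rewrite -(meanZ mI)// -(meanD mI)//; last by apply: bmM => //; exact: bm_cst.
  by congr I; apply/funext => x; ring.
have e2 (I : (R * R -> R) -> R) : is_mean I ->
    I (fun x => below q x * (M - phi x.2)) =
    M * I (below q) - I (fun x => below q x * phi x.2).
  move=> mI; rewrite -(meanZ mI)// -(meanB mI)//; last by apply: bmM => //; exact: bm_cst.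
  by congr I; apply/funext => x; ring.
move: up dn; rewrite !e1// !e2// ler_norml /err; lra.
Qed.

(** A Lipschitz integrand is nearly constant on thin slabs, and the slab endpoints can be placed
    where the two distribution functions nearly agree. The Lipschitz range is widened by 1 because
    the outermost endpoints fall outside [[lo, hi]]. *)
Lemma mean_eq_lipschitz (Psi : R * R -> R) (C : R) : lo < hi -> bm Psi ->
  (forall t, bm1 (fun v => Psi (t, v))) ->
  (forall t t' v, lo - 1 <= t <= hi + 1 -> lo - 1 <= t' <= hi + 1 ->
    `|Psi (t, v) - Psi (t', v)| <= C * `|t - t'|) ->
  L Psi = E Psi.
Proof.
move=> lohi bP bPt PC; apply/eqP; rewrite -subr_eq0 -normr_le0; apply/ler_addgt0Pl => e e0.
rewrite addr0.
have [M M0 PM] := bm_bound bP.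
(* The summand 1 gives [eta < 1]; the other one gives oscillation at most [e / 3] on slabs of width
   [2 * eta]. *)
pose m := Num.bound ((hi - lo) * (6 * `|C| / e + 1)).
have hl0 : 0 < hi - lo by rewrite subr_gt0.
have c0 : 0 <= 6 * `|C| / e by rewrite divr_ge0 ?mulr_ge0// ltW.
have mb : (hi - lo) * (6 * `|C| / e + 1) < m%:R.
  by apply: archi_boundP; rewrite mulr_ge0 ?ltW// ltr_wpDl.
have m0 : 0 < m%:R :> R by apply: le_lt_trans mb; rewrite mulr_ge0 ?ltW// ltr_wpDl.
pose eta := (hi - lo) / m%:R.
have eta0 : 0 < eta by rewrite divr_gt0.
have etab : eta * (6 * `|C| / e + 1) < 1.
  by rewrite /eta mulrAC ltr_pdivrMr// mul1r.
have eta1 : eta < 1.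
  by apply: le_lt_trans etab; rewrite ler_peMr ?(ltW eta0)// lerDr.
have etaC : `|C| * (2 * eta) <= e / 3.
  have : eta * (6 * `|C| / e) < 1.
    by apply: le_lt_trans etab; rewrite ler_wpM2l ?ltW// ltrDl.
  rewrite mulrA ltr_pdivrMr// mul1r => h; lra.
pose K := m.+1.
pose e' := e / 3 / (2 * M * K%:R).
have K0 : 0 < 2 * M * K%:R by rewrite !mulr_gt0.
have e'0 : 0 < e' by rewrite !divr_gt0.
(* One endpoint [q k] is chosen inside each mesh cell. Starting at [lo - eta] puts [q 0] below [lo],
   and [a K = hi] puts [q K] above [hi]. The value of [e'] makes the [K] slab errors [2 * M * e']
   add up to [e / 3]. *)
pose a k := lo - eta + k%:R * eta.
have aS k : a k < a k.+1 by rewrite /a -natr1 mulrDl mul1r addrA ltrDl.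
have /choice[q Hq] : forall k, exists q, [/\ D q, a k < q < a k.+1 & err q <= e'].
  by move=> k; have [q [Dq akq] qe] := small_err (aS k) e'0; exists q.
have Dq k : D (q k) by have [] := Hq k.
have aq k : a k < q k by have [_ /andP[]] := Hq k.
have qa k : q k < a k.+1 by have [_ /andP[]] := Hq k.
have qe k : err (q k) <= e' by have [] := Hq k.
have qS k : q k <= q k.+1 by rewrite ltW// (lt_trans (qa k)).
have aK : a K = hi.
  have me : m%:R * eta = hi - lo by rewrite /eta mulrCA divff ?mulr1// gt_eqF.
  rewrite /a /K -natr1 mulrDl mul1r me; ring.
have aKS : a K.+1 < hi + 1 by rewrite /a -natr1 mulrDl mul1r addrA -/(a K) aK ltrD2l.
have ale k : (k <= K)%N -> a k.+1 <= a K.+1.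
  by move=> kK; rewrite /a lerD2l ler_wpM2r ?(ltW eta0)// ler_nat.
have part (I : (R * R -> R) -> R) : is_mean I ->
    `|I Psi - \sum_(k < K) (I (fun x => below (q k.+1) x * Psi (q k, x.2)) -
                          I (fun x => below (q k) x * Psi (q k, x.2)))| <= e / 3.
  move=> mI; apply: (mean_partition mI) => //.
  - by have := qa 0%N; rewrite /a mul1r subrK.
  - by rewrite -aK ltW.
  - move=> k t v kK /andP[qt tq] /andP[lot thi].
    have qk1 : q k <= hi + 1.
      by rewrite ltW// (lt_trans (qa k))// (le_lt_trans _ aKS)// ale// ltnW.
    have qk0 : lo - 1 <= q k.
      have := aq k; have : 0 <= k%:R * eta by rewrite mulr_ge0// ltW.
      rewrite /a; lra.
    apply: le_trans (PC t (q k) v _ _) _; [lra|lra|].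
    apply: le_trans etaC; apply: le_trans (ler_wpM2r (normr_ge0 _) (ler_norm C)) _.
    rewrite ler_wpM2l// ger0_norm ?subr_ge0 ?ltW//.
    have := aq k; have := qa k.+1; rewrite /a -[k.+2%:R]natr1 -[k.+1%:R]natr1; lra.
have d (I J : R) x y : `|I - x| <= e / 3 -> `|J - y| <= e / 3 -> `|x - y| <= e / 3 ->
    `|I - J| <= e.
  by rewrite !ler_norml; lra.
apply: (d _ _ _ _ (part _ mL) (part _ mE)).
rewrite -sumrB; apply: le_trans (ler_norm_sum _ _ _) _.
have -> : e / 3 = \sum_(k < K) (2 * M * e').
  by rewrite sumr_const card_ord -[RHS]mulr_natr [RHS]mulrAC [RHS]mulrC /e' divfK ?gt_eqF.
apply: ler_sum => k _.
have h1 := below_close (Dq k.+1) (bPt (q k)) (fun v => PM (q k, v)).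
have h2 := below_close (Dq k) (bPt (q k)) (fun v => PM (q k, v)).
have h3 : M * err (q k.+1) <= M * e' by rewrite ler_wpM2l// ltW.
have h4 : M * err (q k) <= M * e' by rewrite ler_wpM2l// ltW.
move: h1 h2; rewrite !ler_norml /=; lra.
Qed.

End TwoMeans.
End Mean.

(** * Limits of means along an ultrafilter *)

Section UltrafilterLimit.

Lemma fmap_ultra_filter (T S : Type) (f : T -> S) (U : set_system T) :
  UltraFilter U -> UltraFilter (f @ U).
Proof.
move=> UU; have U_proper : ProperFilter U := ultra_proper.
split; first exact: fmap_proper_filter.
move=> G GP UG; apply/seteqP; split => // A GA.
have [//|UnA] := in_ultra_setVsetC (f @^-1` A) UU.
have GnA : G (~` A) by apply: UG.
by have : G set0; [rewrite -(setICr A); exact: filterI | move/filter_not_empty].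
Qed.

Context (R : realType) (lo hi : R).
Local Notation bm := (@bounded_measurable _ (R * R)%type R).

(** The values at each bounded measurable function form a bounded sequence, which converges along an
    ultrafilter finer than [\oo]. Linearity and monotonicity survive, whereas countable additivity
    may be lost; this is why [is_mean] asks for no more. *)
Lemma mean_limit (E : nat -> (R * R -> R) -> R) : (forall n, is_mean lo hi (E n)) ->
  exists2 L, is_mean lo hi L & forall f y, bm f ->
    (forall e, 0 < e -> \forall n \near \oo, E n f <= y + e) -> L f <= y.
Proof.
move=> mE.
have [U [UU ooU]] := ultraFilterLemma (eventually_filter).
have U_proper : ProperFilter U := ultra_proper.
have cvgU (x : nat -> R) M : (forall n, `|x n| <= M) -> cvg (x @ U).
  move=> xM; have : compact `[- M, M]%classic by exact: segment_compact.
  rewrite compact_ultra => /(_ (x @ U)) [||l [_ xl]].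
  - exact: fmap_ultra_filter.
  - apply: (@filterS _ U _ setT) => [n _ /=|]; last exact: filterT.
    by rewrite in_itv/= -ler_norml.
  - by apply/cvg_ex; exists l.
have cvgE f : bm f -> cvg ((fun n => E n f) @ U).
  move=> bf; have [M _ fM] := bm_bound bf; apply: (cvgU _ M) => n.
  exact: (mean_bound (mE n)).
exists (fun f => lim ((fun n => E n f) @ U)).
  split.
  - move=> f g bf bg; apply/cvg_lim => //.
    under eq_cvg do rewrite (meanD (mE _) bf bg).
    by apply: cvgD; exact: cvgE.
  - move=> k f bf; apply/cvg_lim => //.
    under eq_cvg do rewrite (meanZ (mE _) _ bf).
    by apply: cvgM; [exact: cvg_cst | exact: cvgE].
  - move=> f g bf bg fg; apply: ler_lim; [exact: cvgE|exact: cvgE|].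
    by apply: nearW => n; exact: (mean_le (mE n)).
  - apply/cvg_lim => //; under eq_cvg do rewrite (mean1 (mE _)).
    exact: cvg_cst.
move=> f y bf fy; apply/ler_addgt0Pl => e e0; rewrite addrC.
apply: limr_le; first exact: cvgE.
by apply: ooU; exact: fy.
Qed.

End UltrafilterLimit.

Section LayerCake.
Context (R : realType).

(** The sum counts the thresholds passed, so it equals [truncn (x * N) / N]. *)
Lemma layer_cake (x : R) (N : nat) : (0 < N)%N -> 0 <= x <= 1 ->
  `|x - \sum_(k < N) (k.+1%:R / N%:R <= x)%R%:R / N%:R| <= N%:R^-1.
Proof.
move=> N0 /andP[x0 x1]; have NR : 0 < N%:R :> R by rewrite ltr0n.
pose j := Num.truncn (x * N%:R).
have xN0 : 0 <= x * N%:R by rewrite mulr_ge0// ltW.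
have jN : (j <= N)%N.
  rewrite -(ler_nat R); apply: le_trans (_ : x * N%:R <= _).
    by have /andP[] := truncn_itv xN0.
  by rewrite ler_piMl// ltW.
have -> : \sum_(k < N) (k.+1%:R / N%:R <= x)%R%:R / N%:R = j%:R / N%:R :> R.
  rewrite -mulr_suml; congr (_ / _).
  transitivity (\sum_(k < N) (k < j)%N%:R : R).
    apply: eq_bigr => k _; rewrite ler_pdivrMr//.
    by rewrite -truncn_ge_nat.
  rewrite -natr_sum; congr (_%:R).
  transitivity (\sum_(k < N | (k < j)%N) 1)%N.
    by rewrite [RHS]big_mkcond/=; apply: eq_bigr => k _; case: (_ < _)%N.
  by rewrite -(big_ord_widen N (fun=> 1%N))// sum1_card card_ord.
have /andP[jx xj] := truncn_itv xN0.
rewrite ger0_norm ?subr_ge0 ?ler_pdivrMr//.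
by rewrite lerBlDr -[X in X + _]mul1r -mulrDl ler_pdivlMr// addrC natr1 ltW.
Qed.

End LayerCake.

(** * Positive functionals and their densities *)

Section PositiveFunctional.
Context d (T : measurableType d) (R : realType).
Local Notation bm := (@bounded_measurable _ T R).

(** Scaled into [[0, 1]], [f] is within [N^-1] of a nonnegative combination of indicators. The
    approximation is uniform because [K] is only continuous in the sup norm, with constant [C]. *)
Lemma functional_ge0 (K : (T -> R) -> R) (C : R) :
  (forall f g, bm f -> bm g -> K (fun x => f x + g x) = K f + K g) ->
  (forall k f, bm f -> K (fun x => k * f x) = k * K f) ->
  (forall f (M : R), bm f -> (forall x, `|f x| <= M) -> `|K f| <= C * M) ->
  (forall A, measurable A -> 0 <= K (\1_A)) ->
  forall f, bm f -> (forall x, 0 <= f x) -> 0 <= K f.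
Proof.
move=> KD KZ KC K1 f bf f0.
have [M M0 fM] := bm_bound bf.
have C0 : 0 <= C.
  have := KC _ 1 (bm_cst T (0 : R)); rewrite mulr1 => KC1.
  by apply: le_trans (KC1 _) => // x; rewrite normr0.
have bg : bm (fun x => M^-1 * f x) by apply: bmM => //; exact: bm_cst.
suff : 0 <= K (fun x => M^-1 * f x) by rewrite KZ// pmulr_rge0// invr_gt0.
pose A (N k : nat) := [set x | k.+1%:R / N%:R <= M^-1 * f x].
have mA (N k : nat) : measurable (A N k).
  by rewrite -[X in measurable X]setTI; apply: measurable_fun_le => //; case: bg.
pose s (N n : nat) (x : T) : R := \sum_(k < n) N%:R^-1 * \1_(A N k) x.
have bs (N n : nat) : bm (s N n).
  by apply: bm_sum => k; apply: bmM; [exact: bm_cst | exact: bm_indic].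
have Ks (N n : nat) : 0 <= K (s N n).
  elim: n => [|n IH].
    have -> : s N 0%N = \1_set0.
      by apply/funext => x; rewrite /s big_ord0 indic0.
    exact: K1.
  have -> : s N n.+1 = (fun x => s N n x + N%:R^-1 * \1_(A N n) x).
    by apply/funext => x; rewrite /s big_ord_recr.
  have bA := bm_indic R (mA N n).
  by rewrite KD ?KZ ?addr_ge0 ?mulr_ge0 ?invr_ge0 ?K1//; apply: bmM => //; exact: bm_cst.
have Kd (N : nat) : (0 < N)%N -> - (C * N%:R^-1) <= K (fun x => M^-1 * f x).
  move=> N0.
  have h : `|K (fun x => M^-1 * f x + -1 * s N N x)| <= C * N%:R^-1.
    apply: KC => [|x]; first by apply: bmD => //; apply: bmM => //; exact: bm_cst.
    rewrite mulN1r; have -> : s N N x =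
        \sum_(k < N) (k.+1%:R / N%:R <= M^-1 * f x)%R%:R / N%:R.
      apply: eq_bigr => k _; rewrite indicE mulrC.
      by have -> : (x \in A N k) = (k.+1%:R / N%:R <= M^-1 * f x) by apply/idP/idP => /[!inE].
    apply: layer_cake => //; rewrite mulr_ge0 ?invr_ge0 ?(ltW M0)//=.
    by rewrite mulrC ler_pdivrMr// mul1r (le_trans (ler_norm _)).
  move: h; rewrite KD ?KZ//; last by apply: bmM => //; exact: bm_cst.
  by have := Ks N N; rewrite ler_norml => ? /andP[]; lra.
apply/ler_addgt0Pl => e e0.
pose N := (Num.bound (C / e)).+1.
have NR : 0 < N%:R :> R by rewrite ltr0n.
have Ce : C / e < N%:R.
  by apply: lt_le_trans (archi_boundP _) _; rewrite ?ler_nat// divr_ge0// ltW.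
have := Kd N isT; have : C * N%:R^-1 <= e.
  by rewrite ler_pdivrMr// mulrC -ler_pdivrMr// ltW.
lra.
Qed.

Section Density.
Variables (mu : probability T R) (J : (T -> R) -> R).
Hypothesis JD : forall f g, bm f -> bm g -> J (fun x => f x + g x) = J f + J g.
Hypothesis JZ : forall k f, bm f -> J (fun x => k * f x) = k * J f.
Hypothesis J_ge0 : forall f, bm f -> (forall x, 0 <= f x) -> 0 <= J f.
Hypothesis J_le : forall f, bm f -> (forall x, 0 <= f x) -> J f <= \int[mu]_x f x.

Let JB f g : bm f -> bm g -> J (fun x => f x - g x) = J f - J g.
Proof.
move=> bf bg; rewrite JD//; last exact: bmN.
congr (_ + _); rewrite -mulN1r -JZ//.
by congr J; apply/funext => x; rewrite mulN1r.
Qed.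

Let J0 : J (fun=> 0) = 0.
Proof.
have e := JZ 0 (bm_cst T (0 : R)); rewrite [RHS]mul0r in e; rewrite -[RHS]e.
by congr J; apply/funext => x; rewrite mul0r.
Qed.

(** [J] is controlled on bounded measurable functions only; the default 0 makes [m] nonnegative on
    all sets. *)
Let m (A : set T) : \bar R := if `[< measurable A >] then (J \1_A)%:E else 0%E.

Let mE A : measurable A -> m A = (J \1_A)%:E.
Proof. by move=> mA; rewrite /m; case: asboolP. Qed.

Let m0 : m set0 = 0%E.
Proof.
by rewrite mE//; congr (_%:E); rewrite -[RHS]J0; congr J; apply/funext => x; rewrite indic0.
Qed.

Let m_ge0 A : (0 <= m A)%E.
Proof.
rewrite /m; case: asboolP => // mA; rewrite lee_fin; apply: J_ge0 => //.
exact: bm_indic.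
Qed.

Let J_sum n (F : nat -> T -> R) : (forall k, bm (F k)) ->
  J (fun x => \sum_(0 <= k < n) F k x) = \sum_(0 <= k < n) J (F k).
Proof.
move=> bF; elim: n => [|n IH].
  by rewrite big_nil -[RHS]J0; congr J; apply/funext => x; rewrite big_nil.
rewrite big_nat_recr//= -IH -JD//; last exact: bm_sum.
by congr J; apply/funext => x; rewrite big_nat_recr.
Qed.

(** Countable additivity is inherited from [mu]: by [J_le], the value of [J] on the indicator of the
    remaining sets is at most the tail [r n] of [mu], which tends to 0. *)
Let m_sigma : semi_sigma_additive m.
Proof.
move=> F mF tF mU; rewrite mE//.
have bF k : bm (\1_(F k)) by exact: bm_indic.
have -> : (fun n => \sum_(0 <= i < n) m (F i))%E =
    EFin \o (fun n => \sum_(0 <= i < n) J (\1_(F i))).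
  by apply/funext => n /=; rewrite -sumEFin; apply: eq_bigr => k _; rewrite mE.
apply: cvg_EFin; first exact: nearW.
pose r n := fine (mu (\bigcup_k F k)) - \sum_(0 <= i < n) fine (mu (F i)).
have fin (A : set T) : measurable A -> mu A \is a fin_num by exact: fin_num_measure.
have r0 : r n @[n --> \oo] --> 0.
  rewrite -(subrr (fine (mu (\bigcup_k F k)))); apply: cvgB; first exact: cvg_cst.
  have := @measure_semi_sigma_additive _ _ _ mu F mF tF mU.
  have -> : (fun n => \sum_(0 <= i < n) mu (F i))%E =
      EFin \o (fun n => \sum_(0 <= i < n) fine (mu (F i))).
    by apply/funext => n /=; rewrite -sumEFin; apply: eq_bigr => k _; rewrite fineK// fin.
  by rewrite -[X in _ --> X -> _](fineK (fin _ mU)) => /fine_cvg.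
have bs n : bm (fun x => \sum_(0 <= k < n) \1_(F k) x) by apply: bm_sum.
have bU : bm (\1_(\bigcup_k F k)) by exact: bm_indic.
have sub n x : \sum_(0 <= k < n) \1_(F k) x <= \1_(\bigcup_k F k) x :> R.
  have [[k0 _ Fk0]|nF] := pselect ((\bigcup_k F k) x); last first.
    rewrite big1 => [|k _]; first by rewrite indicE.
    by rewrite indicE memNset// => Fk; apply: nF; exists k.
  rewrite [leRHS]indicE mem_set; last by exists k0.
  have Fk k : \1_(F k) x = (k == k0)%:R :> R.
    rewrite indicE; case: eqP => [->|kk0]; first by rewrite mem_set.
    by rewrite memNset// => Fk; apply: kk0; apply: tF => //; exists x.
  suff -> : \sum_(0 <= k < n) \1_(F k) x = (k0 < n)%N%:R :> R by rewrite lern1 leq_b1.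
  elim: n => [|n IH]; first by rewrite big_nil.
  by rewrite big_nat_recr//= IH Fk -natrD; congr (_%:R); case: ltngtP => //=; lia.
have e1 n : J (\1_(\bigcup_k F k)) - \sum_(0 <= i < n) J (\1_(F i)) =
    J (fun x => \1_(\bigcup_k F k) x - \sum_(0 <= k < n) \1_(F k) x).
  by rewrite JB// J_sum.
have dge n : \sum_(0 <= i < n) J (\1_(F i)) <= J (\1_(\bigcup_k F k)).
  by rewrite -subr_ge0 e1; apply: J_ge0 => [|x]; [exact: bmB | rewrite subr_ge0].
have dle n : J (\1_(\bigcup_k F k)) - r n <= \sum_(0 <= i < n) J (\1_(F i)).
  rewrite lerBlDl -lerBlDr e1.
  apply: le_trans (J_le _ _) _; [exact: bmB | by move=> x; rewrite subr_ge0|].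
  rewrite RintegralB//; [|exact: bm_integrable|exact: bm_integrable].
  rewrite E_indic// /r lerD2l lerN2 E_sum//.
  by under [leRHS]eq_bigr do rewrite E_indic//.
apply: (@squeeze_cvgr _ _ _ _ (fun n => J (\1_(\bigcup_k F k)) - r n)
  (cst (J (\1_(\bigcup_k F k))))).
- by apply: nearW => n; rewrite dle dge.
- rewrite -[X in _ --> X]subr0; apply: cvgB => //; exact: cvg_cst.
- exact: cvg_cst.
Qed.

HB.instance Definition _ := isMeasure.Build d T R m m0 m_ge0 m_sigma.

Let m_fin : fin_num_fun m.
Proof. by move=> A mA; rewrite mE. Qed.

HB.instance Definition _ := Measure_isFinite.Build d T R m m_fin.

Let m_dominated : m `<< mu.
Proof.
apply/null_content_dominatesP => A mA A0; rewrite mE//; congr (_%:E).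
have bA : bm (\1_A) by exact: bm_indic.
apply/eqP; rewrite eq_le J_ge0// andbT; apply: le_trans (J_le bA _) _ => //.
by rewrite E_indic// [X in fine X](_ : _ = 0%E).
Qed.

Lemma functional_density : exists2 f : T -> R,
  measurable_fun setT f /\ (forall x, 0 <= f x <= 1) &
  forall phi, bm phi -> J phi = \int[mu]_x (f x * phi x).
Proof.
pose g := Radon_Nikodym_SigmaFinite.f m mu.
pose h x := fine (g x).
have g0 x : (0 <= g x)%E by exact: Radon_Nikodym_SigmaFinite.f_ge0 m_dominated x.
have gE x : g x = (h x)%:E.
  by rewrite /h fineK//; exact: Radon_Nikodym_SigmaFinite.f_fin_num m_dominated x.
have h0 x : 0 <= h x by exact: fine_ge0.
have ig : mu.-integrable setT g by exact: Radon_Nikodym_SigmaFinite.f_integrable m_dominated.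
have mh : measurable_fun setT h.
  apply/measurable_EFinP; rewrite (_ : EFin \o h = g); last by apply/funext => x; rewrite [RHS]gE.
  exact: measurable_int ig.
have mg A : measurable A -> (J \1_A)%:E = (\int[mu]_(x in A) (h x)%:E)%E.
  move=> mA; rewrite -mE// (Radon_Nikodym_SigmaFinite.f_integral m_dominated)//.
  by apply: eq_integral => x _; rewrite -gE.
(* The derivative is bounded by 1 only almost everywhere; truncation makes the bound hold
   everywhere. Where [h] exceeds 1, [J] is at least the [mu]-measure by integration of [h] and at
   most it by [J_le], so [ind] still holds. *)
pose f x := Num.min (h x) 1.
have mf : measurable_fun setT f by exact: measurable_minr.
have f01 x : 0 <= f x <= 1 by rewrite /f le_min h0 ler01/= ge_min lexx orbT.
have bf : bm f.
  by apply: (bm_le (M := 1)) => // x; have /andP[f0 f1] := f01 x; rewrite ger0_norm.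
exists f => //.
have fE A : measurable A -> (\int[mu]_x (f x * \1_A x))%:E = (\int[mu]_(x in A) (f x)%:E)%E.
  move=> mA; rewrite -bm_integralE; last by apply: bmM => //; exact: bm_indic.
  rewrite [RHS]integral_mkcond; apply: eq_integral => x _.
  by rewrite patchE indicE; case: ifP; rewrite ?mulr1 ?mulr0.
have ind A : measurable A -> J \1_A = \int[mu]_x (f x * \1_A x).
  move=> mA; pose C := [set x | h x <= 1].
  have mC : measurable C.
    by rewrite -[X in measurable X]setTI; apply: measurable_fun_le.
  have mAC : measurable (A `&` C) by exact: measurableI.
  have mAD : measurable (A `\` C) by exact: measurableD.
  have AE x : \1_A x = \1_(A `&` C) x + \1_(A `\` C) x :> R.
    rewrite !indicE in_setI in_setD.
    by case: (x \in A); case: (x \in C); rewrite ?addr0 ?add0r.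
  have -> : \1_A = (fun x => \1_(A `&` C) x + \1_(A `\` C) x) :> (T -> R).
    by apply/funext.
  have b1 : bm (\1_(A `&` C)) by exact: bm_indic.
  have b2 : bm (\1_(A `\` C)) by exact: bm_indic.
  rewrite JD//; under eq_Rintegral do rewrite mulrDr.
  rewrite ED//; [congr (_ + _)|exact: bmM|exact: bmM]; apply: EFin_inj.
    rewrite mg// fE//; apply: eq_integral => x /[!inE] -[_ hx].
    by rewrite /f min_l.
  have fD x : x \in A `\` C -> (f x)%:E = 1%E.
    by move=> /[!inE] -[_ /negP]; rewrite -ltNge => /ltW hx; rewrite /f min_r.
  rewrite fE// (eq_integral _ _ fD) integral_cst// mul1e.
  apply/eqP; rewrite eq_le; apply/andP; split.
    have J2 : J (\1_(A `\` C)) <= \int[mu]_x \1_(A `\` C) x by apply: J_le.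
    by move: J2; rewrite E_indic// -lee_fin fineK ?fin_num_measure.
  rewrite mg// -[leLHS]mul1e -integral_cst//; apply: ge0_le_integral => //.
  - exact/measurable_EFinP/measurable_funTS.
  - by move=> x -[_ /negP]; rewrite -ltNge => /ltW hx; rewrite lee_fin.
have bfM phi : bm phi -> bm (fun x => f x * phi x) by exact: bmM.
(* The defect vanishes on indicators, so [functional_ge0] applies to it and to its opposite. The
   constant 2 adds the bounds of the two terms. *)
pose K phi := J phi - \int[mu]_x (f x * phi x).
have KD a b : bm a -> bm b -> K (fun x => a x + b x) = K a + K b.
  move=> ba bb; rewrite /K JD//; under [X in _ - X = _]eq_Rintegral do rewrite mulrDr.
  by rewrite ED; [ring|exact: bfM|exact: bfM].
have KZ k a : bm a -> K (fun x => k * a x) = k * K a.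
  move=> ba; rewrite /K JZ//; under [X in _ - X = _]eq_Rintegral do rewrite mulrCA.
  by rewrite EZ; [ring|exact: bfM].
have J_bound a (M : R) : bm a -> (forall x, `|a x| <= M) -> `|J a| <= M.
  move=> ba aM; have bM := bm_cst T M.
  have JM : J (fun=> M) <= M.
    rewrite -[leRHS](E_cst mu M); apply: J_le => // x.
    by apply: le_trans (aM point).
  rewrite ler_norml; apply/andP; split.
    have : 0 <= J (fun x => M + a x).
      by apply: J_ge0 => [|x]; [exact: bmD | have := aM x; rewrite ler_norml => /andP[]; lra].
    by rewrite JD//; lra.
  have : 0 <= J (fun x => M - a x).
    by apply: J_ge0 => [|x]; [exact: bmB | have := aM x; rewrite ler_norml => /andP[]; lra].
  by rewrite JB//; lra.
have K_bound a (M : R) : bm a -> (forall x, `|a x| <= M) -> `|K a| <= 2 * M.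
  move=> ba aM; have Ja := J_bound _ _ ba aM.
  have : `|\int[mu]_x (f x * a x)| <= M.
    have bM c := bm_cst T (c : R).
    have up x : f x * a x <= M /\ - M <= f x * a x.
      have := aM x; have /andP[f0 f1] := f01 x; rewrite ler_norml => /andP[].
      by move=> a0 a1; split; nra.
    rewrite ler_norml -(E_cst mu (- M)) -[X in _ <= _ <= X](E_cst mu M); apply/andP; split;
      apply: E_le => // [|x]; try exact: bfM; by case: (up x).
  by move: Ja; rewrite /K !ler_norml; lra.
have K1 A : measurable A -> K (\1_A) = 0 by move=> mA; rewrite /K ind// subrr.
have K0 a : bm a -> (forall x, 0 <= a x) -> K a = 0.
  move=> ba a0; apply/eqP; rewrite eq_le; apply/andP; split.
    rewrite -oppr_ge0; apply: (@functional_ge0 (fun b => - K b) 2) => //.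
    - by move=> b b' bb bb'; rewrite KD// opprD.
    - by move=> k b bb; rewrite KZ// mulrN.
    - by move=> b M bb bM; rewrite normrN; exact: K_bound.
    - by move=> A mA; rewrite K1// oppr0.
  by apply: (@functional_ge0 K 2) => // A mA; rewrite K1.
move=> phi bphi; apply/eqP; rewrite -subr_eq0 -/(K phi); apply/eqP.
have [M M0 phiM] := bm_bound bphi.
have bM := bm_cst T M.
have : K (fun x => M + phi x) = 0.
  apply: K0 => [|x]; first exact: bmD.
  by have := phiM x; rewrite ler_norml => /andP[]; lra.
by rewrite KD// (K0 _ bM) ?add0r// => x; exact: ltW.
Qed.

End Density.
End PositiveFunctional.

(** * Realization of a mean by a value and an independent uniform draw *)

Section UniformLaw.
Context (R : realType).
Local Notation U01 := (uniform_prob (@ltr01 R)).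
Local Notation bm := (@bounded_measurable _ (R * R)%type R).
Local Notation bm1 := (@bounded_measurable _ R R).

Lemma uniform01_lt (a : R) : 0 <= a <= 1 -> U01 [set u | u < a] = a%:E.
Proof.
move=> /andP[a0 a1].
have -> : [set u | u < a] = `]-oo, a[%classic by apply/seteqP; split => x /=; rewrite in_itv.
rewrite /uniform_prob integral_uniform_pdf.
have -> : `]-oo, a[%classic `&` `[0, 1]%classic = `[0, a[%classic :> set R.
  apply/seteqP; split => x /=; rewrite !in_itv/=; first by move=> [-> /andP[->]].
  by move=> /andP[-> xa]; rewrite xa (ltW (lt_le_trans xa a1)).
rewrite (eq_integral (fun=> 1%E)); last first.
  move=> x /[!inE]/=; rewrite in_itv/= => /andP[x0 xa]; rewrite /uniform_pdf x0.
  by rewrite (ltW (lt_le_trans xa a1)) subr0 invr1.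
rewrite integral_cst// mul1e [LHS]lebesgue_measure_itv/= lte_fin.
by case: ltP => [_|a00]; [rewrite oppr0 adde0 | congr (_%:E); apply/eqP; rewrite eq_le a0 a00].
Qed.

Variable mu : probability R R.
Local Notation W := (mu \x U01)%E.

Lemma bm_fst (phi : R -> R) : bm1 phi -> bm (fun x => phi x.1).
Proof.
by move=> [mphi [M phiM]]; split; [exact: measurableT_comp | exists M].
Qed.

Lemma bm_pair1 (Psi : R * R -> R) t : bm Psi -> bm1 (fun v => Psi (t, v)).
Proof.
move=> [mP [M PM]]; split; last by exists M.
exact: (measurableT_comp mP (pair1_measurable t)).
Qed.

Lemma bm_subgraph (f : R -> R) : measurable_fun setT f -> bm (fun z => (z.2 < f z.1)%R%:R).
Proof. by move=> mf; apply: bm_ltr => //; exact: measurableT_comp. Qed.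

(** For uniform [u], the event [u < f v] has conditional probability [f v]; this turns a density
    into an event. *)
Lemma integral_subgraph (f phi : R -> R) :
  measurable_fun setT f -> (forall x, 0 <= f x <= 1) ->
  bm1 phi -> (forall v, 0 <= phi v) ->
  \int[W]_z ((z.2 < f z.1)%R%:R * phi z.1) = \int[mu]_v (f v * phi v).
Proof.
move=> mf f01 bphi phi0; have bs := bm_subgraph mf.
have bsp : bm (fun z => (z.2 < f z.1)%R%:R * phi z.1) by apply: bmM => //; exact: bm_fst.
rewrite /Rintegral; congr fine.
rewrite fubini_tonelli1; last 2 first.
- by apply/measurable_EFinP; case: bsp.
- by move=> z; rewrite lee_fin mulr_ge0.
apply: eq_integral => v _; rewrite /fubini_F/=.
have mA : measurable [set u : R | u < f v].
  rewrite (_ : mkset _ = `]-oo, f v[%classic); first exact: measurable_itv.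
  by apply/seteqP; split => x /=; rewrite in_itv.
transitivity (\int[U01]_u ((phi v)%:E * (\1_[set u | u < f v] u)%:E))%E.
  apply: eq_integral => u _; rewrite indicE -EFinM mulrC; congr ((_ * _%:R)%:E).
  by congr nat_of_bool; apply/idP/idP => /[!inE].
rewrite ge0_integralZl//; [|exact/measurable_EFinP/measurable_indic|by rewrite lee_fin].
by rewrite integral_indic// setIT [X in (_ * X)%E]uniform01_lt// -EFinM mulrC.
Qed.

Section Representation.
Variables (lo hi : R) (L : (R * R -> R) -> R).
Hypotheses (lohi : lo < hi) (mL : is_mean lo hi L).
Hypothesis L_marginal : forall phi, bm1 phi -> L (fun x => phi x.2) = \int[mu]_v phi v.

Let d (k : nat) : R := ratr (odflt 0 (unpickle k)).

(** [f] is the conditional distribution function, at [d k], of the signal given the value. It exists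
    because [below] is at most 1 and the value marginal is [mu]. *)
Let density k : exists f : R -> R,
  [/\ measurable_fun setT f, forall x, 0 <= f x <= 1 &
  forall phi, bm1 phi -> L (fun x => below (d k) x * phi x.2) = \int[mu]_v (f v * phi v)].
Proof.
have bb phi := @bm_belowM R (d k) phi.
have [||||f [mf f01] fE] := @functional_density _ _ R mu
    (fun phi => L (fun x => below (d k) x * phi x.2)).
- move=> a b ba bb'; rewrite -(meanD mL (bb _ ba) (bb _ bb')).
  by congr L; apply/funext => x; rewrite mulrDr.
- move=> c a ba; rewrite -(meanZ mL _ (bb _ ba)).
  by congr L; apply/funext => x; rewrite mulrCA.
- move=> a ba a0; rewrite -(mean_cst mL 0); apply: (mean_le mL) => [||t v _].
  + exact: bm_cst.
  + exact: bb _ ba.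
  + by rewrite mulr_ge0.
- move=> a ba a0; rewrite -L_marginal//; apply: (mean_le mL) => [||t v _].
  + exact: bb _ ba.
  + exact: bm_snd.
  + by rewrite ler_piMl//= /below lern1 leq_b1.
by exists f.
Qed.

(** Inverse transform sampling. As [L] need not be countably additive, its distribution function may
    fail to be right-continuous; the law of [(T z, z.1)] only interlaces with it along the
    rationals, which is what [mean_eq_lipschitz] takes as input. *)
Lemma mean_representation : exists T : R * R -> R,
  [/\ measurable_fun setT T, forall z, lo <= T z <= hi &
  forall Psi C, bm Psi ->
    (forall t t' v, lo - 1 <= t <= hi + 1 -> lo - 1 <= t' <= hi + 1 ->
      `|Psi (t, v) - Psi (t', v)| <= C * `|t - t'|) ->
    L Psi = \int[W]_z Psi (T z, z.1)].
Proof.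
have [f Hf] := choice density.
have mf k : measurable_fun setT (f k) by have [] := Hf k.
have f01 k x : 0 <= f k x <= 1 by have [] := Hf k.
have fE k phi : bm1 phi ->
  L (fun x => below (d k) x * phi x.2) = \int[mu]_v (f k v * phi v) by have [] := Hf k => _ _; exact.
pose clamp x := Num.max lo (Num.min x hi).
pose g k (z : R * R) := if z.2 < f k z.1 then clamp (d k) else hi.
have g01 k z : lo <= g k z <= hi.
  rewrite /g /clamp; case: ifP => _; last by rewrite lexx ltW.
  by rewrite le_max lexx ge_max ge_min lexx orbT (ltW lohi).
(* The quantile, at level [z.2], of the conditional law of the signal given
   the value [z.1]. *)
pose T z := infs (g ^~ z) 0.
have gne z : [set g k z | k in [set k | (0 <= k)%N]] !=set0 by exists (g 0%N z), 0%N.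
have glb z : has_lbound [set g k z | k in [set k | (0 <= k)%N]].
  by exists lo => _ [k _ <-]; by case/andP: (g01 k z).
have Tg k z : T z <= g k z by apply: (ge_inf (glb z)); exists k.
have mT : measurable_fun setT T.
  apply: measurable_fun_infs => [z _|k].
    by exists lo => _ [k _ <-]; case/andP: (g01 k z).
  apply: measurable_fun_ifT; [|exact: measurable_cst|exact: measurable_cst].
  by apply: measurable_fun_ltr => //; exact: measurableT_comp.
have T01 z : lo <= T z <= hi.
  apply/andP; split; last by apply: le_trans (Tg 0%N z) _; case/andP: (g01 0%N z).
  by apply: (lb_le_inf (gne z)) => _ [k _ <-]; case/andP: (g01 k z).
exists T; split => // Psi C bP PC.
pose E (h : R * R -> R) := \int[W]_z h (T z, z.1).
have mTp : measurable_fun setT (fun z : R * R => (T z, z.1)).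
  exact: measurable_fun_pair.
have bE h : bm h -> bm (fun z => h (T z, z.1)).
  by move=> [mh [M hM]]; split; [exact: (measurableT_comp mh mTp) | exists M].
have mE : is_mean lo hi E.
  split.
  - by move=> a b ba bb; apply: ED; exact: bE.
  - by move=> k a ba; apply: EZ; exact: bE.
  - move=> a b ba bb ab; apply: E_le => [||z]; [exact: bE|exact: bE|].
    by apply: ab; exact: T01.
  - exact: E_cst.
apply: (mean_eq_lipschitz (D := range d) mL mE) => //.
- move=> x y xy; have [q /[!in_itv]/= xqy] := rat_in_itvoo xy.
  by exists (d (pickle q)); [exists (pickle q) | rewrite /d pickleK].
- move=> _ phi [k _ <-] bphi phi0.
  have bb := bm_belowM (d k) bphi.
  have [lok|klo] := leP lo (d k); last first.
    apply: (@le_trans _ _ 0).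
      rewrite -(mean_cst mL 0); apply: (mean_le mL) => [||t v /andP[lot _]] //.
        exact: bm_cst.
      by rewrite /below/= (lt_geF (lt_le_trans klo lot)) mul0r.
    rewrite -(mean_cst mE 0); apply: (mean_le mE) => [||t v _] //; first exact: bm_cst.
    by rewrite mulr_ge0.
  rewrite fE// -integral_subgraph//; apply: E_le => [||z].
  + by apply: bmM; [exact: bm_subgraph | exact: bm_fst].
  + exact: (bE _ bb).
  + rewrite ler_wpM2r// /below/= ler_nat; case: ltP => // zf.
    have := Tg k z; rewrite /g zf => /le_trans -> //.
    by rewrite /clamp ge_max lok ge_min lexx.
- move=> _ _ [k _ <-] [m _ <-] km.
  have [lok|klo] := leP lo (d k); last first.
    apply: (@le_trans _ _ 0).
      rewrite -(mean_cst mE 0); apply: (mean_le mE) => [||t v /andP[lot _]] //.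
      + exact: bm_below.
      + exact: bm_cst.
      + by rewrite /below/= (lt_geF (lt_le_trans klo lot)).
    rewrite -(mean_cst mL 0); apply: (mean_le mL) => [||t v _] //.
    + exact: bm_cst.
    + exact: bm_below.
  have [him|mhi] := leP hi (d m).
    apply: (@le_trans _ _ 1).
      rewrite -(mean1 mE); apply: (mean_le mE) => [||t v _] //.
      + exact: bm_below.
      + exact: bm_cst.
      + by rewrite /below lern1 leq_b1.
    rewrite -(mean1 mL); apply: (mean_le mL) => [||t v /andP[_ thi]] //.
    + exact: bm_cst.
    + exact: bm_below.
    + by rewrite /below/= (le_trans thi him).
  have bf j : bm1 (f j).
    by apply: (bm_le (M := 1)) => // x; have /andP[f0 f1] := f01 j x; rewrite ger0_norm.
  (* The densities increase with the threshold only for almost every value; [A j] collects the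
     exceptions. Off their union, [T z <= d k < d m] forces [z.2 < f m z.1]. *)
  pose A j := if d j < d m then [set v | f m v < f j v] else set0.
  have mA j : measurable (A j).
    rewrite /A; case: ifP => // _; have -> : [set v | f m v < f j v] = ~` [set v | f j v <= f m v].
      by apply/seteqP; split => v /=; rewrite ltNge => /negP.
    by apply: measurableC; rewrite -[X in measurable X]setTI; apply: measurable_fun_le.
  have A0 j : mu (A j) = 0%E.
    rewrite /A; case: ifP => [djm|_]; last exact: measure0.
    have := mA j; rewrite /A djm; set B := mkset _ => mB.
    have bB : bm1 (\1_B) by exact: bm_indic.
    have bh : bm1 (fun v => \1_B v * (f j v - f m v)) by apply: bmM => //; exact: bmB.
    have h0 v : 0 <= \1_B v * (f j v - f m v).
      rewrite indicE; case: (boolP (v \in B)) => [|_]; last by rewrite mul0r.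
      by rewrite inE mul1r subr_ge0 => /ltW.
    have h1 : \int[mu]_v (\1_B v * (f j v - f m v)) <= 0.
      have -> : \int[mu]_v (\1_B v * (f j v - f m v)) =
          \int[mu]_v (f j v * \1_B v) - \int[mu]_v (f m v * \1_B v).
        rewrite -RintegralB//; [|apply: bm_integrable; exact: bmM..].
        by apply: eq_Rintegral => v _; ring.
      rewrite -!fE// subr_le0; apply: (mean_le mL) => [||t v _].
      - exact: (bm_belowM _ bB).
      - exact: (bm_belowM _ bB).
      rewrite ler_wpM2r// /below/= ler_nat; case: leP => // tj.
      by rewrite (le_trans tj (ltW djm)).
    have : (\int[mu]_v `|(\1_B v * (f j v - f m v))%:E| = 0)%E.
      under eq_integral do rewrite gee0_abs ?lee_fin//.
      rewrite bm_integralE//; congr (_%:E); apply/eqP; rewrite eq_le h1/=.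
      exact: Rintegral_ge0.
    move/ae_eq_integral_abs => [//| |Z [mZ Z0 BZ]].
      by apply/measurable_EFinP; case: bh.
    apply: (subset_measure0 _ _ _ Z0) => // v Bv; apply: BZ => /= /(_ I) [].
    rewrite indicE mem_set// mul1r => /eqP; rewrite subr_eq0 => /eqP e.
    by move: Bv; rewrite /B/= e ltxx.
  pose N := \bigcup_j (A j `*` setT) : set (R * R).
  have mN : measurable N by apply: bigcup_measurable => j _; exact: measurableX.
  have N0 : W N = 0%E.
    apply/negligibleP => //; apply: negligible_bigcup => j.
    apply/negligibleP; first exact: measurableX.
    transitivity (mu (A j) * U01 setT)%E; first exact: product_measure1E.
    by rewrite [X in (X * _)%E]A0 mul0e.
  have -> : L (below (d m)) = \int[W]_z (z.2 < f m z.1)%R%:R.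
    have -> : below (d m) = (fun x => below (d m) x * (fun=> 1) x.2) :> (R * R -> R).
      by apply/funext => x; rewrite mulr1.
    rewrite (fE m (fun=> 1)); last exact: bm_cst.
    rewrite -(@integral_subgraph _ (fun=> 1))//; last exact: bm_cst.
    by apply: eq_Rintegral => z _; rewrite mulr1.
  rewrite -[leRHS]addr0 -[X in _ <= _ + X]/(fine 0%E) -N0 -E_indic// -ED//; last 2 first.
  + exact: bm_subgraph.
  + exact: bm_indic.
  apply: E_le => [||z].
  + exact: (bE _ (bm_below _)).
  + by apply: bmD; [exact: bm_subgraph|exact: bm_indic].
  rewrite /below/=; case: (leP (T z) (d k)) => [Tk|_]; last by rewrite addr_ge0.
  have [zf|fz] := ltP z.2 (f m z.1); first by rewrite lerDl.
  rewrite add0r indicE mem_set//.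
  have : T z < d m by exact: le_lt_trans Tk km.
  move=> /(inf_lt (gne z))[_ [j _ <-]]; rewrite /g; case: ifP => [zj jm|_ /lt_trans/(_ mhi)]; last first.
    by rewrite ltxx.
  have djm : d j < d m.
    move: jm; rewrite /clamp gt_max => /andP[_]; rewrite gt_min => /orP[//|hm].
    by move: (lt_trans hm mhi); rewrite ltxx.
  by exists j => //; split => //=; rewrite /A djm/=; exact: le_lt_trans zj.
- by move=> t; exact: bm_pair1.
- exact: PC.
Qed.

End Representation.
End UniformLaw.

(** * Comparison of finite measures on intervals *)

Section IntervalDomination.
Context (R : realType).

Lemma measure_halfline_right_continuous (nu : {finite_measure set R -> \bar R}) :
  right_continuous (fun x => fine (nu `]-oo, x]%classic)).
Proof.
move=> x; pose G (y : R) := fine (nu `]-oo, y]%classic).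
have G_le y z : y <= z -> G y <= G z.
  move=> yz; rewrite fine_le ?fin_num_measure// le_measure ?inE//.
  by move=> w /=; rewrite !in_itv/= => /le_trans; exact.
have cG : G (x + n.+1%:R^-1) @[n --> \oo] --> G x.
  have fin y : nu `]-oo, y]%classic \is a fin_num by exact: fin_num_measure.
  have eI : \bigcap_n `]-oo, x + n.+1%:R^-1]%classic = `]-oo, x]%classic :> set R.
    apply/seteqP; split => y /=.
      move=> H; rewrite in_itv/=; apply/ler_addgt0Pr => e e0.
      have [N _] : \forall n \near \oo, n.+1%:R^-1 < e by exact: near_infty_natSinv_lt (PosNum e0).
      move=> /(_ N (leqnn N)) /= Ne; have := H N I; rewrite /= in_itv/= => /le_trans; apply.
      by rewrite lerD2l ltW.
    rewrite in_itv/= => yx n _ /=; rewrite in_itv/= (le_trans yx)// lerDl invr_ge0//.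
  have := @nonincreasing_cvg_mu _ _ _ nu (fun n => `]-oo, x + n.+1%:R^-1]%classic).
  rewrite eI => H; apply: fine_cvg; rewrite fineK//.
  apply: H => //; first by rewrite -ge0_fin_numE// fin.
  move=> m n mn; apply/subsetPset => y /=; rewrite !in_itv/= => /le_trans; apply.
  by rewrite lerD2l lef_pV2 ?posrE// ler_nat.
apply/cvgrPdist_le => e e0.
move/cvgrPdist_le : cG => /(_ _ e0)[N _ /(_ N (leqnn N))/= GN].
have xN : x < x + N.+1%:R^-1 by rewrite ltrDl.
near=> y.
have xy : x <= y by [].
have yN : y <= x + N.+1%:R^-1 by near: y; exact: nbhs_right_le.
rewrite ler0_norm ?subr_le0 ?G_le//; move: GN.
rewrite ler0_norm ?subr_le0 ?G_le ?(ltW xN)//; apply: le_trans.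
by rewrite !opprB lerD2r G_le.
Unshelve. all: by end_near. Qed.

(* [lebesgue_stieltjes_measure_unique] is stated for the display of
   [measurableTypeR R] and not for that of [R]. *)
Let redisplay (nu : {measure set R -> \bar R}) : set (measurableTypeR R) -> \bar R := nu.

Section Redisplay.
Variable nu : {measure set R -> \bar R}.

Let redisplay0 : redisplay nu set0 = 0%E.
Proof. exact: measure0. Qed.

Let redisplay_ge0 A : (0 <= redisplay nu A)%E.
Proof. exact: measure_ge0. Qed.

Let redisplay_sigma : semi_sigma_additive (redisplay nu).
Proof. exact: (@measure_semi_sigma_additive _ _ _ nu). Qed.

HB.instance Definition _ := isMeasure.Build _ _ _ (redisplay nu)
  redisplay0 redisplay_ge0 redisplay_sigma.

End Redisplay.

(** The difference of the distribution functions is nondecreasing and right-continuous, so it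
    generates a Lebesgue-Stieltjes measure; by uniqueness, [beta] is [alpha] plus that measure. *)
Lemma measure_le_intervals (alpha beta : {finite_measure set R -> \bar R}) :
  (forall a b, a < b -> (alpha `]a, b]%classic <= beta `]a, b]%classic)%E) ->
  forall A, measurable A -> (alpha A <= beta A)%E.
Proof.
move=> ab.
have halfline (nu : {finite_measure set R -> \bar R}) a b : a <= b ->
    nu `]a, b]%classic = (fine (nu `]-oo, b]%classic) - fine (nu `]-oo, a]%classic))%:E.
  move=> leab.
  have -> : `]-oo, b]%classic = `]-oo, a]%classic `|` `]a, b]%classic :> set R.
    by rewrite -itv_bndbnd_setU// bnd_simp.
  rewrite measureU//; last first.
    by rewrite -subset0 => y [] /=; rewrite !in_itv/= => ya /andP[/lt_geF]; rewrite ya.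
  by rewrite fineD ?fin_num_measure// addrAC subrr add0r fineK ?fin_num_measure.
pose F x := fine (beta `]-oo, x]%classic) - fine (alpha `]-oo, x]%classic).
have F_nd : nondecreasing F.
  move=> x y; rewrite le_eqVlt => /orP[/eqP ->//|xy].
  have := ab _ _ xy; rewrite !halfline ?(ltW xy)// lee_fin /F; lra.
have F_rc : right_continuous F.
  by move=> x; apply: cvgB; exact: measure_halfline_right_continuous.
pose Fi := isCumulative.Build R _ R F F_nd F_rc.
pose FC : cumulative R R := HB.pack F Fi.
pose B x := fine (beta `]-oo, x]%classic).
have B_nd : nondecreasing B.
  move=> x y xy; rewrite fine_le ?fin_num_measure// le_measure ?inE//.
  by move=> w /=; rewrite !in_itv/= => /le_trans; exact.
have B_rc : right_continuous B by exact: measure_halfline_right_continuous.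
pose Bi := isCumulative.Build R _ R B B_nd B_rc.
pose BC : cumulative R R := HB.pack B Bi.
move=> A mA.
have lsE (H : cumulative R R) x y : x <= y ->
    lebesgue_stieltjes_measure H `]x, y]%classic = (H y - H x)%:E.
  move=> xy; rewrite /lebesgue_stieltjes_measure /measure_extension measurable_mu_extE/=; last exact: is_ocitv.
  by rewrite wlength_itv_bnd.
have eB : lebesgue_stieltjes_measure BC A = redisplay beta A.
  apply: lebesgue_stieltjes_measure_unique => // X /ocitvP[->|[[x y] /= xy ->]].
    by rewrite !measure0.
  by rewrite lsE ?ltW// [RHS]halfline ?ltW.
have eA : lebesgue_stieltjes_measure BC A =
    measure_add (redisplay alpha) (lebesgue_stieltjes_measure FC) A.
  apply: lebesgue_stieltjes_measure_unique => // X /ocitvP[->|[[x y] /= xy ->]].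
    by rewrite !measure0.
  rewrite lsE ?ltW//; apply/esym/(etrans (measure_addE _ _ _)).
  rewrite [X in (_ + X)%E]lsE ?ltW// [X in (X + _)%E]halfline ?ltW// -EFinD.
  by congr (_%:E); rewrite /= /B /F; ring.
have -> : beta A = redisplay beta A by [].
by rewrite -eB eA [leRHS]measure_addE leeDl.
Qed.

End IntervalDomination.

(** * Image laws under a weight *)

Section WeightedLaw.
Context d (Omega : measurableType d) (R : realType) (P : probability Omega R).
Variables (T : Omega -> R) (mT : measurable_fun setT T).

Section Weight.
Variables (w : Omega -> R) (bw : bounded_measurable w) (w_ge0 : forall z, 0 <= w z).

(** The anonymous arguments carry the facts on which the measure structure attached below
    depends. *)
Let weighted_law (_ : bounded_measurable w) (_ : forall z, 0 <= w z)
  (_ : measurable_fun setT T) (A : set R) : \bar R := (\int[P]_(z in T @^-1` A) (w z)%:E)%E.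

Let weighted0 : weighted_law bw w_ge0 mT set0 = 0%E.
Proof. by rewrite /weighted_law preimage_set0 integral_set0. Qed.

Let weighted_ge0 A : (0 <= weighted_law bw w_ge0 mT A)%E.
Proof. by apply: integral_ge0 => z _; rewrite lee_fin. Qed.

Let mpre A : measurable A -> measurable (T @^-1` A).
Proof. by move=> mA; rewrite -[X in measurable X]setTI; exact: mT. Qed.

Let weighted_sigma : semi_sigma_additive (weighted_law bw w_ge0 mT).
Proof.
move=> F mF tF mUF; rewrite /weighted_law preimage_bigcup; apply: cvg_toP.
  apply: ereal_nondecreasing_is_cvgn => m n mn.
  by apply: lee_sum_nneg_natr => // k _ _; exact: weighted_ge0.
rewrite ge0_integral_bigcup//=.
- by move=> k; exact: mpre.
- by apply/measurable_EFinP; apply: measurable_funTS; case: bw.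
- by move=> x _; rewrite lee_fin.
- by move=> i j _ _ [z [/= Fi Fj]]; apply: tF => //; exists (T z).
Qed.

Let weightedE A : measurable A ->
  weighted_law bw w_ge0 mT A = (\int[P]_z (\1_A (T z) * w z))%:E.
Proof.
move=> mA; rewrite -bm_integralE; last first.
  apply: bmM => //; split; first by apply: measurableT_comp => //; exact: measurable_indic.
  by exists 1 => x; rewrite indicE; case: (_ \in _); rewrite ?normr1 ?normr0.
rewrite /weighted_law integral_mkcond; apply: eq_integral => z _.
have e : (z \in T @^-1` A) = (T z \in A) by apply/idP/idP => /[!inE].
by rewrite patchE indicE e; case: (_ \in A); rewrite ?mul1r ?mul0r.
Qed.

HB.instance Definition _ := isMeasure.Build _ R R (weighted_law bw w_ge0 mT)
  weighted0 weighted_ge0 weighted_sigma.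

Let weighted_fin : fin_num_fun (weighted_law bw w_ge0 mT).
Proof. by move=> A mA; rewrite weightedE. Qed.

HB.instance Definition _ := Measure_isFinite.Build _ R R (weighted_law bw w_ge0 mT) weighted_fin.

Lemma weighted_law_measure : exists nu : {finite_measure set R -> \bar R},
  forall A, measurable A -> nu A = (\int[P]_z (\1_A (T z) * w z))%:E.
Proof. by exists (weighted_law bw w_ge0 mT). Qed.

End Weight.

Lemma bm_indic_comp (A : set R) : measurable A -> bounded_measurable (fun z => \1_A (T z) : R).
Proof.
move=> mA; split; first by apply: measurableT_comp => //; exact: measurable_indic.
by exists 1 => x; rewrite indicE; case: (_ \in _); rewrite ?normr1 ?normr0.
Qed.

(** The positive and negative parts of [D] weight two finite image laws of [T]; the sign of the
    integral over [A] is a comparison of these laws at [A], decided on intervals. *)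
Lemma integral_ge0_intervals (D : Omega -> R) : bounded_measurable D ->
  (forall a b, a < b -> 0 <= \int[P]_z (\1_(`]a, b]%classic) (T z) * D z)) ->
  forall A, measurable A -> 0 <= \int[P]_z (\1_A (T z) * D z).
Proof.
move=> bD Dab.
have bmax (f : Omega -> R) : bounded_measurable f -> bounded_measurable (fun z => Num.max (f z) 0).
  move=> [mf [M fM]]; apply: (bm_le (M := M)) => [|z].
    by apply: measurable_maxr => //; exact: measurable_cst.
  have M0 : 0 <= M by exact: le_trans (fM z).
  by case: (leP (f z) 0); rewrite ?normr0.
have [al alE] := weighted_law_measure (bmax _ (bmN bD)) (fun z => ltac:(by rewrite le_max lexx orbT)).
have [be beE] := weighted_law_measure (bmax _ bD) (fun z => ltac:(by rewrite le_max lexx orbT)).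
have split A : measurable A -> \int[P]_z (\1_A (T z) * D z) =
    \int[P]_z (\1_A (T z) * Num.max (D z) 0) - \int[P]_z (\1_A (T z) * Num.max (- D z) 0).
  move=> mA; have bA := bm_indic_comp mA.
  rewrite -RintegralB//; last 2 first.
  - by apply: bm_integrable; apply: bmM => //; exact: bmax.
  - by apply: bm_integrable; apply: bmM => //; exact: bmax (bmN bD).
  apply: eq_Rintegral => z _; rewrite -mulrBr; congr (_ * _).
  by case: (leP (D z) 0); case: (leP (- D z) 0); lra.
move=> A mA; rewrite split// subr_ge0 -lee_fin -alE// -beE//.
apply: measure_le_intervals mA => a b ab.
by rewrite alE// beE// lee_fin -subr_ge0 -split// Dab.
Qed.

End WeightedLaw.

(** Views a fibre of a probability kernel as a [probability], the type for which the calculus of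
    bounded measurable functions is stated. *)
Lemma measure_probability d (Y : measurableType d) (R : realType)
    (m : {measure set Y -> \bar R}) :
  m setT = 1%E -> exists Q : probability Y R, (Q : set Y -> \bar R) = m.
Proof.
move=> m1; exists (mnormalize m (\d_point : probability Y R)).
apply/funext => A; rewrite /= /mnormalize m1 onee_eq0/=.
by rewrite invr1 mule1.
Qed.

Lemma ge0_integral_eq0_ae d (X : measurableType d) (R : realType)
    (m : {measure set X -> \bar R}) (f : X -> \bar R) :
  measurable_fun setT f -> (forall x, (0 <= f x)%E) ->
  (\int[m]_x f x = 0)%E -> {ae m, forall x, f x = 0%E}.
Proof.
move=> mf f0 If; have [] := ae_eq_integral_abs m measurableT mf.
under eq_integral do rewrite gee0_abs//.
by move=> /(_ If) + _; apply: filterS => x; exact.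
Qed.

Section KernelPrecomposition.
Context d d' d'' (X : measurableType d) (Y : measurableType d') (Z : measurableType d'').
Context (R : realType) (f : X -> Y).

(** Reindexes the seller's strategy by the whole outcome, so that integrals over the posted price
    are measurable in the outcome. The argument [mf] lets the kernel structure be attached. *)
Definition kprecomp (mf : measurable_fun setT f) (k : R.-pker Y ~> Z) (x : X) :
  {measure set Z -> \bar R} := k (f x).

Variables (mf : measurable_fun setT f) (k : R.-pker Y ~> Z).

Let measurable_kprecomp U : measurable U -> measurable_fun setT (kprecomp mf k ^~ U).
Proof. by move=> mU; exact: (measurableT_comp (measurable_kernel k _ mU) mf). Qed.

HB.instance Definition _ := isKernel.Build _ _ _ _ _ (kprecomp mf k) measurable_kprecomp.

Let kprecomp_prob x : kprecomp mf k x setT = 1%E.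
Proof. exact: prob_kernel. Qed.

HB.instance Definition _ := Kernel_isProbability.Build _ _ _ _ _
  (kprecomp mf k) kprecomp_prob.

End KernelPrecomposition.

(** * The environment *)

Section Environment.
Context (R : realType) (V : set R) (vlo vhi : R) (mu : probability R R) (c : R -> R).
Hypotheses (V_compact : compact V) (V_lo : V vlo) (V_hi : V vhi).
Hypothesis V_itv : forall v, V v -> vlo <= v <= vhi.
Hypothesis mu_supp : msupport mu = V.
Hypothesis c_cont : {within V, continuous c}.
Hypothesis gain_ge0 : forall v, V v -> 0 <= v - c v.
Local Notation bm1 := (@bounded_measurable _ R R).

Lemma measurable_valuations : measurable V.
Proof. exact: compact_measurable. Qed.

(** Each point outside the support lies in a null open interval with rational endpoints, and there
    are countably many of these. *)
Lemma support_full : mu (~` V) = 0%E.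
Proof.
apply/negligibleP; first by apply: measurableC; exact: measurable_valuations.
pose I (n : nat) : set R := if unpickle n is Some (q, r) then `]ratr q, ratr r[%classic else set0.
pose J n := if `[< mu (I n) = 0%E >] then I n else set0.
have J0 n : mu.-negligible (J n).
  rewrite /J; case: asboolP => [I0|_]; last exact: negligible_set0.
  apply/negligibleP => //; rewrite /I; case: unpickle => [[q r]|] //.
apply: negligibleS (negligible_bigcup J0) => x; rewrite -mu_supp /msupport => nx.
have [U [oU Ux U0]] : exists U : set R, [/\ open U, U x & mu U = 0%E].
  apply: contrapT => H; apply: nx => U oU Ux; rewrite lt_neqAle measure_ge0 andbT.
  by apply/negP => /eqP U0; apply: H; exists U.
have /nbhs_ballP[e /= e0 xU] : nbhs x U by exact: open_nbhs_nbhs.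
have [q /[!in_itv]/= /andP[eq qx]] : exists q, ratr q \in `]x - e, x[.
  by apply: rat_in_itvoo; rewrite ltrBlDr ltrDl.
have [r /[!in_itv]/= /andP[xr re]] : exists q, ratr q \in `]x, x + e[.
  by apply: rat_in_itvoo; rewrite ltrDl.
exists (pickle (q, r)) => //; rewrite /J.
have -> : I (pickle (q, r)) = `]ratr q, ratr r[%classic by rewrite /I pickleK.
case: asboolP => [_|[]]; first by rewrite /= in_itv/= qx xr.
apply: (subset_measure0 _ _ _ U0) => //; first exact: open_measurable.
move=> y /=; rewrite in_itv/= => /andP[qy yr]; apply: xU.
by rewrite /ball/= ltr_distl; apply/andP; split; lra.
Qed.

Lemma cost_bounded : exists2 K, 0 < K & forall v, V v -> `|c v| <= K.
Proof.
have /compact_bounded[M [_ cM]] := continuous_compact c_cont V_compact.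
exists (`|M| + 1) => [|v Vv]; first by rewrite ltr_pwDr.
apply: (cM (`|M| + 1)); last by exists v.
by rewrite (le_lt_trans (ler_norm M))// ltrDl.
Qed.

(* [sale a b] is the seller's payoff when exactly the types [v >= a] buy at
   price [b]; it is cut off outside [V], where [c] is arbitrary. *)
Definition sale (a b v : R) : R := if (v \in V) && (a <= v) then b - c v else 0.

(** The additional buyers [a' <= v < a] are served without loss, since [c v <= v < a <= b']. *)
Lemma sale_le a b a' b' v : a' <= a -> b <= b' -> a <= b' -> sale a b v <= sale a' b' v.
Proof.
move=> aa bb ab; rewrite /sale; case: (boolP (v \in V)) => //= /[!inE] Vv.
have := gain_ge0 Vv; case: (leP a v) => av; first by rewrite (le_trans aa av); lra.
by case: (leP a' v) => //; lra.
Qed.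

Lemma sale_addr a b e v : 0 <= e -> sale a (b + e) v <= sale a b v + e.
Proof. by move=> e0; rewrite /sale; case: ifP; lra. Qed.

Lemma bm_valuations : bm1 (fun v => (v \in V)%:R).
Proof. by have := bm_indic R measurable_valuations. Qed.

Lemma bm_cost : bm1 (fun v => (v \in V)%:R * c v).
Proof.
have [K K0 cK] := cost_bounded.
apply: (bm_le (M := K)) => [|v]; last first.
  case: (boolP (v \in V)) => [/[!inE] Vv|_]; first by rewrite mul1r cK.
  by rewrite mul0r normr0 ltW.
have -> : (fun v => (v \in V)%:R * c v) = c \_ V.
  by apply/funext => v; rewrite patchE; case: ifP; rewrite ?mul1r ?mul0r.
apply/(measurable_restrictT _ measurable_valuations).
by apply: subspace_continuous_measurable_fun => //; exact: measurable_valuations.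
Qed.

Lemma saleE a b v : sale a b v = (a <= v)%R%:R * ((v \in V)%:R * b - (v \in V)%:R * c v).
Proof.
rewrite /sale; case: (v \in V) => /=; last by rewrite !mul0r subr0 mulr0.
by case: (a <= v); rewrite ?mul1r ?mul0r.
Qed.

Lemma measurable_sale d (T : measurableType d) (a b y : T -> R) :
  measurable_fun setT a -> measurable_fun setT b -> measurable_fun setT y ->
  measurable_fun setT (fun x => sale (a x) (b x) (y x)).
Proof.
move=> ma mb my; have comp (f : R -> R) : bm1 f -> measurable_fun setT (fun x => f (y x)).
  by move=> [mf _]; exact: measurableT_comp.
rewrite (_ : (fun x => _) = fun x => (a x <= y x)%R%:R *
  ((y x \in V)%:R * b x - (y x \in V)%:R * c (y x))); last by apply/funext => x; rewrite saleE.
apply: measurable_funM; first by case: (bm_ler ma my).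
apply: measurable_funB; last by apply: (comp (fun v => (v \in V)%:R * c v)); exact: bm_cost.
by apply: measurable_funM => //; apply: (comp (fun v => (v \in V)%:R)); exact: bm_valuations.
Qed.

Lemma bm_sale_comp d (T : measurableType d) (a b y : T -> R) :
  measurable_fun setT a -> bounded_measurable b -> measurable_fun setT y ->
  bounded_measurable (fun x => sale (a x) (b x) (y x)).
Proof.
move=> ma [mb [M bM]] my; have [K K0 cK] := cost_bounded.
apply: (bm_le (M := M + K)) => [|x]; first exact: measurable_sale.
have bx := bM x; have M0 : 0 <= M by rewrite (le_trans _ bx).
rewrite /sale; case: (boolP (y x \in V)) => [/[!inE] /cK cy|_] /=; last by rewrite normr0 addr_ge0// ltW.
case: ifP => _; last by rewrite normr0 addr_ge0// ltW.
by rewrite (le_trans (ler_normB _ _))// lerD.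
Qed.

Lemma bm_sale a b : bm1 (sale a b).
Proof.
rewrite (_ : sale a b = fun v => (a <= v)%R%:R *
  ((v \in V)%:R * b - (v \in V)%:R * c v)); last by apply/funext => v; rewrite saleE.
apply: bmM; first by apply: bm_ler => //; exact: measurable_cst.
apply: bmB; last exact: bm_cost.
by apply: bmM; [exact: bm_valuations | exact: bm_cst].
Qed.

Lemma integral_valuations (phi : R -> R) : bm1 phi ->
  \int[mu]_v ((v \in V)%:R * phi v) = \int[mu]_v phi v.
Proof.
move=> [mphi _]; rewrite /Rintegral; congr fine.
apply: eq_integral_ae_arbitrary.
exists (~` V); split => [||v /= nv]; [|exact: support_full|].
  by apply: measurableC; exact: measurable_valuations.
by apply: contra_not nv => Vv; rewrite mem_set// mul1r.
Qed.

Lemma bm_valuation : bm1 (fun v => (v \in V)%:R * v).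
Proof.
apply: (bm_le (M := `|vlo| + `|vhi|)).
  by apply: measurable_funM => //; case: bm_valuations.
move=> v; case: (boolP (v \in V)) => [/[!inE] /V_itv/andP[v0 v1]|_]; last first.
  by rewrite mul0r normr0 addr_ge0.
have := ler_norm vhi; have := ler_norm (- vlo); rewrite normrN mul1r => n0 n1.
rewrite ler_norml; apply/andP; split; have := normr_ge0 vlo; have := normr_ge0 vhi; lra.
Qed.

Definition gain (v : R) : R := (v \in V)%:R * v - (v \in V)%:R * c v.

Lemma bm_gain : bm1 gain.
Proof. by apply: bmB; [exact: bm_valuation | exact: bm_cost]. Qed.

Lemma gainE v : V v -> gain v = v - c v.
Proof. by move=> Vv; rewrite /gain mem_set// !mul1r. Qed.

Lemma ae_valuations (Q : R -> Prop) : (forall v, V v -> Q v) -> {ae mu, forall v, Q v}.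
Proof.
move=> VQ; exists (~` V); split => [||v /= nv]; [|exact: support_full|].
  by apply: measurableC; exact: measurable_valuations.
by apply: contra_not nv; exact: VQ.
Qed.

Lemma surplusE : surplus c mu = (\int[mu]_v gain v)%:E.
Proof.
rewrite -bm_integralE; last exact: bm_gain.
by apply: eq_integral_ae_arbitrary; apply: ae_valuations => v Vv; rewrite gainE.
Qed.

Lemma integral_sale p :
  (\int[mu]_(v in [set v | (p <= v)%R]) (p - c v)%:E)%E = (\int[mu]_v sale p p v)%:E.
Proof.
rewrite -bm_integralE; last exact: bm_sale.
rewrite integral_mkcond.
apply: eq_integral_ae_arbitrary; apply: ae_valuations => v Vv.
rewrite patchE /sale (mem_set Vv)/=.
by have -> : (v \in [set v | p <= v]) = (p <= v) by [apply/idP/idP => /[!inE]]; case: ifP.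
Qed.

Lemma pis_fb_le y : (pis_fb c mu <= y%:E)%E <-> forall p, \int[mu]_v sale p p v <= y.
Proof.
split => [H p|H].
  rewrite -lee_fin -integral_sale; apply: le_trans H.
  by apply: ereal_sup_ubound; exists p.
by apply: ge_ereal_sup => _ [p _ <-]; rewrite integral_sale lee_fin.
Qed.

(** The price [vlo] serves every type and the price [vhi + 1] serves none. *)
Lemma pis_low_le_fb : (pis_low c vlo mu <= pis_fb c mu)%E.
Proof.
rewrite /pis_low ge_max; apply/andP; split; apply: le_ereal_sup_tmp.
  exists (\int[mu]_v sale vlo vlo v)%:E; first by exists vlo => //; rewrite integral_sale.
  have -> : (\int[mu]_v (c v)%:E = (\int[mu]_v ((v \in V)%:R * c v))%:E)%E.
    rewrite -bm_integralE; last exact: bm_cost.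
    by apply: eq_integral_ae_arbitrary; apply: ae_valuations => v Vv; rewrite mem_set// mul1r.
  have bc := bm_cst R (vlo : R); have bV := bm_valuations.
  rewrite -EFinB lee_fin -[X in X - _](E_cst mu) -(integral_valuations bc) -RintegralB//.
  - apply: E_le; [|exact: bm_sale|move=> v].
      by apply: bmB; [exact: bmM|exact: bm_cost].
    rewrite saleE; case: (boolP (v \in V)) => [/[!inE] /V_itv/andP[-> _]|_].
      by rewrite !mul1r.
    by rewrite !mul0r subrr mulr0.
  - by apply: bm_integrable; exact: bmM.
  - by apply: bm_integrable; exact: bm_cost.
exists (\int[mu]_v sale (vhi + 1) (vhi + 1) v)%:E; first by exists (vhi + 1) => //; rewrite integral_sale.
rewrite lee_fin; apply: Rintegral_ge0 => v _; rewrite /sale.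
case: (boolP (v \in V)) => //= /[!inE] /V_itv/andP[_ vh].
by have /lt_geF -> : v < vhi + 1 by rewrite (le_lt_trans vh)// ltrDl.
Qed.

(** The mesh never exceeds [vhi - vlo], so this bounds the grid prices of all discretizations, whose
    laws thus share one signal interval. *)
Let top := vhi + 2 * (vhi - vlo).

(** Makes expressions in the signal bounded on the whole plane without changing them on
    [[vlo, top]], the only signals a mean sees. *)
Definition clamp (t : R) : R := Num.max vlo (Num.min t top).

Lemma clamp_id t : vlo <= t <= top -> clamp t = t.
Proof. by move=> /andP[t0 t1]; rewrite /clamp min_l// max_r. Qed.

Lemma clamp_itv t : vlo < vhi -> vlo <= clamp t <= top.
Proof.
move=> lohi; rewrite /clamp le_max lexx/= ge_max ge_min lexx orbT andbT.
by rewrite /top; lra.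
Qed.

(** * Discretized markets *)

Section Discretization.
Variable n : nat.
Hypothesis lohi : vlo < vhi.
(* The values [vt i.+2 <= v < vt i.+1] form the type [i] of a finite market and
   are given the value [vt i]: this overstates them by at most [2 * delta] and
   makes every gain from trade positive. *)
Let N := n.+2.
Let delta := (vhi - vlo) / n.+1%:R.
Let vt (i : nat) := vhi + 2 * delta - i%:R * delta.

Let delta_gt0 : 0 < delta.
Proof. by rewrite divr_gt0// subr_gt0. Qed.

Let vtS i : vt i.+1 = vt i - delta.
Proof. by rewrite /vt -natr1; ring. Qed.

Let vt_dec i : vt i.+1 < vt i.
Proof. by rewrite vtS; have := delta_gt0; lra. Qed.

Let vt_le i j : (i <= j)%N -> vt j <= vt i.
Proof.
by move=> ij; rewrite /vt lerD2l lerN2 ler_wpM2r ?(ltW delta_gt0)// ler_nat.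
Qed.

(** Cells are half-open on the right, so type 0 is the cell that starts at [vhi]; hence [N = n.+2]
    cells for [n.+1] mesh steps. *)
Let vt2 : vt 2 = vhi.
Proof. by rewrite /vt; ring. Qed.

Let vtN : vt N.+1 = vlo.
Proof.
have e : n.+1%:R * delta = vhi - vlo by rewrite mulrC divfK.
have e3 : n.+3%:R = n.+1%:R + 2 :> R by rewrite -natrD addn2.
have e4 : n.+3%:R * delta = vhi - vlo + 2 * delta by rewrite e3 mulrDl e.
by rewrite /vt /N e4; ring.
Qed.

Let locate v : vlo <= v <= vhi -> exists i, [/\ (i < N)%N, vt i.+2 <= v & v < vt i.+1].
Proof.
move=> /andP[v0 v1].
have ex : exists i, vt i.+2 <= v by exists n.+1; rewrite -/N vtN.
case: (ex_minnP ex) => i iv imin; exists i; split => //.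
  by apply: imin; rewrite -/N vtN.
case: i iv imin => [|i] _ imin; last by rewrite ltNge; apply/negP => /imin; rewrite ltnn.
by apply: le_lt_trans v1 _; rewrite -vt2; exact: vt_dec.
Qed.

Let ind (i : nat) (v : R) : R := (v \in V)%:R * ((vt i.+2 <= v)%R%:R * (v < vt i.+1)%R%:R).

Let bm_ind i : bm1 (ind i).
Proof.
apply: bmM; first exact: bm_valuations.
by apply: bmM; [apply: bm_ler | apply: bm_ltr] => //; exact: measurable_cst.
Qed.

Let ind_case i v : ind i v = 0 \/ [/\ ind i v = 1, V v, vt i.+2 <= v & v < vt i.+1].
Proof.
rewrite /ind; have [/[!inE] Vv|_] := boolP (v \in V); last by left; rewrite mul0r.
have [a|_] := leP (vt i.+2) v; last by left; rewrite mul0r mulr0.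
by have [b|_] := ltP v (vt i.+1); [right; rewrite !mulr1 | left; rewrite !mulr0].
Qed.

Let ind_ge0 i v : 0 <= ind i v.
Proof. by case: (ind_case i v) => [->|[->]]. Qed.

Let ind_sum v : \sum_(i < N) ind i v = (v \in V)%:R.
Proof.
case: (boolP (v \in V)) => [|nV]; last by rewrite big1// => i _; rewrite /ind (negbTE nV)/= mul0r.
move=> /[dup] vV /[!inE] Vv; have [k [kN kv vk]] := locate (V_itv Vv).
rewrite (bigD1 (Ordinal kN))//= big1 ?addr0; first by rewrite /ind vV kv vk !mul1r.
move=> i ik; case: (ind_case i v) => // -[_ _ iv vi].
case: (ltngtP i k) => [lik|lki|eik]; last by move/eqP: ik; case; exact: val_inj.
  by have := lt_le_trans vk (vt_le (lik : (i.+2 <= k.+1)%N)); rewrite ltNge iv.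
by have := lt_le_trans vi (vt_le (lki : (k.+2 <= i.+1)%N)); rewrite ltNge kv.
Qed.

(** In the cell containing [p], the threshold is lowered and the price raised. Prices above [vhi]
    sell nothing and prices below [vlo] sell to everyone, so the two extreme cells take care of
    them. *)
Let sale_round p : exists2 l, (l < N)%N & forall v, sale p p v <= sale (vt l.+2) (vt l) v.
Proof.
have [ph|hp] := leP p vhi; last first.
  exists 0%N => // v; rewrite /sale vt2; case: (boolP (v \in V)) => //= /[!inE] Vv.
  have /andP[_ vh] := V_itv Vv; have /lt_geF -> := le_lt_trans vh hp.
  have := gain_ge0 Vv; have := vt_dec 1; have := vt_dec 0; rewrite vt2.
  by case: ifP => // _; lra.
have [lp|pl] := leP vlo p; last first.
  exists n.+1 => // v; rewrite /sale -/N vtN; case: (boolP (v \in V)) => //= /[!inE] Vv.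
  have /andP[lv _] := V_itv Vv; rewrite lv (ltW (lt_le_trans pl lv)).
  have := vt_dec n.+1; have := vt_dec N; rewrite vtN /N.
  by lra.
have [|l [lN pl pu]] := locate (v := p); first by rewrite lp ph.
exists l => // v; have pv : p <= vt l by rewrite ltW// (lt_trans pu).
by apply: sale_le.
Qed.

Let m i := \int[mu]_v ind i v.
Let costV v := (v \in V)%:R * c v.
(** The average cost over the cell; an empty cell receives a cost below [vt i], so that every gain
    from trade is positive. *)
Let cost i := if m i == 0 then vt i - 1 else (\int[mu]_v (ind i v * costV v)) / m i.

Let m_ge0 i : 0 <= m i.
Proof. by apply: Rintegral_ge0 => v _. Qed.

Let m_cost i : m i * cost i = \int[mu]_v (ind i v * costV v).
Proof.
rewrite /cost; case: eqP => [m0|/eqP m0]; last by rewrite mulrC divfK.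
rewrite m0 mul0r; apply/esym.
have [K K0 cK] := cost_bounded.
have bi := bm_ind i; have bc : bm1 (fun v => ind i v * costV v) by apply: bmM => //; exact: bm_cost.
have h v : ind i v * costV v <= K * ind i v /\ - K * ind i v <= ind i v * costV v.
  case: (ind_case i v) => [->|[-> Vv _ _]]; first by rewrite !mul0r !mulr0.
  by rewrite /costV mem_set// !mul1r !mulr1; have := cK v Vv; rewrite ler_norml => /andP[].
apply/eqP; rewrite eq_le; apply/andP; split.
  rewrite -(mulr0 K) -m0 -EZ//; apply: E_le => // [|v]; last by case: (h v).
  by apply: bmM => //; exact: bm_cst.
rewrite -(mulr0 (- K)) -m0 -EZ//; apply: E_le => // [|v]; last by case: (h v).
by apply: bmM => //; exact: bm_cst.
Qed.

Let bm_costV : bm1 costV. Proof. exact: bm_cost. Qed.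

Let cost_lt i : cost i < vt i.
Proof.
rewrite /cost; case: eqP => [_|/eqP m0]; first by rewrite ltrBlDr ltrDl.
have mp : 0 < m i by rewrite lt_neqAle eq_sym m0 m_ge0.
apply: (@le_lt_trans _ _ (vt i.+1)); last exact: vt_dec.
rewrite ler_pdivrMr// -EZ//; apply: E_le => [||v].
- by apply: bmM => //; exact: bm_costV.
- by apply: bmM => //; exact: bm_cst.
case: (ind_case i v) => [->|[-> Vv _ vi]]; first by rewrite mul0r mulr0.
by rewrite /costV mem_set// !mul1r mulr1; have := gain_ge0 Vv; lra.
Qed.

Let cell_sale i l : \int[mu]_v (ind i v * sale (vt l.+2) (vt l) v) =
  if (i <= l)%N then m i * (vt l - cost i) else 0.
Proof.
case: leqP => il.
  rewrite mulrBr m_cost mulrC -EZ// -RintegralB//; last 2 first.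
  - by apply: bm_integrable; apply: bmM => //; exact: bm_cst.
  - by apply: bm_integrable; apply: bmM => //; exact: bm_costV.
  apply: eq_Rintegral => v _.
  case: (ind_case i v) => [->|[-> Vv iv _]]; first by rewrite !mul0r mulr0 subrr.
  rewrite /costV /sale mem_set//= !mul1r mulr1 (le_trans _ iv)//.
  exact: vt_le.
rewrite -[RHS](E_cst mu); apply: eq_Rintegral => v _.
case: (ind_case i v) => [->|[-> Vv _ vi]]; first by rewrite !mul0r.
by rewrite mul1r /sale lt_geF ?andbF// (lt_le_trans vi)// vt_le.
Qed.

Let profit_m l : (l < N)%N -> profit vt cost m l = \int[mu]_v sale (vt l.+2) (vt l) v.
Proof.
move=> lN; have bs := bm_sale (vt l.+2) (vt l).
transitivity (\sum_(i < N) \int[mu]_v (ind i v * sale (vt l.+2) (vt l) v)).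
  rewrite /profit (big_ord_widen N (fun i => m i * (vt l - cost i)))// big_mkcond/=.
  by apply: eq_bigr => i _; rewrite cell_sale ltnS.
rewrite -E_sum; last by move=> i; exact: bmM.
apply: eq_Rintegral => v _; rewrite -mulr_suml ind_sum /sale.
by case: (v \in V); rewrite ?mul1r ?mul0r.
Qed.

Variables (ae ai af pi0 : R).
Hypotheses (ae0 : 0 <= ae) (ai0 : 0 <= ai) (af0 : 0 <= af) (a1 : ae + ai + af = 1).
Hypothesis pi_ub : forall p, \int[mu]_v sale p p v <= pi0.
Hypothesis pi_lub : forall y, (forall p, \int[mu]_v sale p p v <= y) -> pi0 <= y.
Let S := \int[mu]_v gain v.

Let integral_cells f : bm1 f -> \int[mu]_v ((v \in V)%:R * f v) =
  \sum_(i < N) \int[mu]_v (ind i v * f v).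
Proof.
move=> bf; rewrite -E_sum; last by move=> i; exact: bmM.
by apply: eq_Rintegral => v _; rewrite -mulr_suml ind_sum.
Qed.

Let vt_itv j : (j < N)%N -> vlo <= vt j <= top.
Proof.
move=> jN; apply/andP; split.
  by rewrite -vtN vt_le// (leq_trans (ltnW jN)).
apply: (@le_trans _ _ (vt 0)); first exact: vt_le.
rewrite /vt /top mul0r subr0 lerD2l ler_wpM2l// ler_pdivrMr// ler_peMr// ?ler1n//.
by rewrite subr_ge0 ltW.
Qed.

Let best : exists s, [/\ (s < N)%N, forall i, (i < N)%N -> profit vt cost m i <= profit vt cost m s &
  pi0 <= profit vt cost m s <= pi0 + 2 * delta].
Proof.
case: (@arg_maxP _ _ _ (ord0 : 'I_N) xpredT (fun i => profit vt cost m i) isT) => s _ smax.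
have {}smax i : (i < N)%N -> profit vt cost m i <= profit vt cost m s.
  by move=> iN; exact: (smax (Ordinal iN)).
exists s; split => //; apply/andP; split.
  apply: pi_lub => p; have [l lN pl] := sale_round p.
  apply: le_trans (smax l lN); rewrite profit_m//.
  by apply: E_le => //; exact: bm_sale.
have e : vt s = vt s.+2 + 2 * delta by rewrite !vtS; ring.
rewrite profit_m// e; apply: le_trans (_ : \int[mu]_v (sale (vt s.+2) (vt s.+2) v + 2 * delta) <= _).
  apply: E_le => [||v]; [exact: bm_sale|by apply: bmD; [exact: bm_sale|exact: bm_cst]|].
  by apply: sale_addr; rewrite mulr_ge0// ltW.
by rewrite ED ?E_cst ?lerD2r//; [exact: bm_sale|exact: bm_cst].
Qed.

Let total : S <= \sum_(i < N) m i * (vt i - cost i) <= S + 2 * delta.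
Proof.
have bg := bm_gain.
have SE : S = \sum_(i < N) \int[mu]_v (ind i v * gain v).
  by rewrite -integral_cells// integral_valuations.
have e i : m i * (vt i - cost i) = \int[mu]_v (ind i v * (vt i - costV v)).
  rewrite mulrBr m_cost mulrC -EZ// -RintegralB//; last 2 first.
  - by apply: bm_integrable; apply: bmM => //; exact: bm_cst.
  - by apply: bm_integrable; apply: bmM => //; exact: bm_costV.
  by apply: eq_Rintegral => v _; ring.
have bvc i : bm1 (fun v => ind i v * (vt i - costV v)).
  by apply: bmM => //; apply: bmB; [exact: bm_cst | exact: bm_costV].
rewrite SE; under [X in _ <= X <= _]eq_bigr do rewrite e.
have vd i v : V v -> vt i.+2 <= v -> v < vt i.+1 -> gain v <= vt i - costV v <= gain v + 2 * delta.
  move=> Vv; rewrite gainE// /costV mem_set// mul1r !vtS => a b; have := delta_gt0.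
  by move=> d0; apply/andP; split; lra.
apply/andP; split.
  apply: ler_sum => i _; apply: E_le => [||v]; [exact: bmM|exact: bvc|].
  case: (ind_case i v) => [->|[-> Vv iv vi]]; first by rewrite !mul0r.
  by rewrite !mul1r; case/andP: (vd i v Vv iv vi).
have -> : 2 * delta = \sum_(i < N) 2 * delta * m i.
  rewrite -mulr_sumr (_ : \sum_(i < N) m i = 1) ?mulr1//.
  have := integral_cells (bm_cst _ (1 : R)); rewrite (integral_valuations (bm_cst _ (1 : R))) E_cst => ->.
  by apply: eq_bigr => i _; apply: eq_Rintegral => v _; rewrite mulr1.
rewrite -big_split/=; apply: ler_sum => i _.
rewrite -EZ// -ED//; [|exact: bmM|by apply: bmM => //; exact: bm_cst].
apply: E_le => [||v]; [exact: bvc|by apply: bmD; apply: bmM => //; exact: bm_cst|].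
case: (ind_case i v) => [->|[-> Vv iv vi]]; first by rewrite !mul0r mulr0 addr0.
by rewrite !mul1r mulr1; case/andP: (vd i v Vv iv vi).
Qed.

Let sum_m : \sum_(i < N) m i = 1.
Proof.
have := integral_cells (bm_cst _ (1 : R)); rewrite (integral_valuations (bm_cst _ (1 : R))) E_cst => ->.
by apply: eq_bigr => i _; apply: eq_Rintegral => v _; rewrite mulr1.
Qed.

(** The recommendation depends on the value only through its cell, with conditional weights [rho].
    The threshold [clamp x.1 - 2 * delta] appears because the finite market treats all of cell [j]
    as buying at [vt j]. The deviation [p] may vary with the signal, so that undercutting a
    recommendation by a fixed amount is covered. *)
Lemma discretized_market : exists E : (R * R -> R) -> R,
  [/\ is_mean vlo top E,
      forall phi, bm1 phi -> E (fun x => phi x.2) = \int[mu]_v phi v,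
      forall h p : R -> R, (forall t, 0 <= h t) ->
        E (fun x => h x.1 * sale (p x.1) (p x.1) x.2) <=
        E (fun x => h x.1 * sale (clamp x.1 - 2 * delta) (clamp x.1) x.2),
      (ae + ai) * pi0 + af * S <=
        E (fun x => sale (clamp x.1 - 2 * delta) (clamp x.1) x.2) <=
        (ae + ai) * pi0 + af * S + 2 * delta &
      `|E (fun x => (x.2 \in V)%:R * Num.max (x.2 - clamp x.1) 0) - ae * (S - pi0)|
        <= 4 * delta].
Proof.
have [s [sN smax /andP[s0 s1]]] := best.
have [Y [Y0 Ym Yo Ys] Yb] :=
  finite_segmentation vt_dec cost_lt ae0 ai0 af0 a1 sN m_ge0 smax.
(* For an empty cell the quotient is 0, in accordance with [Y j i = 0] there. *)
pose rho (j i : nat) := Y j i / m i.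
have rho_ge0 j i : 0 <= rho j i by rewrite divr_ge0.
have YE j i : (j < N)%N -> (i < N)%N -> Y j i = rho j i * m i.
  move=> jN iN; rewrite /rho; have [m0|m0] := eqVneq (m i) 0; last by rewrite divfK.
  rewrite m0 mulr0; have := Ym i iN; rewrite m0 => /eqP.
  rewrite psumr_eq0; last by move=> *; exact: Y0.
  by move=> /allP/(_ (Ordinal jN) (mem_index_enum _))/eqP.
pose E (f : R * R -> R) := \sum_(j < N) \sum_(i < N) rho j i * \int[mu]_v (ind i v * f (vt j, v)).
have bmi j f : bounded_measurable f -> forall i, bm1 (fun v => ind i v * f (vt j, v)).
  by move=> bf i; apply: bmM => //; exact: bm_pair1.
have rho_sum i : (i < N)%N -> (\sum_(j < N) rho j i) * m i = m i.
  move=> iN; rewrite mulr_suml -[RHS]Ym//.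
  by apply: eq_bigr => j _; rewrite YE.
have profitE j l : (j < N)%N -> (l < N)%N ->
    \sum_(i < N) rho j i * \int[mu]_v (ind i v * sale (vt l.+2) (vt l) v) =
    profit vt cost (Y j) l.
  move=> jN lN; rewrite /profit (big_ord_widen N (fun i => Y j i * (vt l - cost i)))// [RHS]big_mkcond/=.
  apply: eq_bigr => i _; rewrite cell_sale ltnS; case: ifP => _; last by rewrite mulr0.
  by rewrite YE// mulrA.
have row j : (j < N)%N -> forall f, (fun v => f (vt j, v)) = sale (vt j.+2) (vt j) ->
    \sum_(i < N) rho j i * \int[mu]_v (ind i v * f (vt j, v)) = profit vt cost (Y j) j.
  move=> jN f fE; rewrite -profitE//; apply: eq_bigr => i _.
  by congr (_ * _); apply: eq_Rintegral => v _; rewrite -fE.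
have clE j : (j < N)%N -> sale (clamp (vt j) - 2 * delta) (clamp (vt j)) = sale (vt j.+2) (vt j).
  move=> jN; rewrite clamp_id ?vt_itv//.
  by congr (sale _ _); rewrite !vtS; ring.
exists E; split.
- split.
  + move=> f g bf bg; rewrite /E -big_split/=; apply: eq_bigr => j _.
    rewrite -big_split/=; apply: eq_bigr => i _; rewrite -mulrDr -(ED mu (bmi j f bf i) (bmi j g bg i)).
    by congr (_ * _); apply: eq_Rintegral => v _; rewrite mulrDr.
  + move=> k f bf; rewrite /E mulr_sumr; apply: eq_bigr => j _.
    rewrite mulr_sumr; apply: eq_bigr => i _; rewrite mulrCA -(EZ mu k (bmi j f bf i)).
    by congr (_ * _); apply: eq_Rintegral => v _; rewrite mulrCA.
  + move=> f g bf bg fg; apply: ler_sum => j _; apply: ler_sum => i _.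
    rewrite ler_wpM2l//; apply: E_le => [||v]; [exact: bmi bf _|exact: bmi bg _|].
    by rewrite ler_wpM2l// fg// vt_itv.
  + rewrite /E exchange_big/= -[RHS]sum_m; apply: eq_bigr => i _.
    rewrite -mulr_suml -[RHS]rho_sum//; congr (_ * _).
    by apply: eq_Rintegral => v _; rewrite mulr1.
- move=> phi bphi; rewrite /E exchange_big/= -[RHS]integral_valuations// integral_cells//.
  apply: eq_bigr => i _; rewrite -mulr_suml.
  have [m0|m0] := eqVneq (m i) 0; last first.
    by rewrite -[X in X * _](mulfK m0) rho_sum// divff// mul1r.
  suff -> : \int[mu]_v (ind i v * phi v) = 0 by rewrite mulr0.
  have [M M0 phiM] := bm_bound bphi.
  have b1 : bm1 (fun v => ind i v * phi v) by exact: bmM.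
  have b2 k : bm1 (fun v => k * ind i v) by apply: bmM => //; exact: bm_cst.
  apply/eqP; rewrite eq_le; apply/andP; split.
    rewrite -(mulr0 M) -m0 -EZ//; apply: E_le => // v.
    by rewrite mulrC ler_wpM2r// (le_trans (ler_norm _)).
  rewrite -(mulr0 (- M)) -m0 -EZ//; apply: E_le => // v.
  by rewrite [leRHS]mulrC ler_wpM2r//; have := phiM v; rewrite ler_norml => /andP[].
- move=> h p h0; apply: ler_sum => j _ /=.
  have [l lN pl] := sale_round (p (vt j)).
  have hE (f : R -> R) : bm1 f -> \sum_(i < N) rho j i * \int[mu]_v (ind i v * (h (vt j) * f v)) =
      h (vt j) * \sum_(i < N) rho j i * \int[mu]_v (ind i v * f v).
    move=> bf; rewrite mulr_sumr; apply: eq_bigr => i _; rewrite mulrCA -(EZ mu _ (bmM (bm_ind i) bf)).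
    by congr (_ * _); apply: eq_Rintegral => v _; rewrite mulrCA.
  rewrite !hE; [|exact: bm_sale..].
  rewrite ler_wpM2l// clE// (profitE j j)//.
  apply: le_trans (Yo j l _ lN) => //; rewrite -profitE//.
  apply: ler_sum => i _; rewrite ler_wpM2l//; apply: E_le => [||v].
  + by apply: bmM => //; exact: bm_sale.
  + by apply: bmM => //; exact: bm_sale.
  + by rewrite ler_wpM2l.
- have -> : E (fun x => sale (clamp x.1 - 2 * delta) (clamp x.1) x.2) =
      (ae + ai) * profit vt cost m s + af * \sum_(i < N) m i * (vt i - cost i).
    rewrite -Ys; apply: eq_bigr => j _; rewrite -(profitE j j)//.
    by apply: eq_bigr => i _; rewrite /= clE.
  have /andP[t0 t1] := total; have d0 := delta_gt0.
  set p1 := profit _ _ _ _ in s0 s1 *; set S1 := \sum_(i < N) _ in t0 t1 *.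
  apply/andP; split; first by rewrite lerD// ler_wpM2l// addr_ge0.
  have h1 : (ae + ai) * p1 <= (ae + ai) * (pi0 + 2 * delta) by rewrite ler_wpM2l// addr_ge0.
  have h2 : af * S1 <= af * (S + 2 * delta) by rewrite ler_wpM2l.
  have h3 : (ae + ai) * (pi0 + 2 * delta) + af * (S + 2 * delta) =
     (ae + ai) * pi0 + af * S + (ae + ai + af) * (2 * delta) by ring.
  by rewrite a1 mul1r in h3; lra.
- pose K i j := Num.max (vt i - vt j) 0.
  (* [B] is the rent of the rounded market. Rounding the values changes the rent by at most
     [2 * delta], and [B] differs from [ae * (S - pi0)] by at most another [2 * delta]. *)
  pose B := \sum_(j < N) \sum_(i < N) rho j i * (m i * K i j).
  have BE : B = ae * (\sum_(i < N) m i * (vt i - cost i) - profit vt cost m s).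
    rewrite -Yb; apply: eq_bigr => j _.
    rewrite (big_ord_widen N (fun i => Y j i * (vt i - vt j)))// [RHS]big_mkcond/=.
    apply: eq_bigr => i _; rewrite mulrA -YE// /K ltnS; case: leqP => ij.
      by rewrite max_l// subr_ge0 vt_le.
    by rewrite max_r ?mulr0// subr_le0 vt_le// ltnW.
  set w := fun x : R * R => _.
  have wE i j v : (j < N)%N -> ind i v * w (vt j, v) = ind i v * Num.max (v - vt j) 0.
    move=> jN; rewrite /w/= clamp_id ?vt_itv//.
    by case: (ind_case i v) => [->|[-> Vv _ _]]; rewrite ?mul0r// mem_set// !mul1r.
  have bmax j : bm1 (fun v => (v \in V)%:R * Num.max (v - vt j) 0).
    have -> : (fun v => (v \in V)%:R * Num.max (v - vt j) 0) = 
       (fun v => (vt j <= v)%R%:R * ((v \in V)%:R * v - (v \in V)%:R * vt j)).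
      apply/funext => v; case: (leP (vt j) v) => vj.
        by rewrite max_l ?subr_ge0// mul1r mulrBr.
      by rewrite max_r ?subr_le0 ?(ltW vj)// mulr0 mul0r.
    apply: bmM; first by apply: bm_ler => //; exact: measurable_cst.
    by apply: bmB; [exact: bm_valuation | apply: bmM; [exact: bm_valuations|exact: bm_cst]].
  have bw i j : bm1 (fun v => ind i v * Num.max (v - vt j) 0).
    have := bmM (bm_ind i) (bmax j); congr bounded_measurable; apply/funext => v.
    by case: (ind_case i v) => [->|[-> Vv _ _]]; rewrite ?mul0r// mem_set// !mul1r.
  have bk i (k : R) : bm1 (fun v => k * ind i v) by apply: bmM => //; exact: bm_cst.
  have wK i j v : (K i j - 2 * delta) * ind i v <= ind i v * Num.max (v - vt j) 0 <= K i j * ind i v.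
    case: (ind_case i v) => [->|[-> Vv iv vi]]; first by rewrite !mulr0 mul0r lexx.
    rewrite !mulr1 mul1r; move: iv vi; rewrite !vtS /K => iv vi; have d0 := delta_gt0.
    by case: (leP (vt i - vt j) 0); case: (leP (v - vt j) 0); lra.
  have rm : \sum_(j < N) \sum_(i < N) rho j i * m i = 1.
    rewrite exchange_big/= -[RHS]sum_m; apply: eq_bigr => i _.
    by rewrite -mulr_suml rho_sum.
  have up : E w <= B.
    apply: ler_sum => j _; apply: ler_sum => i _; rewrite ler_wpM2l// mulrC -EZ//.
    under eq_Rintegral do rewrite wE//.
    by apply: E_le => // v; case/andP: (wK i j v).
  have dn : B - 2 * delta <= E w.
    have <- : \sum_(j < N) \sum_(i < N) 2 * delta * (rho j i * m i) = 2 * delta.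
      by under eq_bigr do rewrite -mulr_sumr; rewrite -mulr_sumr rm mulr1.
    rewrite -sumrB; apply: ler_sum => j _; rewrite -sumrB; apply: ler_sum => i _; rewrite [2 * delta * _]mulrCA -mulrBr ler_wpM2l//.
    under eq_Rintegral do rewrite wE//.
    rewrite [m i * _]mulrC -mulrBl -EZ//.
    by apply: E_le => // v; case/andP: (wK i j v).
  have /andP[t0 t1] := total; have d0 := delta_gt0; move: up dn; rewrite BE.
  set p1 := profit _ _ _ _ in s0 s1 *; set S1 := \sum_(i < N) _ in t0 t1 *.
  have ae1 : ae <= 1 by rewrite -a1 -addrA lerDl addr_ge0.
  move=> up dn; rewrite ler_norml.
  have h1 : ae * (S1 - p1) <= ae * (S - pi0 + 2 * delta) by rewrite ler_wpM2l//; lra.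
  have h2 : ae * (S - pi0 - 2 * delta) <= ae * (S1 - p1) by rewrite ler_wpM2l//; lra.
  have h3 : ae * (2 * delta) <= 1 * (2 * delta) by rewrite ler_wpM2r//; lra.
  by rewrite mulrDr in h1; rewrite mulrBr in h2; apply/andP; split; lra.
Qed.

End Discretization.

(** * An obedient price recommendation *)

Section Limit.
Hypothesis lohi : vlo < vhi.
Local Notation U01 := (uniform_prob (@ltr01 R)).
Local Notation W := (mu \x U01)%E.
Local Notation bm := (@bounded_measurable _ (R * R)%type R).

Let dist_max (a x y : R) : `|Num.max a x - Num.max a y| <= `|x - y|.
Proof.
have := normr_ge0 (x - y); have := ler_norm (x - y); have := ler_norm (- (x - y)).
rewrite normrN => h1 h2 h3.
by rewrite ler_norml; apply/andP; case: (leP a x); case: (leP a y) => h4 h5; split; lra.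
Qed.

Let dist_min (a x y : R) : `|Num.min x a - Num.min y a| <= `|x - y|.
Proof.
have := normr_ge0 (x - y); have := ler_norm (x - y); have := ler_norm (- (x - y)).
rewrite normrN => h1 h2 h3.
by rewrite ler_norml; apply/andP; case: (leP x a); case: (leP y a) => h4 h5; split; lra.
Qed.

Let lip (f : R * R -> R) := exists2 C, 0 <= C &
  forall t t' v, `|f (t, v) - f (t', v)| <= C * `|t - t'|.

Let lip_snd (f : R -> R) : lip (fun x => f x.2).
Proof. by exists 0 => // t t' v; rewrite subrr normr0 mul0r. Qed.

Let lipM f g : lip f -> lip g -> bm f -> bm g -> lip (fun x => f x * g x).
Proof.
move=> [C C0 fC] [D D0 gD] /bm_bound[M M0 fM] /bm_bound[N N0 gN].
exists (C * N + M * D) => [|t t' v]; first by rewrite addr_ge0// mulr_ge0// ltW.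
have -> : f (t, v) * g (t, v) - f (t', v) * g (t', v) =
   (f (t, v) - f (t', v)) * g (t, v) + f (t', v) * (g (t, v) - g (t', v)) by ring.
apply: le_trans (ler_normD _ _) _; rewrite !normrM mulrDl; apply: lerD.
  by rewrite mulrAC ler_pM.
by rewrite -mulrA ler_pM.
Qed.

Let lip_clamp : forall t t', `|clamp t - clamp t'| <= `|t - t'|.
Proof. by move=> t t'; apply: le_trans (dist_max _ _ _) _; exact: dist_min. Qed.

Let bm_clamp : bm1 clamp.
Proof.
apply: (bm_le (M := `|vlo| + `|top|)) => [|t].
  apply: measurable_maxr; first exact: measurable_cst.
  by apply: measurable_minr => //; exact: measurable_cst.
have /andP[c0 c1] := clamp_itv t lohi.
have := ler_norm top; have := ler_norm (- vlo); rewrite normrN => n0 n1.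
have := normr_ge0 vlo; have := normr_ge0 top.
by rewrite ler_norml => ? ?; apply/andP; split; lra.
Qed.

Let bm_clamp1 : bm (fun x => clamp x.1). Proof. exact: bm_fst. Qed.

Let mfst : measurable_fun setT (fst : R * R -> R). Proof. exact: measurable_fst. Qed.
Let msnd : measurable_fun setT (snd : R * R -> R). Proof. exact: measurable_snd. Qed.

(** Rises linearly from 0 at [- (2 * eta)] to 1 at [- eta]: applied to [v - t], a Lipschitz
    substitute for [t <= v] that errs towards trade. *)
Let ramp (eta z : R) := Num.max 0 (Num.min ((z + 2 * eta) / eta) 1).

Let ramp01 eta z : 0 <= ramp eta z <= 1.
Proof. by rewrite /ramp le_max lexx ge_max ler01 ge_min lexx orbT. Qed.

Let ramp1 eta z : 0 < eta -> - eta <= z -> ramp eta z = 1.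
Proof.
by move=> e0 ze; rewrite /ramp min_r ?max_r ?ler01// ler_pdivlMr//; lra.
Qed.

Let ramp0 eta z : 0 < eta -> z <= - (2 * eta) -> ramp eta z = 0.
Proof.
move=> e0 ze; have h : (z + 2 * eta) / eta <= 0 by rewrite ler_pdivrMr// mul0r; lra.
by rewrite /ramp min_l ?max_l// (le_trans h).
Qed.

(* A Lipschitz (in the signal) function squeezed between
   [sale (t - eta) t] and [sale (t - 2 eta) (t + 2 eta)]. *)
Let H eta (x : R * R) := ramp eta (x.2 - clamp x.1) *
  ((x.2 \in V)%:R * (clamp x.1 + 2 * eta) - (x.2 \in V)%:R * c x.2).

Let H_ge eta t v : 0 < eta -> sale (clamp t - eta) (clamp t) v <= H eta (t, v).
Proof.
move=> e0; rewrite /H /sale/=; case: (boolP (v \in V)) => [/[!inE] Vv|_] /=; last first.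
  by rewrite !mul0r subrr mulr0.
have := gain_ge0 Vv; rewrite !mul1r; case: (leP (clamp t - eta) v) => cv g0.
  by rewrite ramp1//; lra.
by rewrite mulr_ge0//; [case/andP: (ramp01 eta (v - clamp t)) | lra].
Qed.

Let H_le eta t v : 0 < eta ->
  H eta (t, v) <= sale (clamp t - 2 * eta) (clamp t + 2 * eta) v.
Proof.
move=> e0; rewrite /H /sale/=; case: (boolP (v \in V)) => [/[!inE] Vv|_] /=; last first.
  by rewrite !mul0r subrr mulr0.
have := gain_ge0 Vv; rewrite !mul1r; case: (leP (clamp t - 2 * eta) v) => cv g0; last first.
  by rewrite ramp0 ?mul0r//; lra.
have /andP[r0 r1] := ramp01 eta (v - clamp t).
have [vt|tv] := leP v (clamp t + 2 * eta); first by rewrite ler_piMl//; lra.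
by rewrite ramp1 ?mul1r//; lra.
Qed.

Let bm_ramp eta : bm (fun x => ramp eta (x.2 - clamp x.1)).
Proof.
apply: (bm_le (M := 1)) => [|x]; last by have /andP[r0 r1] := ramp01 eta (x.2 - clamp x.1); rewrite ger0_norm.
have [mc _] := bm_clamp1.
apply: measurable_maxr; first exact: measurable_cst.
apply: measurable_minr; last exact: measurable_cst.
apply: measurable_funM; last exact: measurable_cst.
apply: measurable_funD; last exact: measurable_cst.
exact: measurable_funB.
Qed.

Let bm_margin eta : bm (fun x => (x.2 \in V)%:R * (clamp x.1 + 2 * eta) - (x.2 \in V)%:R * c x.2).
Proof.
apply: bmB; last exact: (bm_snd bm_cost).
apply: bmM; first exact: (bm_snd bm_valuations).
by apply: bmD => //; exact: bm_cst.
Qed.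

Let bm_H eta : bm (H eta).
Proof. by apply: bmM; [exact: bm_ramp|exact: bm_margin]. Qed.

Let lip_H eta : 0 < eta -> lip (H eta).
Proof.
move=> e0; apply: lipM; [|exists 1 => // t t' v|exact: bm_ramp|exact: bm_margin].
  exists eta^-1 => [|t t' v]; first by rewrite invr_ge0 ltW.
  apply: le_trans (dist_max _ _ _) _; apply: le_trans (dist_min _ _ _) _ => /=.
  rewrite -mulrBl normrM mulrC [`|eta^-1|]ger0_norm ?invr_ge0 ?(ltW e0)//.
  rewrite ler_wpM2l ?invr_ge0 ?(ltW e0)//.
  have -> : v - clamp t + 2 * eta - (v - clamp t' + 2 * eta) = - (clamp t - clamp t') by ring.
  by rewrite normrN.
rewrite mul1r; case: (v \in V) => /=; last by rewrite !mul0r subrr normr0.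
rewrite !mul1r; have -> : clamp t + 2 * eta - c v - (clamp t' + 2 * eta - c v) = clamp t - clamp t' by ring.
exact: lip_clamp.
Qed.

Section LimitLaw.
Variables (ae ai af pi0 : R).
Hypotheses (ae0 : 0 <= ae) (ai0 : 0 <= ai) (af0 : 0 <= af) (a1 : ae + ai + af = 1).
Hypothesis pi_ub : forall p, \int[mu]_v sale p p v <= pi0.
Hypothesis pi_lub : forall y, (forall p, \int[mu]_v sale p p v <= y) -> pi0 <= y.
Let S := \int[mu]_v gain v.
Let s := (ae + ai) * pi0 + af * S.
Let rent (x : R * R) := (x.2 \in V)%:R * Num.max (x.2 - clamp x.1) 0.

Let delta_small e : 0 < e -> \forall n \near \oo, 4 * ((vhi - vlo) / n.+1%:R) <= e.
Proof.
move=> e0; have h : 0 < e / (4 * (vhi - vlo)) by rewrite divr_gt0// mulr_gt0// subr_gt0.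
have hl : 0 < vhi - vlo by rewrite subr_gt0.
have := near_infty_natSinv_lt (PosNum h); apply: filterS => n /= /ltW.
rewrite ler_pdivlMr ?mulr_gt0//; apply: le_trans.
by rewrite mulrA mulrC.
Qed.

Let bm_rent : bm rent.
Proof.
apply: (bm_le (M := `|vlo| + `|vhi|)).
  apply: measurable_funM; first by case: (bm_snd bm_valuations).
  apply: measurable_maxr; last exact: measurable_cst.
  by apply: measurable_funB => //; case: bm_clamp1.
move=> x; rewrite /rent; case: (boolP (x.2 \in V)) => [/[!inE] /V_itv/andP[v0 v1]|_]; last first.
  by rewrite mul0r normr0 addr_ge0.
have /andP[c0 c1] := clamp_itv x.1 lohi.
have := ler_norm vhi; have := ler_norm (- vlo); rewrite normrN mul1r => n0 n1.
rewrite ger0_norm ?le_max ?lexx ?orbT// ge_max addr_ge0// andbT.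
by lra.
Qed.

Let lip_rent : lip rent.
Proof.
exists 1 => // t t' v; rewrite mul1r /rent/=; case: (v \in V); last by rewrite !mul0r subrr normr0.
rewrite !mul1r ![Num.max _ 0]maxC; apply: le_trans (dist_max _ _ _) _.
have -> : v - clamp t - (v - clamp t') = - (clamp t - clamp t') by ring.
by rewrite normrN.
Qed.

(** For fine meshes the relaxed sale lies below [H eta], which yields obedience and the lower bound
    on profit. For the upper bound, [H eta] exceeds by at most [4 * eta] the sale at a price
    [2 * eta] below the recommendation, and obedience excludes a gain from that deviation. *)
Let limit_mean : exists L : (R * R -> R) -> R,
  [/\ is_mean vlo top L,
      forall phi, bm1 phi -> L (fun x => phi x.2) = \int[mu]_v phi v,
      forall h p eta, bm1 h -> (forall t, 0 <= h t) -> 0 < eta ->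
        L (fun x => h x.1 * sale p p x.2) <= L (fun x => h x.1 * H eta x),
      forall eta, 0 < eta -> s <= L (H eta) <= s + 4 * eta &
      L rent = ae * (S - pi0)].
Proof.
have /choice[E HE] := fun n => discretized_market n lohi ae0 ai0 af0 a1 pi_ub pi_lub.
have mE n : is_mean vlo top (E n) by case: (HE n).
have [L mL L_le] := mean_limit mE.
have L_eq f y : bm f -> (forall e, 0 < e -> \forall n \near \oo, `|E n f - y| <= e) -> L f = y.
  move=> bf Hf; apply/eqP; rewrite eq_le; apply/andP; split.
    by apply: L_le => // e /Hf; apply: filterS => n; rewrite ler_norml => /andP[]; lra.
  rewrite -lerN2; have -> : - L f = L (fun x => - 1 * f x) by rewrite (meanZ mL)// mulN1r.
  have bNf : bm (fun x => -1 * f x) by apply: bmM => //; exact: bm_cst.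
  apply: L_le => // e /Hf; apply: filterS => n; rewrite (meanZ (mE n))// mulN1r.
  by rewrite ler_norml => /andP[]; lra.
have bsale (a b : R -> R) : measurable_fun setT a -> bm1 b ->
    bm (fun x => sale (a x.1) (b x.1) x.2).
  move=> ma bb; apply: bm_sale_comp => //; first exact: measurableT_comp.
  exact: bm_fst.
have mclamp : measurable_fun setT clamp by case: bm_clamp.
pose trade n x := sale (clamp x.1 - 2 * ((vhi - vlo) / n.+1%:R)) (clamp x.1) x.2.
have btrade n : bm (trade n).
  apply: (bsale (fun t => clamp t - 2 * ((vhi - vlo) / n.+1%:R)) clamp) => //.
  by apply: measurable_funB => //; exact: measurable_cst.
have delta0 n : 0 <= (vhi - vlo) / n.+1%:R :> R by rewrite divr_ge0// subr_ge0 ltW.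
have trade_le eta n x : 0 < eta -> 4 * ((vhi - vlo) / n.+1%:R) <= eta -> trade n x <= H eta x.
  move=> e0 ne; case: x => t v; apply: le_trans (H_ge t v e0); rewrite /trade/=.
  move: ne (delta0 n); set d := (vhi - vlo) / _ => ne d0.
  by apply: sale_le => //; lra.
exists L; split => //.
- move=> phi bphi; apply: L_eq => [|e e0]; first exact: bm_snd.
  by apply: nearW => n; case: (HE n) => _ -> // *; rewrite subrr normr0 ltW.
- move=> h p eta bh h0 eta0.
  have b1 : bm (fun x => h x.1 * sale p p x.2).
    by apply: bmM; [exact: bm_fst | exact: (bm_snd (bm_sale p p))].
  have b2 : bm (fun x => h x.1 * H eta x) by apply: bmM; [exact: bm_fst | exact: bm_H].
  rewrite -subr_le0 -(meanB mL)//; apply: L_le => [|e e0]; first exact: bmB.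
  have := delta_small eta0; apply: filterS => n ne.
  rewrite (meanB (mE n))// add0r; apply: le_trans (ltW e0); rewrite subr_le0.
  case: (HE n) => _ _ Ho _ _; apply: le_trans (Ho h (fun=> p) h0) _.
  apply: (mean_le (mE n)) => [|//|t v _].
    by apply: bmM; [exact: bm_fst | exact: btrade].
  by rewrite ler_wpM2l//; exact: (trade_le _ n (t, v)).
- move=> eta eta0; apply/andP; split.
    rewrite -lerN2; have -> : - L (H eta) = L (fun x => - 1 * H eta x).
      by rewrite (meanZ mL) ?mulN1r//; exact: bm_H.
    apply: L_le => [|e e0]; first by apply: bmM; [exact: bm_cst|exact: bm_H].
    have := delta_small eta0; apply: filterS => n ne.
    rewrite (meanZ (mE n)); last exact: bm_H.
    case: (HE n) => _ _ _ /andP[sE _] _; rewrite -/s in sE.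
    have : E n (trade n) <= E n (H eta).
      apply: (mean_le (mE n)) => [||t v _]; [exact: btrade|exact: bm_H|exact: trade_le].
    by rewrite /trade; lra.
  apply: L_le => [|e e0]; first exact: bm_H.
  have := delta_small e0; apply: filterS => n ne.
  case: (HE n) => _ _ Ho /andP[_ sE] _; rewrite -/s in sE.
  pose f x := sale (clamp x.1 - 2 * eta) (clamp x.1 - 2 * eta) x.2.
  have bf : bm f.
    have bb : bm1 (fun t => clamp t - 2 * eta) by apply: bmB => //; exact: bm_cst.
    by apply: (bsale (fun t => clamp t - 2 * eta) (fun t => clamp t - 2 * eta)) => //; case: bb.
  have h1 : E n (H eta) <= E n (fun x => f x + 4 * eta).
    apply: (mean_le (mE n)) => [||t v _]; [exact: bm_H|by apply: bmD => //; exact: bm_cst|].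
    apply: le_trans (H_le t v eta0) _.
    have -> : clamp t + 2 * eta = clamp t - 2 * eta + 4 * eta by ring.
    by apply: sale_addr; rewrite mulr_ge0// ltW.
  have h2 : E n f <= E n (trade n).
    have := Ho (fun=> 1) (fun t => clamp t - 2 * eta) (fun=> ler01).
    by congr (E n _ <= E n _); apply/funext => x; rewrite mul1r.
  rewrite (meanD (mE n)) ?(mean_cst (mE n))// in h1; last exact: bm_cst.
  move: h1 h2 ne sE (delta0 n); rewrite /trade; set d := (vhi - vlo) / _.
  by set t := E n _; set t' := E n _; set t'' := E n _; lra.
- apply: L_eq => [|e e0]; first exact: bm_rent.
  have := delta_small e0; apply: filterS => n ne.
  by case: (HE n) => _ _ _ _ h; apply: le_trans h ne.
Qed.

Lemma sale_bound eps : 0 <= eps -> exists2 M, 0 < M & forall a b v,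
  vlo - eps <= b <= top + eps -> `|sale a b v| <= M.
Proof.
move=> e0; have [K K0 cK] := cost_bounded.
exists (`|vlo| + `|top| + eps + K) => [|a b v /andP[b0 b1]].
  by rewrite ltr_wpDl// addr_ge0// addr_ge0.
have := ler_norm top; have := ler_norm (- vlo); rewrite normrN => n0 n1.
have := normr_ge0 vlo; have := normr_ge0 top => n2 n3.
rewrite /sale; case: (boolP (v \in V)) => /= [/[!inE]/cK|_]; last by rewrite normr0; lra.
case: ifP => _; last by rewrite normr0; lra.
by rewrite !ler_norml => /andP[c0 c1]; apply/andP; split; lra.
Qed.

Section Law.
Variable T : R * R -> R.
Hypotheses (mT : measurable_fun setT T) (T_itv : forall z, vlo <= T z <= top).

Let bm_T : bm T.
Proof.
apply: (bm_le (M := `|vlo| + `|top|)) => // z; have /andP[t0 t1] := T_itv z.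
have := ler_norm top; have := ler_norm (- vlo); rewrite normrN => n0 n1.
have := normr_ge0 vlo; have := normr_ge0 top => n2 n3.
by rewrite ler_norml; apply/andP; split; lra.
Qed.

Let bm_TT (e : R) : bm (fun z => sale (T z - e) (T z + e) z.1).
Proof.
apply: bm_sale_comp => //; first by apply: measurable_funB => //; exact: measurable_cst.
by apply: bmD => //; exact: bm_cst.
Qed.

Let bm_T0 : bm (fun z => sale (T z) (T z) z.1). Proof. exact: bm_sale_comp. Qed.

(** Since ties are broken in favour of trade, the event [T z <= v] is the decreasing limit of the
    relaxed events [T z - 2 * eta <= v]; the sales converge pointwise and boundedly. *)
Lemma slack_vanishes g y : bm g -> (forall z, 0 <= g z) ->
  (forall eta, 0 < eta -> y <= \int[W]_z (g z * sale (T z - 2 * eta) (T z + 2 * eta) z.1)) ->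
  y <= \int[W]_z (g z * sale (T z) (T z) z.1).
Proof.
move=> bg g0 Hy.
have [M M0 gM] := bm_bound bg.
have [N N0 sN] := sale_bound (ler0n R 2).
pose e (k : nat) : R := k.+1%:R^-1.
have e0 k : 0 < e k by rewrite invr_gt0.
have e1 k : e k <= 1 by rewrite invf_le1// ler1n.
have cv : \int[W]_z (g z * sale (T z - 2 * e k) (T z + 2 * e k) z.1) @[k --> \oo] -->
    \int[W]_z (g z * sale (T z) (T z) z.1).
  apply: (@E_lim _ _ _ _ _ _ (M * N)).
  - by move=> k; apply: measurable_funM; [case: bg | case: (bm_TT (2 * e k))].
  - by apply: measurable_funM; [case: bg | case: bm_T0].
  - move=> k z; rewrite normrM ler_pM// sN//; have /andP[t0 t1] := T_itv z.
    by have := e0 k; have := e1 k; lra.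
  - move=> z; apply: cvgM; first exact: cvg_cst.
    have e_0 : e k @[k --> \oo] --> 0 by exact: cvg_harmonic.
    rewrite /sale; case: (z.1 \in V) => /=; last exact: cvg_cst.
    case: (leP (T z) z.1) => Tz.
      have -> : T z - c z.1 = T z + 2 * 0 - c z.1 by rewrite mulr0 addr0.
      have cvl : T z + 2 * e k - c z.1 @[k --> \oo] --> T z + 2 * 0 - c z.1.
        apply: cvgB; last exact: cvg_cst.
        by apply: cvgD; [exact: cvg_cst | apply: cvgM => //; exact: cvg_cst].
      apply: cvg_trans cvl; apply: near_eq_cvg; apply: nearW => k.
      by rewrite ifT//; have := e0 k; lra.
    apply: cvg_near_cst.
    have h : 0 < (T z - z.1) / 2 by rewrite divr_gt0// subr_gt0.
    have := near_infty_natSinv_lt (PosNum h); apply: filterS => k /= kh.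
    rewrite ifF//; apply/negbTE; rewrite -ltNge /e.
    by move: kh; rewrite ltr_pdivlMr//; set d := _^-1; lra.
rewrite -(cvg_lim _ cv)//; apply: limr_ge; first by apply/cvg_ex; eexists; exact: cv.
by apply: nearW => k; exact: Hy.
Qed.

End Law.

Lemma limit_law : exists T : R * R -> R,
  [/\ measurable_fun setT T, forall z, vlo <= T z <= top,
      forall A p, measurable A ->
        \int[W]_z (\1_A (T z) * sale p p z.1) <=
        \int[W]_z (\1_A (T z) * sale (T z) (T z) z.1),
      \int[W]_z sale (T z) (T z) z.1 = s &
      \int[W]_z ((z.1 \in V)%:R * Num.max (z.1 - T z) 0) = ae * (S - pi0)].
Proof.
have [L [mL L_marg L_obey L_s L_rent]] := limit_mean.
have lotop : vlo < top by move: lohi; rewrite /top; lra.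
have [T [mT T_itv TE]] := mean_representation lotop mL L_marg.
have clT z : clamp (T z) = T z by rewrite clamp_id.
have LE Psi : bm Psi -> lip Psi -> L Psi = \int[W]_z Psi (T z, z.1).
  by move=> bP [C C0 PC]; apply: (TE Psi C).
have mTp : measurable_fun setT (fun z : R * R => (T z, z.1)).
  exact: measurable_fun_pair.
have bT (Psi : R * R -> R) : bm Psi -> bm (fun z => Psi (T z, z.1)).
  by move=> [mh [M hM]]; split; [exact: (measurableT_comp mh mTp) | exists M].
have bm_TT (e : R) : bm (fun z => sale (T z - e) (T z + e) z.1).
  apply: bm_sale_comp => //; first by apply: measurable_funB => //; exact: measurable_cst.
  have := bT _ (bm_clamp1) => /=; under eq_fun do rewrite clT.
  by move=> bT'; apply: bmD => //; exact: bm_cst.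
have bm_T0 : bm (fun z => sale (T z) (T z) z.1).
  by have := bm_TT 0; congr bounded_measurable; apply/funext => z; rewrite subr0 addr0.
have b2 p : bm (fun x : R * R => sale p p x.1) by exact: bm_fst (bm_sale p p).
exists T; split => //.
- move=> A p mA.
  have bA := bm_indic_comp mT mA.
  rewrite -subr_ge0 -RintegralB//; last 2 first.
  + by apply: bm_integrable; exact: (bmM bA bm_T0).
  + by apply: bm_integrable; exact: (bmM bA (b2 p)).
  under eq_Rintegral do rewrite -mulrBr.
  have bD0 : bm (fun z => sale (T z) (T z) z.1 - sale p p z.1) by exact: bmB.
  refine (@integral_ge0_intervals _ _ _ W T mT _ bD0 _ A mA).
  move=> a b ab.
  (* Lipschitz functions increasing to the indicator of [a' < t]; their differences [h k] are
     nonnegative and tend to the indicator of []a, b]]. *)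
  pose r (a' : R) (k : nat) t := Num.max 0 (Num.min (k%:R * (t - a')) 1).
  have r01 a' k t : 0 <= r a' k t <= 1.
    by rewrite /r le_max lexx ge_max ler01 ge_min lexx orbT.
  have mr a' k : measurable_fun setT (r a' k).
    apply: measurable_maxr; first exact: measurable_cst.
    apply: measurable_minr; last exact: measurable_cst.
    apply: measurable_funM; first exact: measurable_cst.
    by apply: measurable_funB => //; exact: measurable_cst.
  pose h k t := r a k t - r b k t.
  have h0 k t : 0 <= h k t.
    rewrite subr_ge0 /r ge_max !le_max lexx/=; apply/orP; right.
    rewrite le_min !ge_min lexx orbT andbT; apply/orP; left.
    by rewrite ler_wpM2l// lerD2l lerN2 ltW.
  have bh k : bm1 (h k).
    apply: (bm_le (M := 1)) => [|t]; first by apply: measurable_funB; exact: mr.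
    rewrite ger0_norm// /h; have := r01 a k t; have := r01 b k t => /andP[p1 p2] /andP[p3 p4].
    by lra.
  have lipr a' k t t' : `|r a' k t - r a' k t'| <= k%:R * `|t - t'|.
    apply: le_trans (dist_max _ _ _) _; apply: le_trans (dist_min _ _ _) _.
    by rewrite -mulrBr opprB addrA subrK normrM ger0_norm.
  have lh k : lip (fun x => h k x.1).
    exists (k%:R + k%:R) => [|t t' v]; first by rewrite addr_ge0.
    have := lipr a k t t'; have := lipr b k t t'; rewrite /h/= mulrDl => l1 l2.
    have -> : r a k t - r b k t - (r a k t' - r b k t') =
       (r a k t - r a k t') - (r b k t - r b k t') by ring.
    by apply: le_trans (ler_normB _ _) _; exact: lerD.
  have obey k : \int[W]_z (h k (T z) * sale p p z.1) <=
      \int[W]_z (h k (T z) * sale (T z) (T z) z.1).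
    have bhT : bm (fun z => h k (T z)) by exact: (bT _ (bm_fst (bh k))).
    apply: slack_vanishes => // eta eta0.
    have b1 : bm (fun x : R * R => h k x.1 * sale p p x.2).
      by apply: bmM; [exact: bm_fst | exact: (bm_snd (bm_sale p p))].
    have b3 : bm (fun x : R * R => h k x.1 * H eta x) by apply: bmM; [exact: bm_fst | exact: bm_H].
    have e1 := LE _ b1 (lipM (lh k) (lip_snd (sale p p)) (bm_fst (bh k)) (bm_snd (bm_sale p p))).
    have e2 := LE _ b3 (lipM (lh k) (lip_H eta0) (bm_fst (bh k)) (bm_H eta)).
    rewrite -[leLHS]e1; apply: le_trans (L_obey _ p _ (bh k) (h0 k) eta0) _.
    rewrite e2; apply: E_le => [||z]; [exact: (bT _ b3) | exact: (bmM bhT (bm_TT (2 * eta))) |].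
    by rewrite ler_wpM2l//; have := H_le (T z) z.1 eta0; rewrite clT.
  have bh' k : bm (fun z => h k (T z)) by exact: (bT _ (bm_fst (bh k))).
  have bD : bm (fun z => sale (T z) (T z) z.1 - sale p p z.1) by exact: bmB.
  have [M M0 DM] := bm_bound bD.
  have cv : \int[W]_z (h k (T z) * (sale (T z) (T z) z.1 - sale p p z.1)) @[k --> \oo] -->
      \int[W]_z (\1_(`]a, b]%classic) (T z) * (sale (T z) (T z) z.1 - sale p p z.1)).
    apply: (@E_lim _ _ _ _ _ _ M).
    + by move=> k; case: (bmM (bh' k) bD).
    + by case: (bmM (bm_indic_comp mT (measurable_itv `]a, b])) bD).
    + move=> k z; rewrite normrM ger0_norm// -[leRHS]mul1r ler_pM//.
      by rewrite /h; have /andP[] := r01 a k (T z); have /andP[] := r01 b k (T z); lra.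
    + move=> z; apply: cvgM; last exact: cvg_cst.
      have cr a' t : r a' k t @[k --> \oo] --> ((a' < t)%R%:R : R).
        have [at'|ta] := ltP a' t; last first.
          apply: cvg_near_cst; apply: nearW => k.
          rewrite /r max_l// ge_min; apply/orP; left.
          by rewrite mulr_ge0_le0// subr_le0.
        apply: cvg_near_cst.
        have h1 : 0 < t - a' by rewrite subr_gt0.
        have := nbhs_infty_ger (t - a')^-1; apply: filterS => k kt.
        rewrite /r min_r ?max_r ?ler01//.
        by rewrite -ler_pdivrMr// div1r.
      have -> : \1_(`]a, b]%classic) (T z) = (a < T z)%R%:R - (b < T z)%R%:R :> R.
        rewrite indicE.
        have -> : (T z \in `]a, b]%classic) = (a < T z) && (T z <= b).
          by apply/idP/idP => /[!inE]/=; rewrite in_itv.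
        case: (ltP a (T z)) => aT; case: (leP (T z) b) => Tb; rewrite ?subrr ?subr0//.
        by move: (lt_le_trans Tb aT); rewrite ltNge (ltW ab).
      exact: cvgB.
  rewrite -(cvg_lim _ cv)//; apply: limr_ge; first by apply/cvg_ex; eexists; exact: cv.
  apply: nearW => k; under eq_Rintegral do rewrite mulrBr.
  rewrite RintegralB// ?subr_ge0 ?obey//.
  + by apply: bm_integrable; exact: (bmM (bh' k) bm_T0).
  + by apply: bm_integrable; exact: (bmM (bh' k) (b2 p)).
- have sE eta : 0 < eta -> s <= \int[W]_z H eta (T z, z.1) <= s + 4 * eta.
    by move=> eta0; rewrite -LE; [exact: L_s | exact: bm_H | exact: lip_H].
  apply/eqP; rewrite eq_le; apply/andP; split.
    apply/ler_addgt0Pr => e e0; have e4 : 0 < e / 4 by rewrite divr_gt0.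
    have /andP[_] := sE _ e4; rewrite [4 * _]mulrC divfK//; apply: le_trans.
    apply: E_le => [||z]; [exact: bm_T0|exact: (bT _ (bm_H _))|].
    apply: le_trans (H_ge (T z) z.1 e4); rewrite clT.
    by apply: sale_le => //; lra.
  have -> : \int[W]_z sale (T z) (T z) z.1 = \int[W]_z (1 * sale (T z) (T z) z.1).
    by apply: eq_Rintegral => z _; rewrite mul1r.
  apply: slack_vanishes => [||||eta eta0]; [exact: mT|exact: T_itv|exact: bm_cst|by []|].
  have /andP[sH _] := sE _ eta0; apply: le_trans sH _.
  under [leRHS]eq_Rintegral do rewrite mul1r.
  apply: E_le => [||z]; [exact: (bT _ (bm_H _))|exact: bm_TT|].
  by have := H_le (T z) z.1 eta0; rewrite clT.
- rewrite -L_rent LE; [|exact: bm_rent|exact: lip_rent].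
  by apply: eq_Rintegral => z _; rewrite /rent/= clT.
Qed.

End LimitLaw.
End Limit.

(** * Sufficiency: the induced equilibrium *)

Section Equilibrium.
Local Notation U01 := (uniform_prob (@ltr01 R)).
Local Notation W := (mu \x U01)%E.
Local Notation bm := (@bounded_measurable _ (R * R)%type R).
Local Notation Om := ((borelT (R : completePseudoMetricType R) * R) * R)%type.

(** Signals carry the sigma-algebra generated by the open sets, and prices the native one of the
    reals; the identity must be measurable in both directions. *)
Lemma measurable_to_borelT : measurable_fun setT (fun x : R => x : borelT R).
Proof.
apply: (@measurability _ _ R (borelT R) setT _ (@open R)) => // _ [U oU <-]; rewrite setTI.
exact: open_measurable.
Qed.

Lemma measurable_of_borelT : measurable_fun setT (fun x : borelT R => x : R).
Proof.
apply: (measurability (@RGenOpens.G R)); first exact: RGenOpens.measurableE.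
move=> _ [_ [x [y ->]] <-]; rewrite setTI.
by apply: sub_sigma_algebra; exact: interval_open.
Qed.

Lemma separable_real : separable_space (R : completePseudoMetricType R).
Proof.
exists (range (@ratr R)); split.
  by apply: (sub_countable (card_image_le _ _)); exact: countableP.
rewrite -subTset => x _ U /nbhs_ballP[e /= e0 xU].
have [q /[!in_itv]/= /andP[xq qe]] : exists q, ratr q \in `]x, x + e[.
  by apply: rat_in_itvoo; rewrite ltrDl.
exists (ratr q); split; first by exists q.
by apply: xU; rewrite /ball/= ltr_distl; apply/andP; split; lra.
Qed.

Variable T : R * R -> R.
Hypotheses (mT : measurable_fun setT T) (T_itv : forall z, vlo <= T z <= top).
Hypothesis T_obey : forall A p, measurable A ->
  \int[W]_z (\1_A (T z) * sale p p z.1) <= \int[W]_z (\1_A (T z) * sale (T z) (T z) z.1).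

Let outcome (z : R * R) : Om := ((T z, z.1), z.1).

Let m_outcome : measurable_fun setT outcome.
Proof.
apply: measurable_fun_pair => //; apply: measurable_fun_pair => //.
exact: (measurableT_comp measurable_to_borelT).
Qed.

Let P : probability Om R := 
  distribution W (@mfun_Sub _ _ (R * measurableTypeR R)%type Om outcome (mem_set m_outcome)).

Let m_ts : measurable_fun setT (fun w : Om => w.1.1 : R).
Proof. by apply: (measurableT_comp measurable_of_borelT); exact: measurableT_comp. Qed.

Let m_tb : measurable_fun setT (fun w : Om => w.1.2).
Proof. exact: measurableT_comp. Qed.

Let PE (F : Om -> R) : measurable_fun setT F -> bm (F \o outcome) ->
  (\int[P]_w (F w)%:E = (\int[W]_z F (outcome z))%:E)%E.
Proof.
move=> mF bF; have bF' : @bounded_measurable _ (R * measurableTypeR R)%type R (F \o outcome) by [].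
rewrite -(bm_integralE W bF'); apply: integral_pushforward => //; first exact/measurable_EFinP.
exact: (bm_integrable W bF').
Qed.

Let informed : {ae P, forall w, w.1.2 = w.2 /\ V w.2}.
Proof.
exists [set w | ~ (w.1.2 = w.2 /\ V w.2)]; split => //.
  have -> : [set w : Om | ~ (w.1.2 = w.2 /\ V w.2)] =
      ~` ((fun w => w.1.2 - w.2) @^-1` [set 0] `&` (snd @^-1` V)).
    apply/seteqP; split => w /=; apply: contra_not => -[].
      by move=> /eqP; rewrite subr_eq0 => /eqP.
    by move=> -> ?; rewrite subrr.
  apply: measurableC; apply: measurableI.
    by rewrite -[X in measurable X]setTI; apply: measurable_funB.
  by rewrite -[X in measurable X]setTI; apply: measurable_snd => //; exact: measurable_valuations.
transitivity (W ((~` V) `*` setT)).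
  rewrite /P/= /distribution /pushforward/=; congr (W _); apply/seteqP; split => z /=.
    by move=> h; split => //; apply: contra_not h.
  by move=> [nV _] [_].
rewrite product_measure1E//; last by apply: measurableC; exact: measurable_valuations.
by rewrite [X in (X * _)%E]support_full mul0e.
Qed.

(** Beliefs must be carried by [V] after every buyer signal, also those outside [V]; there the buyer
    believes in [vlo]. *)
Let r (v : R) : R := if v \in V then v else vlo.

Let Vr v : V (r v).
Proof. by rewrite /r; case: ifP => // /[!inE]. Qed.

Let rE v : V v -> r v = v.
Proof. by move=> Vv; rewrite /r mem_set. Qed.

Let mr : measurable_fun setT r.
Proof.
have [m1 _] := bm_valuations.
have -> : r = fun v => (v \in V)%:R * v + (1 - (v \in V)%:R) * vlo.
  apply/funext => v; rewrite /r; case: (v \in V); first by rewrite mul1r subrr mul0r addr0.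
  by rewrite mul0r subr0 mul1r add0r.
apply: measurable_funD; apply: measurable_funM => //.
by apply: measurable_funB.
Qed.

Let alpha (x : R * R) : R := (x.1 <= r x.2)%R%:R.
Let m_r2 : measurable_fun setT (fun x : R * R => r x.2).
Proof. exact: measurableT_comp. Qed.
Let nu : R.-pker (R * R)%type ~> R := kdirac m_r2.
Let sigma : R.-pker borelT R ~> R := kdirac measurable_of_borelT.

Let sigmaE (f : Om -> R -> \bar R) : (forall w, measurable_fun setT (f w)) ->
  jointE P sigma f = (\int[P]_w f w w.1.1)%E.
Proof.
move=> mf; rewrite /jointE; apply: eq_integral => w _.
by rewrite integral_dirac// diracT mul1e.
Qed.

Let m_alpha tb : measurable_fun setT (fun p => alpha (p, tb)).
Proof. by case: (@bm_ler _ R R id (fun=> r tb)). Qed.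

Let bm_sale_T : bm (fun z => sale (T z) (T z) z.1).
Proof.
apply: bm_sale_comp => //; apply: (bm_le (M := `|vlo| + `|top|)) => // z.
have /andP[t0 t1] := T_itv z.
have := ler_norm top; have := ler_norm (- vlo); rewrite normrN => n0 n1.
have := normr_ge0 vlo; have := normr_ge0 top => n2 n3.
by rewrite ler_norml; apply/andP; split; lra.
Qed.

Let seller_value : seller_payoff c P sigma alpha = (\int[W]_z sale (T z) (T z) z.1)%:E.
Proof.
rewrite /seller_payoff sigmaE => [|w]; last first.
  apply/measurable_EFinP; apply: measurable_funM; first exact: m_alpha.
  by apply: measurable_funB.
transitivity (\int[P]_w (sale w.1.1 w.1.1 w.2)%:E)%E.
  apply: eq_integral_ae_arbitrary; apply: filterS informed => w [tv Vv].
  congr EFin; rewrite /alpha /sale tv/= rE// mem_set//=.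
  by case: ifP; rewrite ?mul1r ?mul0r.
by rewrite (PE (F := fun w => sale w.1.1 w.1.1 w.2))//; exact: measurable_sale.
Qed.

Let buyer_value : buyer_payoff P sigma alpha =
  (\int[W]_z ((z.1 \in V)%:R * Num.max (z.1 - T z) 0))%:E.
Proof.
have mF : measurable_fun setT (fun w : Om => (w.2 \in V)%:R * Num.max (w.2 - w.1.1) 0 : R).
  apply: measurable_funM; last by apply: measurable_maxr => //; exact: measurable_funB.
  by have [mV _] := bm_valuations; exact: (measurableT_comp mV (@measurable_snd _ _ _ _)).
rewrite /buyer_payoff sigmaE => [|w]; last first.
  apply/measurable_EFinP; apply: measurable_funM; first exact: m_alpha.
  by apply: measurable_funB.
transitivity (\int[P]_w ((w.2 \in V)%:R * Num.max (w.2 - w.1.1) 0)%:E)%E.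
  apply: eq_integral_ae_arbitrary; apply: filterS informed => w [tv Vv].
  congr EFin; rewrite /alpha tv/= rE// mem_set// mul1r.
  case: leP => h; first by rewrite mul1r max_l// subr_ge0.
  by rewrite mul0r max_r// subr_le0 ltW.
rewrite (PE mF)//; apply: (bm_le (M := `|vlo| + `|vhi|)).
  by apply: (measurableT_comp mF).
move=> z /=; case: (boolP (z.1 \in V)) => [/[!inE] /V_itv/andP[v0 v1]|_]; last first.
  by rewrite mul0r normr0 addr_ge0.
have /andP[c0 c1] := T_itv z.
have := ler_norm vhi; have := ler_norm (- vlo); rewrite normrN mul1r => n0 n1.
rewrite ger0_norm ?le_max ?lexx ?orbT// ge_max addr_ge0// andbT.
by lra.
Qed.

Let T_obey_weight (h : R -> R) p : bm1 h -> (forall t, 0 <= h t) ->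
  \int[W]_z (h (T z) * sale p p z.1) <= \int[W]_z (h (T z) * sale (T z) (T z) z.1).
Proof.
move=> bh h0.
have bD : bm (fun z => sale (T z) (T z) z.1 - sale p p z.1).
  by apply: bmB => //; exact: (bm_fst (bm_sale p p)).
have bc f : bm1 f -> bm (fun z => f (T z)).
  by move=> [mf [M fM]]; split; [exact: measurableT_comp | exists M].
have bDf f : bm1 f -> bm (fun z => f (T z) * (sale (T z) (T z) z.1 - sale p p z.1)).
  by move=> bf; apply: bmM => //; exact: bc.
have KE f : bm1 f -> \int[W]_z (f (T z) * (sale (T z) (T z) z.1 - sale p p z.1)) =
    \int[W]_z (f (T z) * sale (T z) (T z) z.1) - \int[W]_z (f (T z) * sale p p z.1).
  move=> bf; rewrite -RintegralB//.
  - by apply: eq_Rintegral => z _; rewrite mulrBr.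
  - by apply: bm_integrable; exact: (bmM (bc _ bf) bm_sale_T).
  - by apply: bm_integrable; exact: (bmM (bc _ bf) (bm_fst (bm_sale p p))).
have [M M0 DM] := bm_bound bD.
rewrite -subr_ge0 -KE//.
pose K f := \int[W]_z (f (T z) * (sale (T z) (T z) z.1 - sale p p z.1)).
apply: (functional_ge0 (K := K) (C := M)) => //.
- move=> f g bf bg; rewrite /K -(ED W (bDf _ bf) (bDf _ bg)).
  by apply: eq_Rintegral => z _; rewrite mulrDl.
- move=> k f bf; rewrite /K -(EZ W k (bDf _ bf)).
  by apply: eq_Rintegral => z _; rewrite mulrA.
- move=> f N bf fN.
  have bnd z : `|f (T z) * (sale (T z) (T z) z.1 - sale p p z.1)| <= M * N.
    by rewrite normrM mulrC ler_pM.
  rewrite ler_norml; apply/andP; split; [rewrite -[leLHS](E_cst W)|rewrite -[leRHS](E_cst W)].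
    apply: (E_le W (bm_cst _ _) (bDf _ bf)) => z.
    by have := bnd z; rewrite ler_norml => /andP[].
  apply: (E_le W (bDf _ bf) (bm_cst _ _)) => z.
  by have := bnd z; rewrite ler_norml => /andP[].
- move=> A mA; rewrite /K KE; last exact: bm_indic.
  by rewrite subr_ge0; exact: T_obey.
Qed.

(** * Randomized deviations on a price grid *)

Section PriceGrid.
Variables (eta : R) (eta0 : 0 < eta).
Let N := (Num.truncn ((vhi - vlo) / eta)).+1.
(** Prices below [vlo] fall into cell 0, as [truncn] is 0 on negative numbers; prices from [grid N]
    on fall into cell [N], where nobody buys because [vhi < grid N]. *)
Let cellno (p : R) : nat := minn N (Num.truncn ((p - vlo) / eta)).
Let cell (k : nat) : set R := [set p | cellno p = k].
Let grid (k : nat) : R := vlo + k%:R * eta.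

Let cellno_lt p : (cellno p < N.+1)%N.
Proof. by rewrite ltnS geq_minl. Qed.

Let measurable_cell k : measurable (cell k).
Proof.
have m_gt j : measurable [set p | (j < cellno p)%N].
  have [jN|Nj] := ltnP j N; last first.
    rewrite (_ : [set p | _] = set0)//; apply/seteqP; split => // p /=.
    by move=> /leq_trans/(_ (geq_minl _ _)); rewrite ltnNge Nj.
  rewrite (_ : [set p | _] = `[vlo + j.+1%:R * eta, +oo[%classic); first exact: measurable_itv.
  apply/seteqP; split => p /=; rewrite in_itv/= andbT leq_min jN truncn_gt_nat ler_pdivlMr//;
    by rewrite lerBrDl.
rewrite (_ : cell k = (if k is j.+1 then [set p | (j < cellno p)%N] else setT)
    `\` [set p | (k < cellno p)%N]).
  by apply: measurableD => //; case: k => [|j] //; exact: m_gt.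
apply/seteqP; split => p; rewrite /cell/=.
  by move=> pk; split; [case: k pk => // j /= -> | rewrite pk ltnn].
move=> [pk /negP]; rewrite -leqNgt => kp; apply/eqP; rewrite eqn_leq kp/=.
by case: k pk {kp}.
Qed.

Let grid_sale p v : sale p p v <= sale (grid (cellno p)) (grid (cellno p)) v + eta.
Proof.
have [/[!inE] Vv|nV] := boolP (v \in V); last by rewrite /sale (negbTE nV)/= add0r ltW.
have /andP[lv vh] := V_itv Vv; have g0 := gain_ge0 Vv.
have hN : vhi < grid N.
  by rewrite /grid -ltrBlDl -ltr_pdivrMr//; exact: truncnS_gt.
rewrite /cellno; case: leqP => [Np|pN].
  have pN : grid N <= p.
    move: Np; rewrite /N truncn_gt_nat -/N ler_pdivlMr// lerBrDl.
    exact.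
  have vN := le_lt_trans vh hN.
  by rewrite /sale (lt_geF vN) (lt_geF (lt_le_trans vN pN)) !andbF add0r ltW.
set k := Num.truncn _; have pk : p < grid k + eta.
  have := truncnS_gt ((p - vlo) / eta); rewrite -/k ltr_pdivrMr// -natr1 mulrDl mul1r /grid.
  by lra.
have [k0|k0] := posnP k.
  rewrite k0 /grid mul0r addr0; move: pk; rewrite k0 /grid mul0r addr0 => pk.
  by rewrite /sale mem_set//= lv; case: (leP p v) => ?; lra.
have kp : grid k <= p.
  have := leqnn k; rewrite -{1}(prednK k0) {2}/k truncn_gt_nat prednK// ler_pdivlMr// lerBrDl.
  exact.
apply: le_trans (sale_addr _ _ _ (ltW eta0)).
by apply: sale_le => //; exact: ltW.
Qed.

Let cell_sum (x : nat -> R) p : \sum_(k < N.+1) \1_(cell k) p * x k = x (cellno p).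
Proof.
rewrite (bigD1 (Ordinal (cellno_lt p)))//= big1 ?addr0.
  by rewrite indicE mem_set// mul1r.
move=> k kp; rewrite indicE memNset ?mul0r// /cell/= => pk.
by move/eqP: kp; apply; apply: val_inj.
Qed.

Variable sigma' : R.-pker borelT R ~> R.
Let weight k (t : borelT R) : R := fine (sigma' t (cell k)).

Let bm_weight k : bm1 (fun t => weight k t).
Proof.
apply: (bm_le (M := 1)) => [|t].
  apply: (measurableT_comp (fine_measurable _)) => //.
  exact: (measurableT_comp (measurable_kernel sigma' _ (measurable_cell k)) measurable_to_borelT).
have [Q QE] := measure_probability (prob_kernel (s := sigma') t).
rewrite /weight -QE ger0_norm ?fine_ge0// -lee_fin fineK ?fin_num_measure//.
exact: probability_le1.
Qed.

Let weight_ge0 k t : 0 <= weight k t.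
Proof. by rewrite fine_ge0. Qed.

Let mixed_integral (x : nat -> R) t :
  (\int[sigma' t]_p (x (cellno p))%:E)%E = (\sum_(k < N.+1) weight k t * x k)%:E.
Proof.
have [Q QE] := measure_probability (prob_kernel (s := sigma') t).
have b1 (k : 'I_N.+1) : bm1 (fun p => \1_(cell k) p * x k).
  by apply: bmM; [exact: bm_indic | exact: bm_cst].
rewrite -QE; transitivity (\int[Q]_p (\sum_(k < N.+1) \1_(cell k) p * x k)%:E)%E.
  by apply: eq_integral => p _; rewrite cell_sum.
rewrite bm_integralE; last exact: bm_sum.
congr EFin; rewrite E_sum//; apply: eq_bigr => k _.
have -> : weight k t = \int[Q]_p \1_(cell k) p by rewrite E_indic// QE.
rewrite mulrC -(EZ Q (x k) (bm_indic _ (measurable_cell k))).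
  by apply: eq_Rintegral => p _; rewrite mulrC.
Qed.

(** Rounded to the grid, at a cost of [eta], a randomized deviation is a finite mixture of constant
    prices whose weights depend measurably on the signal; [T_obey_weight] bounds each term. The
    rounding also tames the unbounded range of prices. *)
Lemma deviation_le :
  (seller_payoff c P sigma' alpha <= (\int[W]_z sale (T z) (T z) z.1 + eta)%:E)%E.
Proof.
pose G (w : Om) := \sum_(k < N.+1) weight k w.1.1 * (sale (grid k) (grid k) w.2 + eta).
have bT f : bm1 f -> bm (fun z => f (T z)).
  by move=> [mf [M fM]]; split; [exact: measurableT_comp | exists M].
have bs k : bm1 (fun v => sale (grid k) (grid k) v + eta).
  by apply: bmD; [exact: bm_sale | exact: bm_cst].
have mG : measurable_fun setT G.
  apply: measurable_sum => k; apply: measurable_funM.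
    by have [mw _] := bm_weight k; exact: (measurableT_comp mw m_ts).
  by have [ms _] := bs k; exact: (measurableT_comp ms).
have bW (k : 'I_N.+1) : bm (fun z => weight k (T z) * (sale (grid k) (grid k) z.1 + eta)).
  by apply: bmM; [exact: (bT _ (bm_weight k)) | exact: (bm_fst (bs k))].
have bW' (k : 'I_N.+1) : bm (fun z => weight k (T z) * (sale (T z) (T z) z.1 + eta)).
  by apply: bmM; [exact: (bT _ (bm_weight k)) | apply: bmD => //; exact: bm_cst].
have bG : bm (G \o outcome) by exact: (bm_sum _ bW).
apply: (@le_trans _ _ (\int[P]_w (G w)%:E)%E).
  apply: le_integral_ae_arbitrary; apply: filterS informed => w [tv Vv].
  rewrite /G -(mixed_integral (fun k => sale (grid k) (grid k) w.2 + eta)); apply: le_integral_arbitrary => p _.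
  rewrite lee_fin; apply: le_trans (grid_sale p w.2).
  rewrite /alpha /sale tv/= rE// mem_set//=.
  by case: ifP; rewrite ?mul1r ?mul0r.
rewrite (PE mG bG) lee_fin (E_sum W _ bW).
have -> : \int[W]_z sale (T z) (T z) z.1 + eta =
    \sum_(k < N.+1) \int[W]_z (weight k (T z) * (sale (T z) (T z) z.1 + eta)).
  rewrite -(E_sum W _ bW') -[X in _ + X = _](E_cst W) -(ED W bm_sale_T (bm_cst _ _)).
  apply: eq_Rintegral => z _; rewrite -mulr_suml.
  suff -> : \sum_(k < N.+1) weight k (T z) = 1 by rewrite mul1r.
  apply: EFin_inj; have := mixed_integral (fun=> 1) (T z).
  under [X in _ = X%:E -> _]eq_bigr do rewrite mulr1.
  by move=> <-; rewrite integral_cst// mul1e prob_kernel.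
apply: ler_sum => k _.
have bwT := bT _ (bm_weight k).
have split_eta (F : R * R -> R) : bm F ->
    \int[W]_z (weight k (T z) * (F z + eta)) =
    \int[W]_z (weight k (T z) * F z) + \int[W]_z (weight k (T z) * eta).
  move=> bF; rewrite -(ED W (bmM bwT bF) (bmM bwT (bm_cst _ eta))).
  by apply: eq_Rintegral => z _; rewrite mulrDr.
rewrite (split_eta (fun z => sale (grid k) (grid k) z.1)); last exact: (bm_fst (bm_sale _ _)).
rewrite (split_eta (fun z => sale (T z) (T z) z.1))// lerD2r.
exact: T_obey_weight.
Qed.

End PriceGrid.

Lemma equilibrium_payoffs : Pi_fb V c mu
  (\int[W]_z ((z.1 \in V)%:R * Num.max (z.1 - T z) 0)) (\int[W]_z sale (T z) (T z) z.1).
Proof.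
exists (R : completePseudoMetricType R); split; first exact: Rhausdorff.
split; first exact: separable_real.
exists P; split; first last.
  split.
    rewrite /fully_informed /P/= /distribution/= /pushforward/=.
    rewrite -[RHS](probability_setT W); congr (W _).
    by apply/seteqP; split.
  exists sigma, alpha, nu; split; last first.
    split; last by split; [exact: buyer_value | exact: seller_value].
    move=> p D mD.
    transitivity (\int[P]_w (\1_D (w.1.2, w.2))%:E)%E.
      apply: eq_integral_ae_arbitrary; apply: filterS informed => w [tv Vv].
      by rewrite /nu/= /kdirac/= diracE tv rE// indicE; congr ((_ : bool)%:R)%:E; apply/idP/idP => /[!inE].
    have mE : measurable [set w : Om | D (w.1.2, w.2)].
      rewrite -[X in measurable X]setTI.
      by apply: (measurable_fun_pair m_tb measurable_snd).
    transitivity (\int[P]_w (\1_[set w : Om | D (w.1.2, w.2)] w)%:E)%E => //.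
    by rewrite integral_indic// setIT.
  split; split.
  - by case: (@bm_ler _ (R * R)%type R fst (fun x => r x.2)).
  - by move=> x; rewrite /alpha; case: (x.1 <= _) => /=; rewrite lexx ler01.
  - by move=> p tb; rewrite /nu/= /kdirac/= diracE mem_set.
  - move=> p tb; rewrite /belief_mean integral_dirac// diracT mul1e lte_fin => /ltW pr.
    by rewrite /alpha/= pr.
  - move=> p tb; rewrite /belief_mean integral_dirac// diracT mul1e lte_fin => rp.
    by rewrite /alpha/= lt_geF.
  - move=> sigma'; rewrite seller_value; apply/lee_addgt0Pr => e e0.
    by rewrite -EFinD; exact: deviation_le.
  - move=> A B mA mB; apply: eq_integral_ae_arbitrary; apply: filterS informed => w [tv Vv].
    apply: eq_integral => p _; rewrite EFinM; congr (_ * _)%E.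
    by rewrite /nu/= /kdirac/= diracE tv rE// indicE.
move=> B mB; rewrite /P/= /distribution/= /pushforward/=.
transitivity (W (B `*` setT)); first by congr (W _); apply/seteqP; split => z //= [].
by rewrite product_measure1E// [X in (_ * X)%E]probability_setT mule1.
Qed.

End Equilibrium.

(** * Necessity *)

Section Necessity.
Variable Ts : completePseudoMetricType R.
Local Notation Om := ((borelT Ts * R) * R)%type.
Variable P : probability Om R.
Hypotheses (P_marginal : V_marginal P mu) (P_informed : fully_informed P).
Variables (sigma : R.-pker borelT Ts ~> R) (alpha : R * R -> R) (nu : R.-pker (R * R)%type ~> R).
Hypothesis equil : wPBE c P V sigma alpha nu.
Hypothesis nu_indep : price_independent P nu.

Let m_tb : measurable_fun setT (fun w : Om => w.1.2).
Proof. exact: measurableT_comp. Qed.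

Let mV := measurable_valuations.

Let informed : {ae P, forall w, w.1.2 = w.2 /\ V w.2}.
Proof.
have mD : measurable [set w : Om | w.1.2 = w.2].
  rewrite (_ : [set w | _] = (fun w : Om => w.1.2 - w.2) @^-1` [set 0]).
    by rewrite -[X in measurable X]setTI; apply: measurable_funB.
  apply/seteqP; split => w /=; first by move=> ->; rewrite subrr.
  by move=> /eqP; rewrite subr_eq0 => /eqP.
have mB : measurable [set w : Om | V w.2].
  by rewrite -[X in measurable X]setTI; exact: measurable_snd.
have D0 : {ae P, forall w, w.1.2 = w.2}.
  exists (~` [set w : Om | w.1.2 = w.2]); split => //; first exact: measurableC.
  by rewrite probability_setC// P_informed subee.
have V0 : {ae P, forall w : Om, V w.2}.
  exists (~` [set w : Om | V w.2]); split => //; first exact: measurableC.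
  by rewrite (P_marginal (measurableC mV)) support_full.
by apply: filterS2 D0 V0.
Qed.

Let PE (f : R -> R) : bm1 f -> \int[P]_w f w.2 = \int[mu]_v f v.
Proof.
move=> bf; have bf2 : bounded_measurable (fun w : Om => f w.2).
  by have [mf [M fM]] := bf; split; [exact: measurableT_comp | exists M].
apply: EFin_inj; rewrite -!bm_integralE//.
have mpush : measurable_fun setT (snd : Om -> R) by [].
transitivity (\int[pushforward P (snd : Om -> R)]_v (f v)%:E)%E.
  rewrite integral_pushforward//; first by apply/measurable_EFinP; case: bf.
  exact: (bm_integrable P bf2).
apply: eq_measure_integral => A mA _; exact: P_marginal.
Qed.

(* Price-independence extends Bayes' rule to off-path prices: at any price the
   buyer almost surely knows her value. *)
Let ae_accept p q : p < q -> {ae P, forall w, q < w.2 -> alpha (p, w.1.2) = 1}.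
Proof.
move=> pq; have [[_ _ nuV accept] _] := equil.
(* Belief in values at most [q] held after a signal above [q]. Price independence equates its
   expectation with the probability of such a mismatch, which is 0. *)
pose g (w : Om) := nu (p, w.1.2) [set v | q < w.1.2 /\ v <= q].
have g0 : {ae P, forall w, g w = 0%E}.
  apply: ge0_integral_eq0_ae => //.
    rewrite (_ : g = fun w => ((q < w.1.2)%R%:R : R)%:E * nu (p, w.1.2) `]-oo, q]%classic)%E.
      apply: emeasurable_funM.
        by apply/measurable_EFinP; case: (@bm_ltr _ Om R (fun=> q) (fun w => w.1.2)).
      by apply: (measurableT_comp (measurable_kernel nu _ (measurable_itv _))); exact: measurable_fun_pair.
    apply/funext => w; rewrite /g; case: ltP => /= h.
      rewrite mul1e; congr (nu _ _); apply/seteqP; split => v /=; rewrite in_itv/=.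
        by case.
      by [].
    rewrite mul0e (_ : [set v | _] = set0) ?measure0//.
    by apply/seteqP; split => v //= [].
  have mD : measurable [set x : R * R | q < x.1 /\ x.2 <= q].
    rewrite (_ : [set x | _] = `]q, +oo[%classic `*` `]-oo, q]%classic).
      by apply: measurableX; exact: measurable_itv.
    by apply/seteqP; split => x /=; rewrite !in_itv/= andbT.
  have m_pair : measurable_fun setT (fun w : Om => (w.1.2, w.2)) by exact: measurable_fun_pair.
  rewrite [LHS](nu_indep p mD)/=; apply: measure_negligible.
    by have := m_pair measurableT _ mD; rewrite setTI.
  apply: negligibleS informed => w /= [qw wq] [tv _].
  by move: wq; rewrite -tv leNgt qw.
apply: filterS2 informed g0 => w [tv Vv] gw qv; apply: accept.
have [Q QE] := measure_probability (prob_kernel (s := nu) (p, w.1.2)).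
apply: (@lt_le_trans _ _ q%:E); first by rewrite lte_fin.
have <- : (\int[Q]_v q%:E = q%:E)%E by rewrite integral_cst// [X in (_ * X)%E]probability_setT mule1.
rewrite /belief_mean -QE.
apply: le_integral_ae_arbitrary.
have Q0 : (Q : set R -> \bar R) `]-oo, q]%classic = 0%E.
  rewrite QE -gw /g tv; congr (nu _ _); apply/seteqP; split => v /=; rewrite in_itv/=.
    by [].
  by case.
exists `]-oo, q]%classic; split => //.
by move=> v /=; rewrite in_itv/= lee_fin => /negP; rewrite -ltNge => /ltW.
Qed.

Variables (pib pis : R).
Hypotheses (buyerE : buyer_payoff P sigma alpha = pib%:E)
  (sellerE : seller_payoff c P sigma alpha = pis%:E).

Let m_alpha2 : measurable_fun setT alpha. Proof. by case: equil => -[]. Qed.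
Let alpha01 x : 0 <= alpha x <= 1. Proof. by case: equil => -[]. Qed.

Let bm_alpha p : bounded_measurable (fun w : Om => alpha (p, w.1.2)).
Proof.
apply: (bm_le (M := 1)) => [|w]; last by have /andP[a0 a1] := alpha01 (p, w.1.2); rewrite ger0_norm.
by apply: (measurableT_comp m_alpha2); exact: measurable_fun_pair.
Qed.

Let margin p v := (v \in V)%:R * p - (v \in V)%:R * c v.

Let bm_margin p : bm1 (margin p).
Proof.
apply: bmB; last exact: bm_cost.
by apply: bmM; [exact: bm_valuations | exact: bm_cst].
Qed.

Let bm_2 (f : R -> R) : bm1 f -> bounded_measurable (fun w : Om => f w.2).
Proof. by move=> [mf [M fM]]; split; [exact: measurableT_comp | exists M]. Qed.

Let posted_price p : \int[P]_w (alpha (p, w.1.2) * margin p w.2) <= pis.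
Proof.
have [_ [_ opt _]] := equil.
have m_cst : measurable_fun setT (fun _ : borelT Ts => p) by exact: measurable_cst.
have := opt (kdirac m_cst : R.-pker borelT Ts ~> R).
rewrite sellerE -lee_fin; apply: le_trans.
rewrite -bm_integralE; last by apply: bmM; [exact: bm_alpha | exact: (bm_2 (bm_margin p))].
rewrite /seller_payoff /jointE le_eqVlt; apply/orP; left; apply/eqP.
apply: eq_integral_ae_arbitrary; apply: filterS informed => w [tv Vv].
rewrite integral_dirac// ?diracT ?mul1e; last first.
  apply/measurable_EFinP; apply: measurable_funM; last exact: measurable_funB.
  by apply: (measurableT_comp m_alpha2); exact: measurable_fun_pair.
by rewrite /margin mem_set// !mul1r.
Qed.

(** At the price [p - e] the types [v >= p] accept, by [ae_accept] with threshold [p - e / 2]. A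
    type below [p] that also accepts costs the seller at most [e], since [c v <= v < p]. *)
Lemma seller_guarantee p : \int[mu]_v sale p p v <= pis.
Proof.
apply/ler_addgt0Pr => e e0.
have e2 : p - e < p - e / 2 by rewrite ltrD2l ltrN2 ltr_pdivrMr//; lra.
have b1 := bm_2 (bm_sale p p).
have b2 : bounded_measurable (fun w : Om => alpha (p - e, w.1.2) * margin (p - e) w.2).
  by apply: bmM; [exact: bm_alpha | exact: (bm_2 (bm_margin _))].
have b3 : bounded_measurable (fun w : Om => alpha (p - e, w.1.2) * margin (p - e) w.2 + e).
  by apply: bmD => //; exact: bm_cst.
rewrite -(PE (bm_sale p p)); apply: (@le_trans _ _ (\int[P]_w (alpha (p - e, w.1.2) * margin (p - e) w.2 + e))); last first.
  by rewrite (ED P b2 (bm_cst _ e)) E_cst lerD2r; exact: posted_price.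
rewrite -lee_fin -!bm_integralE//; apply: le_integral_ae_arbitrary.
apply: filterS2 informed (ae_accept e2) => w [tv Vv] acc.
have /andP[a0 a1] := alpha01 (p - e, w.1.2); have g0 := gain_ge0 Vv.
rewrite lee_fin /sale /margin mem_set//= !mul1r.
case: (leP p w.2) => pv; first by rewrite acc ?mul1r; lra.
have [m0|m0] := leP 0 (p - e - c w.2); first by rewrite addr_ge0// ?mulr_ge0// ltW.
nra.
Qed.

Let m_ts : measurable_fun setT (fun w : Om => w.1.1).
Proof. exact: measurableT_comp. Qed.

Let sigma_om : R.-pker Om ~> R := kprecomp m_ts sigma.

Let m_ptb : measurable_fun setT (fun x : Om * R => (x.2, x.1.1.2)).
Proof. by apply: measurable_fun_pair => //; exact: (measurableT_comp m_tb measurable_fst). Qed.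

Let m_price (w : Om) : measurable_fun setT (fun p : R => (p, w.1.2)).
Proof. exact: measurable_fun_pair. Qed.

Let m_pair_price (w : Om) : measurable_fun setT (fun p : R => (w, p)).
Proof. exact: pair1_measurable. Qed.

(* On path, the buyer never pays a price above [q] for a value below [q]; [q] is
   fixed because Bayes' rule is only available on rectangles. *)
Let ae_reject q : {ae P, forall w, {ae sigma w.1.1, forall p,
  w.1.2 <= q -> q < p -> alpha (p, w.1.2) = 0}}.
Proof.
have [_ [reject _ bayes]] := equil.
pose A := [set x : R * R | (x.2 <= q /\ q < x.1) /\ 0 < alpha x].
pose B : set R := `]q, +oo[%classic.
have mB : measurable B by exact: measurable_itv.
have mA : measurable A.
  rewrite (_ : A = (`]q, +oo[%classic `*` `]-oo, q]%classic) `&` alpha @^-1` `]0, +oo[%classic).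
    apply: measurableI; first by apply: measurableX; exact: measurable_itv.
    by rewrite -[X in measurable X]setTI; exact: m_alpha2.
  apply/seteqP; split => x /=; rewrite !in_itv/= !andbT.
    by move=> [[h1 h2] h3].
  by move=> [[h1 h2] h3].
pose k (x : Om * R) : \bar R := ((\1_A (x.2, x.1.1.2))%:E * nu (x.2, x.1.1.2) B)%E.
have k0 x : (0 <= k x)%E by rewrite mule_ge0// lee_fin.
have mk : measurable_fun setT k.
  apply: emeasurable_funM.
    apply/measurable_EFinP.
    exact: (measurableT_comp (measurable_indic mA) m_ptb).
  exact: (measurableT_comp (measurable_kernel nu _ mB) m_ptb).
have mg := measurable_fun_integral_finite_kernel k sigma_om k0 mk.
have g0 : {ae P, forall w, (\int[sigma w.1.1]_p k (w, p) = 0)%E}.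
  apply: ge0_integral_eq0_ae => // [w|]; first exact: integral_ge0.
  (* The event on the right of Bayes' rule is empty almost surely: a signal at most [q] equals the
     value, which then is not in [B]. *)
  rewrite [LHS](bayes A B mA mB) /jointE -[RHS](integral0 P setT).
  apply: eq_integral_ae_arbitrary; apply: filterS informed => w [tv Vv].
  rewrite -[RHS](integral0 (sigma w.1.1) setT).
  apply: eq_integral => p _; congr EFin; rewrite !indicE.
  have [/[!inE] -[[/= wq _] _]|_] := boolP ((p, w.1.2) \in A); last by rewrite mul0r.
  by rewrite memNset ?mulr0// /B/= in_itv/= andbT -tv ltNge wq.
apply: filterS g0 => w /ge0_integral_eq0_ae => /(_ (measurableT_comp mk (m_pair_price w)) (fun p => k0 _)).
apply: filterS => p kp wq qp; apply/eqP; apply: contraT => ap.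
have Ap : A (p, w.1.2).
  by split => //; rewrite lt_neqAle eq_sym ap; case/andP: (alpha01 (p, w.1.2)).
have nuB : nu (p, w.1.2) B = 0%E by move: kp; rewrite /k/= indicE mem_set// mul1e.
have [Q QE] := measure_probability (prob_kernel (s := nu) (p, w.1.2)).
suff : (belief_mean nu p w.1.2 < p%:E)%E by move=> /reject a0; rewrite a0 eqxx in ap.
apply: (@le_lt_trans _ _ q%:E); last by rewrite lte_fin.
have <- : (\int[Q]_v q%:E = q%:E)%E by rewrite integral_cst// [X in (_ * X)%E]probability_setT mule1.
have QB : (Q : set R -> \bar R) B = 0%E by rewrite QE.
rewrite /belief_mean -QE; apply: le_integral_ae_arbitrary; exists B; split => //.
by move=> v /=; rewrite /B/= in_itv/= andbT lee_fin => /negP; rewrite -ltNge.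
Qed.

(** A price above the value is separated from it by a rational [q], and [ae_reject] discards only
    countably many null sets. *)
Let ae_rational : {ae P, forall w, {ae sigma w.1.1, forall p, 0 <= alpha (p, w.1.2) * (w.2 - p)}}.
Proof.
pose q (n : nat) : R := ratr (odflt 0 (unpickle n)).
have := ae_foralln (fun n => ae_reject (q n)).
apply: filterS2 informed => w [tv _] /ae_foralln.
apply: filterS => p H; have [pv|vp] := leP p w.2.
  by rewrite mulr_ge0 ?subr_ge0//; case/andP: (alpha01 (p, w.1.2)).
have [r /[!in_itv]/= /andP[vr rp]] := rat_in_itvoo vp.
by rewrite (H (pickle r)) ?mul0r// /q pickleK//= tv ltW.
Qed.

(** By [ae_rational] the positive part changes nothing on path; it provides the everywhere
    nonnegative integrand that measurability of kernel integrals calls for. *)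
Let buyer_rent (x : Om * R) : \bar R := (Num.max (alpha (x.2, x.1.1.2) * (x.1.2 - x.2)) 0)%:E.

Let m_buyer_rent : measurable_fun setT buyer_rent.
Proof.
apply/measurable_EFinP; apply: measurable_maxr; last exact: measurable_cst.
apply: measurable_funM; first exact: (measurableT_comp m_alpha2 m_ptb).
by apply: measurable_funB => //; exact: measurableT_comp.
Qed.

Let buyer_rent_ge0 x : (0 <= buyer_rent x)%E.
Proof. by rewrite lee_fin le_max lexx orbT. Qed.

Let J (w : Om) := (\int[sigma_om w]_p buyer_rent (w, p))%E.

Let mJ : measurable_fun setT J.
Proof. exact: (measurable_fun_integral_finite_kernel buyer_rent sigma_om). Qed.

Let J_ge0 w : (0 <= J w)%E.
Proof. exact: integral_ge0. Qed.

Let JE : (\int[P]_w J w = pib%:E)%E.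
Proof.
rewrite -buyerE; apply: eq_integral_ae_arbitrary; apply: filterS ae_rational => w H.
apply: eq_integral_ae_arbitrary; apply: filterS H => p H.
by rewrite /buyer_rent/= max_l.
Qed.

Lemma buyer_ge0 : 0 <= pib.
Proof. by rewrite -lee_fin -JE; exact: integral_ge0. Qed.

(** Given the outcome, the seller gets the realized gain from trade minus the rent, and the former
    is at most the full gain. Prices being unbounded, the subtraction is legitimate because [pib] is
    finite: the rent is integrable, hence finite for almost every outcome. *)
Lemma payoffs_le_surplus : pib + pis <= \int[mu]_v gain v.
Proof.
have intJ : P.-integrable setT J.
  apply/integrableP; split => //.
  by under eq_integral do rewrite gee0_abs//; rewrite JE ltry.
have bg := bm_2 bm_gain.
suff : (pis%:E <= \int[P]_w ((gain w.2)%:E - J w))%E.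
  rewrite integralB//; last exact: (bm_integrable P bg).
  by rewrite JE (bm_integralE P bg) (PE bm_gain) -EFinB lee_fin; lra.
rewrite -sellerE; apply: le_integral_ae_arbitrary.
have finJ := integrable_ae measurableT intJ.
have info := informed.
apply: filterS3 info ae_rational finJ => w [tv Vv] rat /(_ I) Jfin.
have [Q QE] := measure_probability (prob_kernel (s := sigma) w.1.1).
have m1 : measurable_fun setT (fun p => alpha (p, w.1.2)).
  exact: (measurableT_comp m_alpha2 (m_price w)).
have b1 : bm1 (fun p => alpha (p, w.1.2) * (w.2 - c w.2)).
  apply: bmM; last exact: bm_cst.
  by apply: (bm_le (M := 1)) => // p; have /andP[a0 a1] := alpha01 (p, w.1.2); rewrite ger0_norm.
have m2 : measurable_fun setT (fun p => buyer_rent (w, p)).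
  exact: (measurableT_comp m_buyer_rent (m_pair_price w)).
have JQ : J w = (\int[Q]_p buyer_rent (w, p))%E by rewrite QE.
have i2 : Q.-integrable setT (fun p => buyer_rent (w, p)).
  apply/integrableP; split => //.
  under eq_integral do rewrite gee0_abs//.
  by rewrite -JQ ltey_eq Jfin.
apply: (@le_trans _ _ (\int[Q]_p ((alpha (p, w.1.2) * (w.2 - c w.2))%:E - buyer_rent (w, p)))%E).
  rewrite le_eqVlt; apply/orP; left; apply/eqP; rewrite QE.
  apply: eq_integral_ae_arbitrary; apply: filterS rat => p H.
  by rewrite /buyer_rent/= max_l// -EFinB; congr EFin; ring.
rewrite integralB//; last exact: (bm_integrable Q b1).
rewrite -JQ leeB// gainE// bm_integralE// lee_fin -[leRHS](E_cst Q).
apply: (E_le Q b1 (bm_cst _ _)) => p; have /andP[a0 a1] := alpha01 (p, w.1.2).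
by rewrite ler_piMl// gain_ge0.
Qed.

End Necessity.

Lemma fb_payoffs_necessary pib pis : Pi_fb V c mu pib pis ->
  [/\ 0 <= pib, (pis_low c vlo mu <= pis%:E)%E,
      ((pib + pis)%:E <= surplus c mu)%E & (pis_fb c mu <= pis%:E)%E].
Proof.
move=> [Ts [_ [_ [P [PV [PI [sigma [alpha [nu [eq [ind [Eb Es]]]]]]]]]]]].
have fb : (pis_fb c mu <= pis%:E)%E.
  by apply/pis_fb_le => p; exact: (seller_guarantee PV PI eq ind Es).
split => //.
- exact: (buyer_ge0 PV PI eq Eb).
- exact: le_trans pis_low_le_fb fb.
- by rewrite surplusE lee_fin; exact: (payoffs_le_surplus PV PI eq Eb Es).
Qed.

Lemma fb_payoffs_sufficient pib pis : vlo < vhi -> 0 <= pib ->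
  ((pib + pis)%:E <= surplus c mu)%E -> (pis_fb c mu <= pis%:E)%E ->
  Pi_fb V c mu pib pis.
Proof.
move=> lohi b0; rewrite surplusE lee_fin => bs fb.
have fb0 : (0 <= pis_fb c mu)%E by apply: le_trans pis_low_le_fb; rewrite /pis_low le_max lexx orbT.
pose pi0 := fine (pis_fb c mu).
have pi0E : pis_fb c mu = pi0%:E.
  by rewrite fineK// ge0_fin_numE// (le_lt_trans fb)// ltry.
have pi_ub : forall p, \int[mu]_v sale p p v <= pi0 by apply/pis_fb_le; rewrite pi0E.
have pi_lub y : (forall p, \int[mu]_v sale p p v <= y) -> pi0 <= y.
  by move=> /pis_fb_le; rewrite pi0E.
have pi_pis : pi0 <= pis by rewrite -lee_fin -pi0E.
set S := \int[mu]_v gain v in bs.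
(* Barycentric coordinates in the triangle with vertices [(S - pi0, pi0)], [(0, pi0)] and [(0, S)].
   If [S <= pi0], the constraints force [pib = 0] and [pis = pi0 = S]. *)
have [ae [ai [af [[ae0 ai0 af0 a1] sE bE]]]] : exists ae ai af,
    [/\ [/\ 0 <= ae, 0 <= ai, 0 <= af & ae + ai + af = 1],
        (ae + ai) * pi0 + af * S = pis & ae * (S - pi0) = pib].
  have [SD|DS] := leP S pi0.
    by exists 0, 0, 1; split; [split; lra | lra | lra].
  have D0 : 0 < S - pi0 by rewrite subr_gt0.
  have ai0 : 0 <= 1 - pib / (S - pi0) - (pis - pi0) / (S - pi0).
    by rewrite -addrA -opprD -mulrDl subr_ge0 ler_pdivrMr// mul1r; lra.
  exists (pib / (S - pi0)), (1 - pib / (S - pi0) - (pis - pi0) / (S - pi0)), ((pis - pi0) / (S - pi0)).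
  split; last by rewrite divfK// gt_eqF.
    by split; rewrite ?divr_ge0 ?(ltW D0)// ?subr_ge0//; ring.
  by field; rewrite gt_eqF.
have [T [mT T_itv ob Es Eb]] := limit_law lohi ae0 ai0 af0 a1 pi_ub pi_lub.
by rewrite -bE -sE -Es -Eb; exact: (equilibrium_payoffs mT T_itv ob).
Qed.

End Environment.

Theorem theorem3 (R : realType) (V : set R) (vlo vhi : R)
  (mu : probability R R) (c : R -> R) :
  compact V -> V vlo -> V vhi -> (forall v, V v -> vlo <= v <= vhi) ->
  vlo < vhi ->
  msupport mu = V ->
  {within V, continuous c} ->
  (forall v, V v -> 0 <= v - c v) ->
  (0 < surplus c mu)%E ->
  forall pib pis : R,
    Pi_fb V c mu pib pis <->
    [/\ 0 <= pib,
        (pis_low c vlo mu <= pis%:E)%E,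
        ((pib + pis)%:E <= surplus c mu)%E &
        (pis_fb c mu <= pis%:E)%E].
Proof.
move=> Vc Vlo Vhi Vi lohi suppV cc g0 _ pib pis; split.
  exact: (fb_payoffs_necessary Vc Vi suppV cc g0).
by move=> [b0 _ bs fb]; apply: (fb_payoffs_sufficient (vlo := vlo) (vhi := vhi)).
Qed.
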